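(* Let $J\subset\mathbb{R}$ be an open interval containing $0$, let $f_0:J\to\mathbb{L}^3$ be a regular smooth timelike curve, and let $V:J\to\mathbb{L}^3$ be a regular (nowhere vanishing) smooth vector field along $f_0$ which is everywhere orthogonal to $\frac{df_0}{dt}$ and satisfies $\langle V(t),V(t)\rangle=-\langle \frac{df_0}{dt}(t),\frac{df_0}{dt}(t)\rangle$ for all $t\in J$. Let $H\neq 0$ be a real number. Set $J^-=\{y\in\mathbb{R} : -y\in J\}$, let $M=J\times J^-$ with coordinates $(x,y)$, and set $\Delta=\{(x,-x) : x\in J\}\subset M$. Then: (1) There is an open subset $W\subset M$ containing $\Delta$, and a unique timelike CMC $H$ immersion $f:W\to\mathbb{L}^3$, with Lorentz isothermal coordinates $(u,v)=\left(\frac12(x-y),\frac12(x+y)\right)$, satisfying $$f(u,0)=f_0(u)\qquad\text{and}\qquad \frac{\partial f}{\partial v}(u,0)=V(u).$$ (2) The surface so constructed is the unique solution, in the sense specified in the context, of the non-characteristic geometric Cauchy problem for the data $(f_0,V)$, with the orientation given by $\frac{df_0}{dt}\wedge V$.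
   Context: $\mathbb{L}^3$ is Lorentz–Minkowski 3-space with metric $\langle\cdot,\cdot\rangle$ of signature $(-,+,+)$. It is identified with $\mathfrak{sl}(2,\mathbb{R})$, $\langle X,Y\rangle=\frac12\operatorname{trace}(XY)$, with orthonormal basis $$e_0=\begin{pmatrix}0&-1\\1&0\end{pmatrix},\quad e_1=\begin{pmatrix}0&1\\1&0\end{pmatrix},\quad e_2=\begin{pmatrix}-1&0\\0&1\end{pmatrix},\qquad \langle e_0,e_0\rangle=-1,$$ and is oriented by $(e_0,e_1,e_2)$. A timelike immersion $f$ of a 2-manifold into $\mathbb{L}^3$ is one whose induced metric has signature $(-,+)$; the domain carries the induced Lorentz conformal structure. Coordinates $(x,y)$ are null if the induced metric has the form $\varepsilon e^{\omega}\,dx\,dy$ with $\varepsilon=\pm1$; the associated Lorentz isothermal coordinates are $u=\frac12(x-y)$, $v=\frac12(x+y)$, and when $\varepsilon=1$ the metric is $e^{\omega}(-du^2+dv^2)$. In that case the unit normal $N$ is chosen so that $(f_u,f_v,N)$ is positively oriented. The mean curvature is $H=2\varepsilon e^{-\omega}\langle f_{xy},N\rangle$. A timelike CMC $H$ surface (immersion) is a timelike immersion whose mean curvature is constant and equal to $H$. Non-characteristic geometric Cauchy problem: given $(f_0,V)$ as in the claim, find a timelike CMC $H$ surface $f$ which contains the curve $f_0$ and is tangent along this curve to the plane spanned by $df_0/dt$ and $V$. ''With the orientation given by $\frac{df_0}{dt}\wedge V$'' means that along the curve the surface is oriented so that $(df_0/dt,V)$ is a positively oriented basis of its tangent plane (and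 the unit normal $N$, hence the sign of $H$, is taken accordingly, that is, so that $(df_0/dt,V,N)$ is a positively oriented basis of $\mathbb{L}^3$ along the curve). Uniqueness of the solution means: given two solutions $f:M_1\to\mathbb{L}^3$ and $\tilde f:\tilde M_1\to\mathbb{L}^3$, then at any point $p=f_0(t_0)$ of the initial curve, with $f(z_0)=\tilde f(\tilde z_0)=p$, where $z_0$ and $\tilde z_0$ are the points of the two domains corresponding to the parameter $t_0$ of the initial curve, there are neighbourhoods $U$ of $z_0$ and $\tilde U$ of $\tilde z_0$ and an isometry $\phi:U\to\tilde U$ (for the induced metrics) such that $f=\tilde f\circ\phi$. *)

(* Defs.v *)
From HB Require Import structures.
From mathcomp Require Import all_boot all_order all_algebra.
From mathcomp Require Import all_classical all_reals all_analysis.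
From mathcomp Require Import ring lra.
Import Order.TTheory GRing.Theory Num.Theory numFieldNormedType.Exports.

Set Implicit Arguments.
Unset Strict Implicit.
Unset Printing Implicit Defensive.

Local Open Scope classical_set_scope.
Local Open Scope ring_scope.

Section Lorentz_Minkowski.
Variable R : realType.
Implicit Types X Y Z : 'rV[R]_3.

(* Row vectors hold the coordinates in the oriented orthonormal basis
   (e0, e1, e2). *)
Definition lprod X Y : R := - (X 0 0 * Y 0 0) + X 0 1 * Y 0 1 + X 0 2 * Y 0 2.

Definition e0 : 'M[R]_2 := delta_mx 1 0 - delta_mx 0 1.
Definition e1 : 'M[R]_2 := delta_mx 0 1 + delta_mx 1 0.
Definition e2 : 'M[R]_2 := delta_mx 1 1 - delta_mx 0 0.

Definition sl2 X : 'M[R]_2 := X 0 0 *: e0 + X 0 1 *: e1 + X 0 2 *: e2.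

Lemma lprod_sl2 X Y : lprod X Y = 2^-1 * \tr (sl2 X *m sl2 Y).
Proof.
rewrite /lprod /mxtrace !(big_ord_recl, big_ord0, mxE) /=.
by field.
Qed.

Definition positively_oriented X Y Z : Prop :=
  0 < \det (col_mx X (col_mx Y Z) : 'M[R]_3).

End Lorentz_Minkowski.

Section Smooth.
Variable R : realType.

(* Class C^n; [D] is meant to be open. *)
Fixpoint Cn (U V : normedModType R) (n : nat) (D : set U) (f : U -> V) : Prop :=
  if n is m.+1
  then (forall p, D p -> differentiable f p) /\ forall v, Cn m D ('D_v f)
  else forall p, D p -> {for p, continuous f}.

Definition smooth (U V : normedModType R) (D : set U) (f : U -> V) : Prop :=
  forall n, Cn n D f.

Lemma near_eq_differentiable (U V : normedModType R) (f g : U -> V) (p : U) :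
  (\near p, f p = g p) -> differentiable f p -> differentiable g p.
Proof.
move=> fg df; have fgp := nbhs_singleton fg.
have dg : g \o shift p = cst (g p) + 'd f p +o_ 0 id.
  apply/eqaddoP => e e0; move/eqaddoP: (diff_locally df) => /(_ e e0).
  apply: filter_app; have : \forall h \near 0, f (h + p) = g (h + p).
    have cp : h + p @[h --> (0 : U)] --> p.
      rewrite -[X in _ --> X]add0r.
      by apply: cvgD; [exact: cvg_id|exact: cvg_cst].
    exact: cp _ fg.
  by apply: filterS => h; rewrite !fctE /= fgp => ->.
have dfg : 'd g p = 'd f p :> (U -> V) := diff_unique (diff_continuous df) dg.
by apply/diff_locallyP; rewrite dfg; split => //; exact: diff_continuous.
Qed.

Lemma eq_Cn (U V : normedModType R) n (D : set U) (f g : U -> V) :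
  open D -> (forall p, D p -> f p = g p) -> Cn n D f -> Cn n D g.
Proof.
move=> oD; elim: n f g => [|n IHn] f g fg.
  move=> cf p Dp; have fgp : \near p, f p = g p.
    by move: (open_nbhs_nbhs (conj oD Dp)); apply: filterS.
  rewrite /prop_for /continuous_at -(fg p Dp).
  by apply: cvg_trans (cf p Dp); exact: near_eq_cvg.
have fgn p : D p -> \near p, f p = g p.
  by move=> Dp; move: (open_nbhs_nbhs (conj oD Dp)); apply: filterS.
case=> df Df; split=> [p Dp|v].
  exact: near_eq_differentiable (fgn p Dp) (df p Dp).
by apply: IHn (Df v) => p Dp; apply: near_eq_derive; exact: fgn.
Qed.

Lemma smooth_id (U : normedModType R) (D : set U) : smooth D id.
Proof.
have Ccst n c : Cn n D (cst c : U -> U).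
  elim: n c => [|n IHn] c; first by move=> p _; exact: cvg_cst.
  split=> // v; rewrite (_ : 'D_v _ = cst 0) //.
  by apply/funext => p; rewrite derive_cst.
case=> [p _|n]; first exact: cvg_id.
split=> [p _|v]; first by [].
by rewrite (_ : 'D_v _ = cst v) //; apply/funext => p; rewrite derive_id.
Qed.

End Smooth.

Section Surfaces.
Variable R : realType.

(* The values of [cinv] outside of [cimg] are irrelevant. *)
Record chart (T : topologicalType) := Chart {
  cdom : set T;
  cfun : T -> R * R;
  cinv : R * R -> T;
  cdom_open : open cdom;
  cimg_open : open (cfun @` cdom);
  cfunK : forall p, cdom p -> cinv (cfun p) = p;
  cfun_continuous : forall p, cdom p -> {for p, continuous cfun};
  cinv_continuous : forall z, (cfun @` cdom) z -> {for z, continuous cinv} }.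

Definition cimg (T : topologicalType) (k : chart T) : set (R * R) :=
  cfun k @` cdom k.

Definition compatible (T : topologicalType) (k l : chart T) : Prop :=
  smooth (cfun k @` (cdom k `&` cdom l)) (cfun l \o cinv k) /\
  smooth (cfun l @` (cdom k `&` cdom l)) (cfun k \o cinv l).

Record surface := Surface {
  points :> topologicalType;
  surface_hausdorff : hausdorff_space points;
  surface_second_countable : @second_countable points;
  atlas : set (chart points);
  atlas_cover : forall p, exists2 k, atlas k & cdom k p;
  atlas_compatible : forall k l, atlas k -> atlas l -> compatible k l }.

(* [k] belongs to the maximal atlas. *)
Definition coordinates (M : surface) (k : chart M) : Prop :=
  forall l, atlas l -> compatible k l.

Section Open_subset.
Variables (W : set (R * R)) (oW : open W).

Lemma hausdorff_W : hausdorff_space W.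
Proof.
have hp : hausdorff_space (R * R)%type by exact: norm_hausdorff.
move: hp; rewrite !open_hausdorff => hp p q pq.
have /hp[[A B] [/= Ap Bq] [oA oB AB0]] : \val p != \val q.
  by apply: contra pq => /eqP/val_inj ->.
exists (set_val @^-1` A, set_val @^-1` B) => /=.
  by move: Ap Bq; rewrite !inE.
split; [by exists A|by exists B|].
apply/eqP; rewrite -preimage_setI.
by move/eqP: AB0 => ->; rewrite preimage_set0.
Qed.

Lemma second_countable_W : @second_countable W.
Proof.
pose r n : R := n.+1%:R^-1.
have r0 n : 0 < r n by rewrite invr_gt0.
pose box (q : (rat * rat) * nat) : set W :=
  set_val @^-1` ball ((ratr q.1.1 : R), (ratr q.1.2 : R)) (r q.2).
exists (range box).
  exact: card_le_trans (card_image_le _ _) (countableP _).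
have obox q : open (box q).
  exists (ball ((ratr q.1.1 : R), (ratr q.1.2 : R)) (r q.2)) => //.
  exact: ball_open.
split=> [_ [q _ <-]//|p U].
rewrite nbhsE => -[_ [[A oA <-] Ap] AU].
have /nbhs_ballP[e /= egt0 eA] : nbhs (\val p) A by exact: open_nbhs_nbhs.
have [n nP] : exists n, r n < e / 2.
  have := near_infty_natSinv_lt (PosNum (divr_gt0 egt0 (ltr0Sn R 1))).
  by case=> n _ /(_ n (leqnn n)); exists n.
have near_rat x : exists q : rat, `|x - ratr q| < r n.
  have /rat_in_itvoo[q] : x - r n < x + r n.
    by rewrite ltrBlDr -addrA ltrDl addr_gt0.
  by rewrite in_itv /= => /andP[xq qx]; exists q; rewrite ltr_distlC; lra.
have [q1 q1P] := near_rat (\val p).1.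
have [q2 q2P] := near_rat (\val p).2.
exists (box ((q1, q2), n)).
  split; first by exists ((q1, q2), n).
  by split; rewrite /ball /= distrC.
move=> s bs; apply: AU; apply: eA.
have [s1 s2] : ball (ratr q1 : R) (r n) (\val s).1 /\
  ball (ratr q2 : R) (r n) (\val s).2 by exact: bs.
have ler : r n + r n <= e by lra.
split; apply: (le_ball ler); first exact: ball_triangle s1.
exact: ball_triangle s2.
Qed.

(* [W] with the inclusion into [R * R] as global coordinates. *)
Definition open_atlas : set (chart W) :=
  [set k | cdom k = setT /\ forall s, cfun k s = set_val s].

Lemma cover_W p : exists2 k, open_atlas k & cdom k p.
Proof.
pose inv (z : R * R) : W := insubd p z.
have valI : set_val @` [set: W] = W.
  apply/seteqP; split=> [_ [s _ <-]|z Wz]; first exact: set_valP.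
  by exists (SigSub (mem_set Wz)).
have oI : open (set_val @` [set: W]) by rewrite valI.
have invK s : [set: W] s -> inv (set_val s) = s by move=> _; exact: valKd.
have cval s : [set: W] s -> {for s, continuous (@set_val _ W)}.
  by move=> _; exact: initial_continuous.
have cinvW z : (set_val @` [set: W]) z -> {for z, continuous inv}.
  rewrite valI => Wz U; rewrite nbhsE => -[_ [[A oA <-] Az] AU].
  have invE y : W y -> set_val (inv y) = y.
    by move=> Wy; rewrite set_valE insubdK // inE.
  have : nbhs z (A `&` W).
    apply: open_nbhs_nbhs; split; first exact: openI.
    by split; rewrite // -(invE z Wz).
  by apply: filterS => y [Ay Wy]; apply: AU; rewrite /preimage /= invE.
by exists (Chart openT oI invK cval cinvW).
Qed.

Lemma compatible_W k l : open_atlas k -> open_atlas l -> compatible k l.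
Proof.
have half k' l' : open_atlas k' -> open_atlas l' ->
    smooth (cfun k' @` [set: W]) (cfun l' \o cinv k').
  move=> [k'T k'E] [l'T l'E] n.
  apply: eq_Cn (smooth_id _ n); first by rewrite -k'T; exact: cimg_open.
  by move=> _ [s _ <-] /=; rewrite cfunK ?k'T// k'E l'E.
move=> ak al; have [kT _] := ak; have [lT _] := al.
by rewrite /compatible kT lT setIT; split; exact: half.
Qed.

Definition open_surface : surface :=
  Surface hausdorff_W second_countable_W cover_W compatible_W.

Definition open_incl : open_surface -> R * R := @set_val _ W.

End Open_subset.

Arguments open_incl [W] oW _.

Definition smooth_map (V : normedModType R) (M : surface) (f : M -> V) : Prop :=
  forall k, atlas k -> smooth (cimg k) (f \o cinv k).

Definition smooth_curve (M : surface) (J : set R) (c : R -> M) : Prop :=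
  (forall t, J t -> {for t, continuous c}) /\
  forall k, atlas k -> smooth (J `&` c @^-1` cdom k) (cfun k \o c).

Definition smooth_between (M1 M2 : surface) (U : set M1) (phi : M1 -> M2) :
    Prop :=
  (forall p, U p -> {for p, continuous phi}) /\
  forall k l, atlas k -> atlas l ->
    smooth (cfun k @` (U `&` cdom k `&` phi @^-1` cdom l))
           (cfun l \o phi \o cinv k).

Definition first_form (F : R * R -> 'rV[R]_3) (z a b : R * R) : R :=
  lprod ('D_a F z) ('D_b F z).

Definition signature_neg_pos (g : R * R -> R * R -> R) : Prop :=
  exists a b, [/\ g a a < 0, 0 < g b b & g a b = 0].

Definition immersion (M : surface) (f : M -> 'rV[R]_3) : Prop :=
  smooth_map f /\
  forall k z, atlas k -> cimg k z ->
    forall a, 'D_a (f \o cinv k) z = 0 -> a = 0.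

Definition timelike_immersion (M : surface) (f : M -> 'rV[R]_3) : Prop :=
  immersion f /\
  forall k z, atlas k -> cimg k z ->
    signature_neg_pos (first_form (f \o cinv k) z).

(* The metric is [eps * e^w dx dy], where [dx dy] is the symmetric product of
   one-forms, so that [dx dy = - du^2 + dv^2]. *)
Definition null_metric (D : set (R * R)) (F : R * R -> 'rV[R]_3)
    (eps : R) (w : R * R -> R) : Prop :=
  (eps = 1 \/ eps = -1) /\
  forall z a b, D z ->
    first_form F z a b = eps * expR (w z) * ((a.1 * b.2 + a.2 * b.1) / 2).

Definition null_coordinates (M : surface) (f : M -> 'rV[R]_3) (k : chart M)
    (eps : R) (w : R * R -> R) : Prop :=
  coordinates k /\ null_metric (cimg k) (f \o cinv k) eps w.

Definition unit_normal (M : surface) (f N : M -> 'rV[R]_3) : Prop :=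
  [/\ smooth_map N, forall p, lprod (N p) (N p) = 1 &
      forall k z a, atlas k -> cimg k z ->
        lprod ('D_a (f \o cinv k) z) (N (cinv k z)) = 0].

(* Meaningful only when the coordinates are null, with metric
   [eps * e^w dx dy]. *)
Definition mean_curvature (F n : R * R -> 'rV[R]_3) (eps : R)
    (w : R * R -> R) (z : R * R) : R :=
  2 * eps * expR (- w z) * lprod ('D_(0, 1) ('D_(1, 0) F) z) (n z).

(* Every point of a timelike surface has null coordinates around it, and the
   value of the formula does not depend on their choice. *)
Definition constant_mean_curvature (H : R) (M : surface)
    (f N : M -> 'rV[R]_3) : Prop :=
  forall k eps w, null_coordinates f k eps w -> forall z, cimg k z ->
    mean_curvature (f \o cinv k) (N \o cinv k) eps w z = H.

Definition timelike_cmc (H : R) (M : surface) (f N : M -> 'rV[R]_3) : Prop :=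
  [/\ timelike_immersion f, unit_normal f N & constant_mean_curvature H f N].

Definition tangent_plane (M : surface) (f : M -> 'rV[R]_3) (p : M) :
    set 'rV[R]_3 :=
  [set X | exists2 k, atlas k /\ cdom k p &
             exists a, X = 'D_a (f \o cinv k) (cfun k p)].

Definition plane_spanned_by (X Y : 'rV[R]_3) : set 'rV[R]_3 :=
  [set Z | exists a b : R, Z = a *: X + b *: Y].

(* Solutions of the non-characteristic geometric Cauchy problem; [c] is the
   initial curve in the surface, with [c t] corresponding to the parameter
   [t]. *)
Definition geometric_cauchy_solution (J : set R) (f0 V : R -> 'rV[R]_3) (H : R)
    (M : surface) (f : M -> 'rV[R]_3) (c : R -> M) : Prop :=
  [/\ smooth_curve J c,
      forall t, J t -> f (c t) = f0 t,
      forall t, J t ->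
        tangent_plane f (c t) = plane_spanned_by (derive1 f0 t) (V t) &
      exists2 N, timelike_cmc H f N &
        forall t, J t -> positively_oriented (derive1 f0 t) (V t) (N (c t))].

Definition surface_isometry (M1 M2 : surface) (f1 : M1 -> 'rV[R]_3)
    (f2 : M2 -> 'rV[R]_3) (U1 : set M1) (U2 : set M2) (phi : M1 -> M2) :
    Prop :=
  [/\ phi @` U1 = U2,
      smooth_between U1 phi,
      exists2 psi, smooth_between U2 psi & forall p, U1 p -> psi (phi p) = p &
      forall k l p a b, atlas k -> atlas l ->
        U1 p -> cdom k p -> cdom l (phi p) ->
        let Phi := cfun l \o phi \o cinv k in
        first_form (f2 \o cinv l) (cfun l (phi p))
          ('D_a Phi (cfun k p)) ('D_b Phi (cfun k p)) =
        first_form (f1 \o cinv k) (cfun k p) a b].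

(* [f], a function of the null coordinates [(x, y)], in terms of
   [(u, v) = ((x - y) / 2, (x + y) / 2)]. *)
Definition in_isothermal (f : R * R -> 'rV[R]_3) (q : R * R) : 'rV[R]_3 :=
  f (q.1 + q.2, q.2 - q.1).

Definition cmc_with_cauchy_data (J : set R) (f0 V : R -> 'rV[R]_3) (H : R)
    (W : set (R * R)) (oW : open W) (f : R * R -> 'rV[R]_3) : Prop :=
  [/\ exists eps w, null_metric W f eps w,
      exists2 N : R * R -> 'rV[R]_3,
        timelike_cmc H (f \o open_incl oW) (N \o open_incl oW) &
        forall u v, W (u + v, v - u) ->
          positively_oriented ('D_(1, 0) (in_isothermal f) (u, v))
            ('D_(0, 1) (in_isothermal f) (u, v)) (N (u + v, v - u)),
      forall u, J u -> in_isothermal f (u, 0) = f0 u &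
      forall u, J u -> 'D_(0, 1) (in_isothermal f) (u, 0) = V u].

End Surfaces.

Arguments open_incl [R W] oW _.

(* Main.v *)
(** In null coordinates [(x, y)], a timelike immersion [f] has constant mean
    curvature [H] exactly when [f_xy = H *: lcross f_x f_y], with the Lorentzian
    cross product and null vectors [f_x], [f_y]. This is a semilinear hyperbolic
    system for [(f, f_x, f_y)], and [(f0, V)] amounts to the initial values
    [f_x = (f0' + V) / 2] and [f_y = (V - f0') / 2] on the line [y = - x].

    A system which prescribes, for each unknown, its derivative along one of the
    coordinate directions has a unique solution on a small square whose diagonal
    lies on that line (Picard iteration and Gronwall's inequality). The solution
    is as smooth as the data, because its remaining first derivatives satisfy a
    linear system of the same kind. As the intersection of two such squares is
    again one, the local solutions of the Cauchy problem glue together.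

    On an arbitrary solution surface, a flow box for each of the two null fields
    transverse to the curve gives a function constant along that field; the pair
    of these functions is a null chart mapping the curve to [y = - x]. The flow
    of a vector field starting from the curve is itself a system of the kind
    above, and is inverted by the inverse function theorem. In these charts all
    solutions satisfy the same Cauchy problem; hence they coincide there, and
    the transition between the charts of two solutions is the isometry. *)

Require Import Defs.
From HB Require Import structures.
From mathcomp Require Import all_boot all_order all_algebra.
From mathcomp Require Import all_classical all_reals all_analysis.
From mathcomp Require Import ring lra.
Import Order.TTheory GRing.Theory Num.Theory numFieldNormedType.Exports.

Set Implicit Arguments.
Unset Strict Implicit.
Unset Printing Implicit Defensive.

Local Open Scope classical_set_scope.
Local Open Scope ring_scope.

(** * Maps of class C^n *)

(** The system by itself does not say that its unknowns are derivatives of [f], nor that they are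
    null. Both facts hold on the initial line and are propagated: the differences in question have
    derivative zero along a coordinate line, and so do the square lengths, as a cross product is
    orthogonal to its factors. Positivity of the product of [f_x] and [f_y] is only an open
    condition, and costs a smaller square.

    Entries of the unknown are differentiated in different directions, so the system is not a family
    of ordinary differential equations. Estimates therefore maximise over a compact set, with an
    exponential weight in the distance to the initial line. Truncating the right-hand side lets the
    iteration run on the whole plane; the square has to be small only for the truncation to be
    inactive.

    Mean curvature is prescribed in every null chart, so the constructed surface is also tested in
    charts other than [(x, y)].

    On an abstract surface the null directions are found without square roots: for a timelike
    tangent vector [tau] and [C = F_x x F_y = lam N], the vectors [lam tau + C x tau] and
    [lam tau - C x tau] are null. *)

Section Cn_theory.
Variable R : realType.
Implicit Types U V W : normedModType R.

Lemma Cn_differentiable U V n (D : set U) (f : U -> V) p :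
  Cn n.+1 D f -> D p -> differentiable f p.
Proof. by case=> df _ /df. Qed.

Lemma Cn_derive U V n (D : set U) (f : U -> V) v :
  Cn n.+1 D f -> Cn n D ('D_v f).
Proof. by case=> _ /(_ v). Qed.

Lemma CnW U V n (D : set U) (f : U -> V) : Cn n.+1 D f -> Cn n D f.
Proof.
elim: n f => [|n IHn] f [df Df].
  by move=> p Dp; exact/differentiable_continuous/df.
by split=> // v; exact: IHn (Df v).
Qed.

Lemma Cn_continuous U V n (D : set U) (f : U -> V) p :
  Cn n D f -> D p -> {for p, continuous f}.
Proof. by elim: n f => [|n IHn] f; [move=> cf; exact: cf|move/CnW; exact: IHn]. Qed.

Lemma Cn_subset U V n (D E : set U) (f : U -> V) : E `<=` D -> Cn n D f -> Cn n E f.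
Proof.
move=> ED; elim: n f => [|n IHn] f; first by move=> cf p /ED/cf.
by case=> df Df; split=> [p /ED/df//|v]; apply: IHn; exact: Df.
Qed.

Lemma derive_eq_on U V (D : set U) (f g : U -> V) v p :
  open D -> (forall q, D q -> f q = g q) -> D p -> 'D_v f p = 'D_v g p.
Proof.
move=> oD fg Dp; apply: near_eq_derive.
by apply: filterS fg _; exact: (open_nbhs_nbhs (conj oD Dp)).
Qed.

Lemma Cn_cst U V n (D : set U) (c : V) : Cn n D (cst c : U -> V).
Proof.
elim: n c => [|n IHn] c; first by move=> p _; exact: cvg_cst.
split=> // v; rewrite (_ : 'D_v _ = cst 0) //.
by apply/funext => p; rewrite derive_cst.
Qed.

Lemma CnD U V n (D : set U) (f g : U -> V) : open D ->
  Cn n D f -> Cn n D g -> Cn n D (fun p => f p + g p).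
Proof.
move=> oD; elim: n f g => [|n IHn] f g.
  by move=> cf cg p Dp; apply: cvgD; [exact: cf|exact: cg].
move=> [df Df] [dg Dg]; split=> [p Dp|v].
  by apply: differentiableD; [exact: df|exact: dg].
apply: eq_Cn oD _ (IHn _ _ (Df v) (Dg v)) => p Dp.
by rewrite [RHS]deriveD//; apply: diff_derivable; [exact: df|exact: dg].
Qed.

Lemma Cn_sum U V n (D : set U) (I : Type) (r : seq I) (P : pred I) (f : I -> U -> V) :
  open D -> (forall i, Cn n D (f i)) -> Cn n D (fun p => \sum_(i <- r | P i) f i p).
Proof.
move=> oD fi; elim: r => [|i r IHr].
  apply: eq_Cn oD _ (Cn_cst n D 0) => p _; by rewrite big_nil.
case Pi : (P i); last first.
  by apply: eq_Cn oD _ IHr => p _; rewrite big_cons Pi.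
by apply: eq_Cn oD _ (CnD oD (fi i) IHr) => p _; rewrite big_cons Pi.
Qed.

(** Scalings, matrix entries, pair components and the coordinates of a [frame] are all instances. A
    continuous linear map commutes with ['D_v], so the induction reuses the same map. *)
Lemma Cn_linear U V W n (D : set U) (l : V -> W) (f : U -> V) : open D ->
  linear l -> continuous l -> Cn n D f -> Cn n D (l \o f).
Proof.
move=> oD ll cl.
pose L := HB.pack_for {linear V -> W} l (GRing.isLinear.Build _ _ _ _ l ll).
have dl p : differentiable l p by exact: (@linear_differentiable _ _ _ L).
elim: n f => [|n IHn] f.
  by move=> cf p Dp; apply: continuous_comp; [exact: cf|exact: cl].
move=> [df Df]; split=> [p Dp|v].
  by apply: differentiable_comp => //; exact: df.
apply: eq_Cn oD _ (IHn _ (Df v)) => p Dp /=.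
rewrite !deriveE; [|by apply: differentiable_comp => //; exact: df|exact: df].
have dlE q : 'd l q = l :> (V -> W) by exact: (@diff_lin _ _ _ L).
have -> : 'd (l \o f) p v = 'd l (f p) ('d f p v) by rewrite diff_comp//; exact: df.
by rewrite dlE.
Qed.

Lemma CnZl U V n (D : set U) (k : R) (f : U -> V) : open D ->
  Cn n D f -> Cn n D (fun p => k *: f p).
Proof.
move=> oD; apply: (@Cn_linear _ _ _ _ _ ( *:%R k)) => //.
  by move=> a x y; rewrite scalerDr !scalerA mulrC.
exact: scaler_continuous.
Qed.

Lemma CnZr U V n (D : set U) (k : U -> R) (c : V) : open D ->
  Cn n D k -> Cn n D (fun p => k p *: c).
Proof.
move=> oD; apply: (@Cn_linear U R V n D ( *:%R^~ c) k) => //.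
  by move=> a x y; rewrite scalerDl scalerA.
exact: scalel_continuous.
Qed.

Lemma CnN U V n (D : set U) (f : U -> V) : open D ->
  Cn n D f -> Cn n D (fun p => - f p).
Proof.
by move=> oD /(CnZl (-1) oD); apply: eq_Cn => // p _; rewrite scaleN1r.
Qed.

Lemma CnB U V n (D : set U) (f g : U -> V) : open D ->
  Cn n D f -> Cn n D g -> Cn n D (fun p => f p - g p).
Proof. by move=> oD cf cg; apply: CnD => //; exact: CnN. Qed.

Lemma CnM U n (D : set U) (f g : U -> R) : open D ->
  Cn n D f -> Cn n D g -> Cn n D (fun p => f p * g p).
Proof.
move=> oD; elim: n f g => [|n IHn] f g.
  by move=> cf cg p Dp; apply: cvgM; [exact: cf|exact: cg].
move=> cf cg; have [df Df] := cf; have [dg Dg] := cg; split=> [p Dp|v].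
  by apply: differentiableM; [exact: df|exact: dg].
have := CnD oD (IHn _ _ (CnW cf) (Dg v)) (IHn _ _ (CnW cg) (Df v)).
apply: eq_Cn => // p Dp.
rewrite [RHS]deriveM//; apply: diff_derivable; [exact: df|exact: dg].
Qed.

Lemma CnV U n (D : set U) (f : U -> R) : open D -> (forall p, D p -> f p != 0) ->
  Cn n D f -> Cn n D (fun p => (f p)^-1).
Proof.
move=> oD f0; elim: n f f0 => [|n IHn] f f0.
  by move=> cf p Dp; apply: cvgV; [exact: f0|exact: cf].
move=> cf; have [df Df] := cf; split=> [p Dp|v].
  by apply: differentiableV; [exact: df|exact: f0].
have cV := IHn _ f0 (CnW cf).
have := CnN oD (CnM oD (CnM oD cV cV) (Df v)).
apply: eq_Cn => // p Dp.
rewrite [RHS]deriveV//; [|exact: f0|exact/diff_derivable/df].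
by rewrite -mulNr -exprVn expr2.
Qed.

Lemma Cn_mxP U m n k (D : set U) (f : U -> 'M[R]_(m, n)) : open D ->
  Cn k D f <-> forall i j, Cn k D (fun p => f p i j).
Proof.
move=> oD; split=> [cf i j|cf].
  apply: (@Cn_linear _ _ _ _ _ (fun M : 'M[R]_(m, n) => M i j)) => //.
    by move=> a x y; rewrite !mxE.
  exact: coord_continuous.
have fE p : \sum_i \sum_j f p i j *: delta_mx i j = f p.
  by rewrite -matrix_sum_delta.
apply: (eq_Cn oD (fun p _ => fE p)).
by apply: Cn_sum => // i; apply: Cn_sum => // j; exact: CnZr.
Qed.

Lemma Cn_entry U m n k (D : set U) (f : U -> 'M[R]_(m, n)) i j : open D ->
  Cn k D f -> Cn k D (fun p => f p i j).
Proof. by move=> oD /(Cn_mxP _ _ oD); exact. Qed.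

Lemma Cn_pairP U V W k (D : set U) (f : U -> V * W) : open D ->
  Cn k D f <-> Cn k D (fun p => (f p).1) /\ Cn k D (fun p => (f p).2).
Proof.
move=> oD; split=> [cf|[cf1 cf2]].
  split; apply: Cn_linear (cf) => //.
    by move=> p; exact: cvg_fst.
  by move=> p; exact: cvg_snd.
have i1 : Cn k D (fun p => ((f p).1, 0 : W)).
  apply: (@Cn_linear _ _ _ _ _ (fun x : V => (x, 0 : W))) cf1 => //.
    by move=> a x y; congr pair; rewrite /= scaler0 addr0.
  by move=> p; apply: cvg_pair => /=; [exact: cvg_id|exact: cvg_cst].
have i2 : Cn k D (fun p => (0 : V, (f p).2)).
  apply: (@Cn_linear _ _ _ _ _ (fun x : W => (0 : V, x))) cf2 => //.
    by move=> a x y; congr pair; rewrite /= scaler0 addr0.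
  by move=> p; apply: cvg_pair => /=; [exact: cvg_cst|exact: cvg_id].
apply: eq_Cn oD _ (CnD oD i1 i2) => p _.
by rewrite [RHS]surjective_pairing; congr pair; rewrite /= ?addr0 ?add0r.
Qed.

(* A finite basis with its coordinate functions: it lets [R * R] and spaces of
   matrices share the expansion of ['D_v g] into partial derivatives. *)
Record frame (V : normedModType R) := Frame {
  frame_index : finType;
  frame_vec : frame_index -> V;
  frame_coord : frame_index -> V -> R;
  frame_linear : forall i, linear (frame_coord i : V -> R^o);
  frame_continuous : forall i, continuous (frame_coord i);
  frameE : forall v, v = \sum_i frame_coord i v *: frame_vec i }.

Arguments frame_vec {V}.
Arguments frame_coord {V}.
Arguments frameE {V}.

Definition frame_RR : frame (R * R)%type.
Proof.
apply: (@Frame (R * R)%type bool (fun b => if b then (1, 0) else (0, 1))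
  (fun b v => if b then v.1 else v.2)).
- by case.
- by case=> v; [exact: cvg_fst|exact: cvg_snd].
- move=> [v1 v2]; rewrite big_bool; congr pair => /=.
    by rewrite [X in _ + X]mulr0 addr0 [RHS]mulr1.
  by rewrite [X in X + _]mulr0 add0r [RHS]mulr1.
Defined.

Definition frame_mx m n : frame 'M[R]_(m, n).
Proof.
apply: (@Frame _ ('I_m * 'I_n)%type (fun k => delta_mx k.1 k.2)
  (fun k v => v k.1 k.2)).
- by move=> k a x y; rewrite !mxE.
- by move=> k; exact: coord_continuous.
- by move=> v; rewrite {1}[v]matrix_sum_delta pair_big.
Defined.

Lemma derive_frame V W (F : frame V) (g : V -> W) p v : differentiable g p ->
  'D_v g p = \sum_i frame_coord F i v *: 'D_(frame_vec F i) g p.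
Proof.
move=> dg; rewrite deriveE// {1}[v](frameE F) linear_sum /=.
by apply: eq_bigr => i _; rewrite linearZ deriveE.
Qed.

Lemma deriveRR V (g : R * R -> V) p (a : R * R) : differentiable g p ->
  'D_a g p = a.1 *: 'D_(1, 0) g p + a.2 *: 'D_(0, 1) g p.
Proof. by move=> dg; rewrite (derive_frame frame_RR)// big_bool. Qed.

Lemma derive_comp U V W (f : U -> V) (g : V -> W) p v :
  differentiable f p -> differentiable g (f p) ->
  'D_v (g \o f) p = 'D_('D_v f p) g (f p).
Proof.
move=> df dg; rewrite !deriveE//; last exact: differentiable_comp.
by rewrite diff_comp.
Qed.

(** In the chain rule the direction ['D_v f p] moves with [p], whereas [Cn] speaks of fixed
    directions. Expanding it in a [frame] restores fixed directions, with coefficients that are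
    linear images of ['D_v f]. *)
Lemma Cn_comp_scalar U V (F : frame V) n (D : set U) (E : set V) (f : U -> V) (g : V -> R) :
  open D -> (forall p, D p -> E (f p)) ->
  Cn n D f -> Cn n E g -> Cn n D (g \o f).
Proof.
move=> oD DE; elim: n f g DE => [|n IHn] f g DE.
  by move=> cf cg p Dp; apply: continuous_comp; [exact: cf|exact/cg/DE].
move=> cf cg; have [df Df] := cf; have [dg Dg] := cg; split=> [p Dp|v].
  by apply: differentiable_comp; [exact: df|exact/dg/DE].
have : Cn n D (fun p => \sum_i frame_coord F i ('D_v f p) * 'D_(frame_vec F i) g (f p)).
  apply: Cn_sum => // i; apply: CnM => //.
    apply: (@Cn_linear _ _ _ _ _ (frame_coord F i)) (Df v) => //.
      exact: frame_linear.
    exact: frame_continuous.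
  exact: IHn (CnW cf) (Dg _).
apply: eq_Cn => // p Dp.
have dgp := dg _ (DE _ Dp).
have -> : 'D_v (g \o f) p = 'D_('D_v f p) g (f p) by apply: derive_comp => //; exact: df.
by rewrite (derive_frame F _ dgp).
Qed.

Lemma Cn_comp_mx U V (F : frame V) m n k (D : set U) (E : set V) (f : U -> V)
    (g : V -> 'M[R]_(m, n)) : open D -> open E -> (forall p, D p -> E (f p)) ->
  Cn k D f -> Cn k E g -> Cn k D (g \o f).
Proof.
move=> oD oE DE cf /(Cn_mxP _ _ oE) cg; apply/Cn_mxP => // i j.
exact: (Cn_comp_scalar F oD DE cf (cg i j)).
Qed.

Lemma Cn_comp_pair U V (F : frame V) k (D : set U) (E : set V) (f : U -> V)
    (g : V -> R * R) : open D -> open E -> (forall p, D p -> E (f p)) ->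
  Cn k D f -> Cn k E g -> Cn k D (g \o f).
Proof.
move=> oD oE DE cf /(Cn_pairP _ _ oE)[c1 c2]; apply/Cn_pairP => //.
by split; [exact: (Cn_comp_scalar F oD DE cf c1)|exact: (Cn_comp_scalar F oD DE cf c2)].
Qed.

(** Both difference quotients are the same function of [h]; through this equivalence one-variable
    theorems apply on lines. *)
Lemma line_derive V W (g : V -> W) (p v : V) (s : R) (d : W) :
  is_derive s 1 (fun t => g (p + t *: v)) d <-> is_derive (p + s *: v) v g d.
Proof.
have E : (fun h : R => h^-1 *: (((fun t => g (p + t *: v)) \o shift s) (h *: 1)
           - g (p + s *: v))) =
         (fun h => h^-1 *: ((g \o shift (p + s *: v)) (h *: v) - g (p + s *: v))).
  apply/funext => h /=; congr (_ *: (g _ - _)).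
  by rewrite [h *: 1]mulr1 scalerDl addrCA.
by split=> -[ex val]; constructor; move: ex val; rewrite /derivable /derive E.
Qed.

Lemma MVT_line V (g : V -> R) (p v : V) (dg : R -> R) :
  (forall s : R, 0 <= s <= 1 -> is_derive (p + s *: v) v g (dg s)) ->
  exists2 s : R, 0 <= s <= 1 & g (p + v) - g p = dg s.
Proof.
move=> dgP; pose f t := g (p + t *: v).
have df (s : R) : 0 <= s <= 1 -> is_derive s 1 f (dg s).
  by move=> /dgP/line_derive.
have [||s] := @MVT _ f dg 0 1 ltr01.
- by move=> x; rewrite in_itv /= => /andP[/ltW x0 /ltW x1]; apply: df; rewrite x0.
- apply: continuous_in_subspaceT => x; rewrite inE/= in_itv/= => /df[dfx _].
  exact/differentiable_continuous/derivable1_diffP.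
rewrite in_itv /= => /andP[/ltW x0 /ltW x1].
rewrite /f scale1r scale0r addr0 subr0 mulr1 => fE.
by exists s => //; rewrite x0.
Qed.

Lemma differentiable_at V W (f : V -> W) p (df : V -> W) :
  linear df -> continuous df ->
  (forall e : R, 0 < e -> \forall h \near 0, `|f (p + h) - f p - df h| <= e * `|h|) ->
  differentiable f p /\ forall v, 'D_v f p = df v.
Proof.
move=> ll cl fo.
pose L := HB.pack_for {linear V -> W} df (GRing.isLinear.Build _ _ _ _ df ll).
have fL : f \o shift p = cst (f p) + L +o_ 0 id.
  apply/eqaddoP => e e0; apply: filterS (fo e e0) => h.
  by rewrite !fctE /= opprD addrA [h + p]addrC.
have dE : 'd f p = L :> (V -> W) := @diff_unique _ _ _ f L p cl fL.
have dif : differentiable f p.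
  by apply/diff_locallyP; rewrite dE; split.
by split=> // v; rewrite deriveE// dE.
Qed.

End Cn_theory.

Arguments frame_vec {R V}.
Arguments frame_coord {R V}.
Arguments frameE {R V}.

(** * Mean value estimates and symmetry of second derivatives *)

Section line_calculus.
Variable R : realType.
Implicit Types U V W : normedModType R.

Lemma is_derive_scale V W (g : V -> W) (p v : V) (k : R) (d : W) :
  is_derive p v g d -> is_derive p (k *: v) g (k *: d).
Proof.
move=> dg; pose f (t : R) := g (p + t *: v).
have df : is_derive (0 : R) 1 f d by apply/line_derive; rewrite scale0r addr0.
have fdiff : differentiable f 0 by apply/derivable1_diffP; case: df.
have mdiff : differentiable (fun t : R => t * k) 0.
  by apply: differentiableM => //; exact: differentiable_cst.
have m0 : (fun t : R => t * k) 0 = 0 by rewrite mul0r.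
have fdiff' : differentiable f ((fun t : R => t * k) 0) by rewrite m0.
suff : is_derive (0 : R) 1 (fun t : R => g (p + t *: (k *: v))) (k *: d).
  by move/line_derive; rewrite scale0r addr0.
have E : (fun t : R => g (p + t *: (k *: v))) = f \o (fun t => t * k).
  by apply/funext => t; rewrite /= /f scalerA.
rewrite E; constructor.
  by apply: diff_derivable; exact: differentiable_comp.
rewrite derive_comp// m0.
have -> : 'D_1 (fun t : R => t * k) 0 = k *: (1 : R).
  by rewrite [LHS](@deriveMr _ _ (@id R) k)// derive_id.
rewrite deriveE// linearZ/= -deriveE//.
by case: df => _ ->.
Qed.

Lemma MVT_dir V (g : V -> R) (p v : V) (h : R) (dg : V -> R) :
  (forall s : R, `|s| <= `|h| -> is_derive (p + s *: v) v g (dg (p + s *: v))) ->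
  exists2 s : R, `|s| <= `|h| & g (p + h *: v) - g p = h * dg (p + s *: v).
Proof.
move=> dgP; have [|s /andP[s0 s1] sE] := @MVT_line _ _ g p (h *: v) (fun s =>
  h * dg (p + (s * h) *: v)).
  move=> s /andP[s0 s1]; rewrite scalerA.
  apply: is_derive_scale; apply: dgP.
  by rewrite normrM ger0_norm// ler_piMl.
by exists (s * h) => //; rewrite normrM ger0_norm// ler_piMl.
Qed.

Lemma scale_e1 (a : R) : a *: ((1, 0) : R * R) = (a, 0).
Proof. by congr pair; [exact: mulr1|exact: mulr0]. Qed.

Lemma scale_e2 (a : R) : a *: ((0, 1) : R * R) = (0, a).
Proof. by congr pair; [exact: mulr0|exact: mulr1]. Qed.

Lemma derivable_is V W (g : V -> W) (p v : V) : derivable g p v ->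
  is_derive p v g ('D_v g p).
Proof. by move=> dg; constructor. Qed.

(** The increment is split into a horizontal and a vertical step, each handled by the mean value
    theorem; continuity of the partial derivatives at [p] absorbs the intermediate points. *)
Lemma partials_differentiable (D : set (R * R)) (f fx fy : R * R -> R) p :
  open D -> D p ->
  (forall q, D q -> is_derive q (1, 0) f (fx q)) ->
  (forall q, D q -> is_derive q (0, 1) f (fy q)) ->
  {for p, continuous fx} -> {for p, continuous fy} ->
  differentiable f p /\ forall v, 'D_v f p = v.1 * fx p + v.2 * fy p.
Proof.
move=> oD Dp dx dy cx cy; apply: differentiable_at.
- by move=> a x y; rewrite /= /GRing.scale/=; ring.
- move=> q; apply: cvgD; apply: cvgM; [exact: cvg_fst|exact: cvg_cst|exact: cvg_snd|exact: cvg_cst].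
move=> e e0.
have e20 : 0 < e / 2 by rewrite divr_gt0.
have : \forall q \near p, [/\ D q, `|fx p - fx q| < e / 2 & `|fy p - fy q| < e / 2].
  near=> q; split; near: q.
  - exact: open_nbhs_nbhs.
  - by move/cvgrPdist_lt : cx; apply.
  - by move/cvgrPdist_lt : cy; apply.
move=> /nbhs_ballP[r /= r0 rP].
have rP' h1 h2 : `|h1| < r -> `|h2| < r -> ball p r (p + (h1, h2)).
  by move=> h1r h2r; split; rewrite /ball/= opprD addNKr normrN.
near=> h.
have hr : `|h| < r.
  by near: h; apply/nbhs_ballP; exists r => // y; rewrite /= -ball_normE /= sub0r normrN.
have [h1r h2r] : `|h.1| < r /\ `|h.2| < r.
  by split; apply: le_lt_trans hr; rewrite prod_normE le_max lexx ?orbT.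
have [s1 s1h E1] : exists2 s : R, `|s| <= `|h.1| &
  f (p + h.1 *: (1, 0)) - f p = h.1 * fx (p + s *: (1, 0)).
  apply: MVT_dir => s sh; apply: dx.
  have := rP' s 0 (le_lt_trans sh h1r); rewrite normr0 => /(_ r0)/rP[].
  by rewrite scale_e1.
have [s2 s2h E2] : exists2 s : R, `|s| <= `|h.2| &
    f ((p + h.1 *: (1, 0)) + h.2 *: (0, 1)) - f (p + h.1 *: (1, 0)) =
      h.2 * fy ((p + h.1 *: (1, 0)) + s *: (0, 1)).
  apply: MVT_dir => s sh; apply: dy.
  have /rP[] := rP' h.1 s h1r (le_lt_trans sh h2r).
  rewrite (_ : p + _ + _ = p + (h.1, s))// -addrA scale_e1 scale_e2; congr (_ + _).
  by congr pair; rewrite /= ?addr0 ?add0r.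
have [_ b1 _] : [/\ D (p + s1 *: (1, 0)), `|fx p - fx (p + s1 *: (1, 0))| < e / 2 &
  `|fy p - fy (p + s1 *: (1, 0))| < e / 2].
  apply: rP; have := rP' s1 0 (le_lt_trans s1h h1r); rewrite normr0 => /(_ r0).
  by rewrite scale_e1.
set q2 := _ + s2 *: _ in E2.
have [_ _ b2] : [/\ D q2, `|fx p - fx q2| < e / 2 & `|fy p - fy q2| < e / 2].
  apply: rP; have := rP' h.1 s2 h1r (le_lt_trans s2h h2r).
  rewrite (_ : p + _ = q2)// /q2 -addrA scale_e1 scale_e2; congr (_ + _).
  by congr pair; rewrite /= ?addr0 ?add0r.
have hE : p + h = (p + h.1 *: (1, 0)) + h.2 *: (0, 1).
  rewrite -addrA scale_e1 scale_e2; congr (_ + _); rewrite [LHS]surjective_pairing.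
  by congr pair; rewrite /= ?addr0 ?add0r.
have -> : f (p + h) - f p = h.2 * fy q2 + h.1 * fx (p + s1 *: (1, 0)).
  by rewrite hE -E2 -E1; ring.
have -> : h.2 * fy q2 + h.1 * fx (p + s1 *: (1, 0)) - (h.1 * fx p + h.2 * fy p) =
  - (h.2 * (fy p - fy q2) + h.1 * (fx p - fx (p + s1 *: (1, 0)))) by ring.
rewrite normrN (le_trans (ler_normD _ _))// !normrM.
have n1 : `|h.1| <= `|h| by rewrite prod_normE le_max lexx.
have n2 : `|h.2| <= `|h| by rewrite prod_normE le_max lexx orbT.
have := ler_pM (normr_ge0 _) (normr_ge0 _) n1 (ltW b1).
have := ler_pM (normr_ge0 _) (normr_ge0 _) n2 (ltW b2).
lra.
Unshelve. all: by end_near. Qed.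

Lemma Cn_partials n (D : set (R * R)) (f fx fy : R * R -> R) : open D ->
  (forall p, D p -> is_derive p (1, 0) f (fx p)) ->
  (forall p, D p -> is_derive p (0, 1) f (fy p)) ->
  Cn n D fx -> Cn n D fy -> Cn n.+1 D f.
Proof.
move=> oD dx dy cx cy.
have df p (Dp : D p) := partials_differentiable oD Dp dx dy (Cn_continuous cx Dp) (Cn_continuous cy Dp).
split=> [p /df[]//|v].
have := CnD oD (CnM oD (@Cn_cst _ _ _ n D v.1) cx) (CnM oD (@Cn_cst _ _ _ n D v.2) cy).
by apply: eq_Cn => // p Dp; rewrite (df p Dp).2.
Qed.

Lemma ball_segment V (p a b : V) r (s : R) : 0 <= s <= 1 ->
  ball p r a -> ball p r b -> ball p r (b + s *: (a - b)).
Proof.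
rewrite -!ball_normE /= => /andP[s0 s1] pa pb.
have E : p - (b + s *: (a - b)) = s *: (p - a) + (1 - s) *: (p - b).
  have gen (u w : V) : s *: (u - w) + (1 - s) *: u = u - s *: w.
    by rewrite scalerBr scalerBl scale1r addrC addrA subrK.
  have -> : p - a = (p - b) - (a - b) by rewrite opprB addrA subrK.
  by rewrite gen opprD addrA.
rewrite E.
rewrite (le_lt_trans (ler_normD _ _))// !normrZ ger0_norm// ger0_norm ?subr_ge0//.
have [->|s_neq0] := eqVneq s 0; first by rewrite mul0r add0r subr0 mul1r.
have sp : 0 < s by rewrite lt_neqAle eq_sym s_neq0.
have : s * `|p - a| < s * r by rewrite ltr_pM2l.
have : (1 - s) * `|p - b| <= (1 - s) * r by rewrite ler_wpM2l ?subr_ge0// ltW.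
lra.
Qed.

Lemma frame_coord_bound V (F : frame V) :
  exists2 C : R, 0 < C & forall v, \sum_i `|frame_coord F i v| <= C * `|v|.
Proof.
have ki i : exists k : R, 0 < k /\ forall v, `|frame_coord F i v| <= k * `|v|.
  pose L := HB.pack_for {linear V -> R^o} (frame_coord F i : V ->
    R^o) (GRing.isLinear.Build _ _ _ _ _ (@frame_linear _ _ F i)).
  have [k k0 kP] := @linear_lipschitz _ V R^o L (@frame_continuous _ _ F i).
  by exists k; split => // v; exact: kP.
have [k kP] := choice ki.
exists (1 + \sum_i k i) => [|v].
  by rewrite ltr_wpDr// sumr_ge0// => i _; rewrite ltW// (kP i).1.
rewrite mulrDl mulr_suml (le_trans (ler_sum _ (fun i _ => (kP i).2 v)))//.
by rewrite lerDr mul1r.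
Qed.

Lemma ler_dist_half (e x y z : R) : `|y - z| < e / 2 -> `|x - z| < e / 2 -> `|x - y| <= e.
Proof.
move=> yz xz; rewrite -(subrKA z) [leRHS](splitr e) (le_trans (ler_normD _ _))//.
by rewrite lerD ?ltW// distrC.
Qed.

(** The three points vary independently in the ball, so the linearisation may be taken at any of
    them. With [c = p] this yields Lipschitz and injectivity estimates, with [c = b] linearisations
    uniform in the base point. *)
Lemma strict_diff V (F : frame V) (D : set V) (g : V -> R) p (e : R) :
  open D -> D p -> Cn 1 D g -> 0 < e ->
  exists r : R, [/\ 0 < r, ball p r `<=` D &
    forall a b c, ball p r a -> ball p r b -> ball p r c ->
    `|g a - g b - 'D_(a - b) g c| <= e * `|a - b|].
Proof.
move=> oD Dp [dg Dg] e0; have [C C0 CP] := frame_coord_bound F.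
have eC : 0 < e / C by rewrite divr_gt0.
have eC2 : 0 < e / C / 2 by rewrite divr_gt0.
have : \forall q \near p, D q /\ forall i,
  `|'D_(frame_vec F i) g q - 'D_(frame_vec F i) g p| < e / C / 2.
  near=> q; split; near: q; first exact: open_nbhs_nbhs.
  apply: filter_forall => i; near=> q; rewrite distrC; near: q.
  by move/cvgrPdist_lt : (Dg (frame_vec F i) p Dp); apply.
move=> /nbhs_ballP[r /= r0 rP]; exists r; split=> // [q /rP[]//|a b c pa pb pc].
have [|s s01] := @MVT_line _ _ g b (a - b) (fun s => 'D_(a - b) g (b + s *: (a - b))).
  move=> s s01; apply: derivable_is; apply: diff_derivable; apply: dg.
  by have [] := rP _ (ball_segment s01 pa pb).
rewrite [b + (a - b)]addrC subrK => ->.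
have [Dq qP] := rP _ (ball_segment s01 pa pb); move: Dq qP; set q := b + _ => Dq qP.
have [Dc cP] := rP _ pc.
rewrite (derive_frame F (a - b) (dg _ Dq)) (derive_frame F (a - b) (dg _ Dc)).
rewrite -sumrB (le_trans (ler_norm_sum _ _ _))//.
have : \sum_i `|frame_coord F i (a - b)| * (e / C) <= e * `|a - b|.
  rewrite -mulr_suml (le_trans (ler_wpM2r (ltW eC) (CP _)))//.
  by rewrite mulrAC mulrCA divff ?mulr1 ?gt_eqF// mulrC.
apply: le_trans; apply: ler_sum => i _.
rewrite -mulrBr normrM ler_wpM2l//.
apply: (ler_dist_half (z := 'D_(frame_vec F i) g p)); [exact: cP|exact: qP].
Unshelve. all: by end_near. Qed.

(** The second difference of [f] over a small parallelogram is [h ^+ 2] times either mixed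
    derivative at some point of it; continuity of both derivatives at [p] then makes them equal
    there. *)
Lemma derive_commute V (D : set V) (f : V -> R) v w p : open D -> D p -> Cn 2 D f ->
  'D_v ('D_w f) p = 'D_w ('D_v f) p.
Proof.
move=> oD Dp [df Df]; apply/eqP; rewrite -subr_eq0 -normr_le0.
apply/ler_addgt0Pl => e e0; rewrite addr0.
have [dv Dv] := Df v; have [dw Dw] := Df w.
have e20 : 0 < e / 2 by rewrite divr_gt0.
have : \forall q \near p, [/\ D q, `|'D_v ('D_w f) p - 'D_v ('D_w f) q| < e / 2
    & `|'D_w ('D_v f) p - 'D_w ('D_v f) q| < e / 2].
  have near3 (a b : V -> R) : {for p, continuous a} -> {for p, continuous b} ->
    \forall q \near p, [/\ D q, `|a p - a q| < e / 2 & `|b p - b q| < e / 2].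
    move=> /cvgrPdist_lt/(_ _ e20) ca /cvgrPdist_lt/(_ _ e20) cb.
    by move: (open_nbhs_nbhs (conj oD Dp)) ca cb; exact: filterS3.
  by apply: near3; [exact: Dw v p Dp|exact: Dv w p Dp].
move=> /nbhs_ballP[r /= r0 rP].
(* The size that keeps [p + s *: v + t *: w] within half the radius for all [s] and [t] up to [h];
   the added 1 avoids a division by zero. *)
pose h := r / (`|v| + `|w| + 1) / 2.
have N0 : 0 < `|v| + `|w| + 1 by rewrite ltr_wpDl ?addr_ge0.
have h0 : 0 < h by rewrite !divr_gt0.
have inb (s t : R) : `|s| <= h -> `|t| <= h -> ball p r (p + s *: v + t *: w).
  move=> sh th; rewrite -ball_normE /= -addrA opprD addNKr normrN.
  rewrite (le_lt_trans (ler_normD _ _))// !normrZ.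
  rewrite (@le_lt_trans _ _ (h * (`|v| + `|w| + 1)))//.
    have := ler_wpM2r (normr_ge0 v) sh; have := ler_wpM2r (normr_ge0 w) th.
    rewrite !mulrDr mulr1; lra.
  have -> : h * (`|v| + `|w| + 1) = r / 2 by rewrite /h; field; rewrite gt_eqF.
  lra.
have inD s t : `|s| <= h -> `|t| <= h -> D (p + s *: v + t *: w).
  by move=> sh th; have [] := rP _ (inb s t sh th).
have hh : `|h| = h by rewrite gtr0_norm.
have E1 : exists s t : R, [/\ `|s| <= h, `|t| <= h &
  f (p + h *: v + h *: w) - f (p + h *: v) - (f (p + h *: w) - f p)
    = h * (h * 'D_w ('D_v f) (p + s *: v + t *: w))].
  have [s /=|s sh sE] := @MVT_dir _ (fun q => f (q + h *: w) - f q) p v h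
    (fun q => 'D_v f (q + h *: w) - 'D_v f q).
    rewrite hh => sh.
    have D1 : D (p + s *: v) by have := inD s 0 sh; rewrite normr0 scale0r addr0; apply;
      exact: ltW.
    have D2 : D (p + s *: v + h *: w) by apply: inD; rewrite ?hh.
    apply: is_deriveB; last exact/derivable_is/diff_derivable/df.
    have := derivable_is (diff_derivable (v := v) (df _ D2)).
    rewrite -addrA [_ *: v + _]addrC addrA => /line_derive H.
    apply/line_derive; move: H; congr is_derive.
    by apply/funext => t; rewrite addrAC.
  rewrite hh in sh; rewrite sE.
  have [t|t] := @MVT_dir _ ('D_v f) (p + s *: v) w h ('D_w ('D_v f)).
    rewrite hh => th; apply/derivable_is/diff_derivable/dv; exact: inD.
  by rewrite hh => th ->; exists s, t.
have E2 : exists s t : R, [/\ `|s| <= h, `|t| <= h &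
  f (p + h *: v + h *: w) - f (p + h *: v) - (f (p + h *: w) - f p)
    = h * (h * 'D_v ('D_w f) (p + t *: w + s *: v))].
  have [t /=|t th tE] := @MVT_dir _ (fun q => f (q + h *: v) - f q) p w h
    (fun q => 'D_w f (q + h *: v) - 'D_w f q).
    rewrite hh => sh.
    have D1 : D (p + t *: w) by have := inD 0 t; rewrite normr0 scale0r addr0; apply => //;
      exact: ltW.
    have D2 : D (p + t *: w + h *: v) by rewrite addrAC; apply: inD; rewrite ?hh.
    apply: is_deriveB; last exact/derivable_is/diff_derivable/df.
    have := derivable_is (diff_derivable (v := w) (df _ D2)).
    rewrite -addrA [_ *: w + _]addrC addrA => /line_derive H.
    apply/line_derive; move: H; congr is_derive.
    by apply/funext => s; rewrite addrAC.
  rewrite hh in th.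
  have -> : f (p + h *: v + h *: w) - f (p + h *: v) - (f (p + h *: w) - f p) =
    f (p + h *: w + h *: v) - f (p + h *: w) - (f (p + h *: v) - f p).
    by rewrite [p + h *: v + _]addrAC; ring.
  rewrite tE.
  have [s|s] := @MVT_dir _ ('D_w f) (p + t *: w) v h ('D_v ('D_w f)).
    rewrite hh => sh; apply/derivable_is/diff_derivable/dw; rewrite addrAC; exact: inD.
  by rewrite hh => sh ->; exists s, t.
have [s [t [sh th E]]] := E1; have [s' [t' [sh' th' E']]] := E2.
have hn0 : h != 0 by rewrite gt_eqF.
have EE : 'D_w ('D_v f) (p + s *: v + t *: w) = 'D_v ('D_w f) (p + t' *: w + s' *: v).
  have hhI (x y : R) : h * (h * x) = h * (h * y) -> x = y.
    by move=> /(mulfI hn0)/(mulfI hn0).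
  by apply: hhI; exact: etrans (esym E) E'.
have [_ _ b1] := rP _ (inb s t sh th); have [_ b2 _] := rP _ (inb s' t' sh' th').
rewrite [p + s' *: v + _]addrAC -EE in b2.
exact: ler_dist_half b1 b2.
Unshelve. all: by end_near. Qed.

End line_calculus.

(** * Integration along the coordinate lines of the plane *)

Section antiderivative.
Variable R : realType.

Lemma eq_antiderivative (F G f : R -> R) (D : set R) (c x : R) :
  (forall s : R, 0 <= s <= 1 -> D (c + s * (x - c))) ->
  (forall y, D y -> is_derive y 1 F (f y)) ->
  (forall y, D y -> is_derive y 1 G (f y)) ->
  F c = G c -> F x = G x.
Proof.
move=> cx dF dG FG.
have [s s01|s s01] := @MVT_line R R (fun y => F y - G y) c (x - c) (fun=> 0).
  have Ds := cx s s01.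
  have -> : (0 : R) = (x - c) *: (0 : R) by rewrite scaler0.
  have -> : is_derive (c + s *: (x - c)) (x - c) (fun y => F y - G y) ((x - c) *: (0 : R)) =
    is_derive (c + s *: (x - c)) ((x - c) *: (1 : R)) (fun y => F y - G y) ((x - c) *:
      (0 : R)).
    by congr is_derive; rewrite [RHS]mulr1.
  apply: is_derive_scale; rewrite -(subrr (f (c + s * (x - c)))).
  by apply: is_deriveB; [exact: dF|exact: dG].
by rewrite [c + _]addrC subrK FG subrr subr0 => /eqP; rewrite subr_eq0 => /eqP.
Qed.

(** Integrating from -1 rather than from 0 makes 0 an interior point, so that this half and its
    mirror image overlap between -1 and 1 and can be joined there. *)
Lemma antiderivative_right (f : R -> R) : continuous f ->
  exists F : R -> R, F 0 = 0 /\ forall x : R, -1 < x -> is_derive x 1 F (f x).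
Proof.
move=> cf.
pose G (x : R) := (\int[@lebesgue_measure R]_(t in `[(-1)%R, x]) f t)%R.
exists (fun x => G x - G 0); split=> [|x x1]; first by rewrite subrr.
rewrite -[f x]subr0; apply: is_deriveB.
have [||||dG GE] := @continuous_FTC1_closed R f (-1) x (x + 1).
- by rewrite ltrDl.
- apply: continuous_compact_integrable; first exact: segment_compact.
  exact: continuous_subspaceT.
- by [].
- exact: cf.
by constructor; [exact: dG|rewrite -derive1E; exact: GE].
Qed.

Lemma antiderivative_exists (f : R -> R) : continuous f ->
  exists F : R -> R, F 0 = 0 /\ forall x : R, is_derive x 1 F (f x).
Proof.
move=> cf; have [F [F0 dF]] := antiderivative_right cf.
have [|G [G0 dG]] := @antiderivative_right (f \o -%R).
  by move=> x; apply: continuous_comp; [exact: opp_continuous|exact: cf].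
have dH (x : R) : x < 1 -> is_derive x 1 (fun y => - G (- y)) (f x).
  move=> x1; have -> : f x = - (f (- - x) * (- 1)) by rewrite opprK mulrN1 opprK.
  have dGx : is_derive (- x) 1 G (f (- - x)) by apply: dG; rewrite ltrN2.
  have dN : is_derive x 1 (-%R : R -> R) (- 1) by exact: is_deriveN.
  exact: is_deriveN (is_derive1_comp dGx dN).
have FG x : -1 < x -> x < 1 -> F x = - G (- x).
  move=> x1 x2; apply: (@eq_antiderivative F (fun y => - G (- y)) f [set y | -1 < y < 1] 0).
  - move=> s /andP[s0 s1] /=; rewrite add0r subr0; nra.
  - by move=> y /andP[y1 _]; exact: dF.
  - by move=> y /andP[_ y1]; exact: dH.
  - by rewrite oppr0 G0 oppr0.
exists (fun x => if x <= 0 then - G (- x) else F x); split=> [|x].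
  by rewrite lexx oppr0 G0 oppr0.
have [x0|x0] := leP x 0.
  apply: near_eq_is_derive (dH x (le_lt_trans x0 ltr01)).
  near=> y; have y1 : y < 1.
    by near: y; apply: lt_nbhsl; rewrite (le_lt_trans x0).
  case: leP => // y0; by rewrite FG// (lt_trans _ y0).
apply: near_eq_is_derive (dF x (lt_trans (ltrN10 _) x0)).
near=> y; have y0 : 0 < y by near: y; exact: lt_nbhsr.
by rewrite leNgt y0.
Unshelve. all: by end_near. Qed.

(** The antiderivative is selected by its properties, with value 0 if none exists. It is defined for
    both signs of the argument, hence serves points on either side of the initial line. *)
Definition prim (f : R -> R) : R -> R :=
  xget (fun=> 0) [set F : R -> R | F 0 = 0 /\ forall x : R, is_derive x 1 F (f x)].

Lemma primP (f : R -> R) : continuous f ->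
  prim f 0 = 0 /\ forall x : R, is_derive x 1 (prim f) (f x).
Proof. by move/antiderivative_exists => [F FP]; rewrite /prim;
  case: xgetP => [G _ //|/(_ F)]. Qed.

(** The comparison function [C / l * expR (l * (N * t))] has exactly the assumed bound as its
    derivative. The factor [e] of absolute value 1 treats [g] and [- g] together. *)
Lemma growth_line (V : normedModType R) (g : V -> R) (p v : V) (dg : R -> R) (C l N : R) :
  0 < l -> 0 <= N ->
  (forall s : R, 0 <= s <= 1 -> is_derive (p + s *: v) v g (dg s)) ->
  (forall s : R, 0 <= s <= 1 -> `|dg s| <= N * (C * expR (l * (N * s)))) ->
  `|g (p + v) - g p| <= C / l * (expR (l * N) - 1).
Proof.
move=> l0 N0 dgP bound; have ln0 : l != 0 by rewrite gt_eqF.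
have dE (s : R) : is_derive s 1 (fun t : R =>
  C / l * expR (l * (N * t))) (N * (C * expR (l * (N * s)))).
  have dM : is_derive s 1 (fun t : R => l * (N * t)) (l * N).
    have -> : (fun t : R => l * (N * t)) = (l * N) \*: id.
      by apply/funext => t; rewrite /= mulrA.
    by rewrite -[X in is_derive _ _ _ X]mulr1; exact: is_deriveZ.
  have := is_deriveZ (C / l) (@is_derive1_comp R expR (fun t : R =>
    l * (N * t)) s _ _ (is_derive_expR (l * (N * s))) dM).
  congr is_derive; rewrite /GRing.scale /=; field.
  by [].
have half (e : R) : `|e| = 1 -> e * (g (p + v) - g p) <= C / l * (expR (l * N) - 1).
  move=> e1.
  have [s s01|s s01] := @MVT_line R R (fun t : R =>
    C / l * expR (l * (N * t)) - e * g (p + t *: v)) 0 1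
    (fun s => N * (C * expR (l * (N * s))) - e * dg s).
    rewrite add0r [s *: 1]mulr1; apply: is_deriveB.
    apply: (@is_deriveZ _ _ _ (fun t : R => g (p + t *: v)) e).
    exact/line_derive/dgP.
  rewrite add0r !mulr1 !mulr0 expR0 mulr1 scale1r scale0r addr0 => E.
  have : 0 <= N * (C * expR (l * (N * s))) - e * dg s.
    rewrite subr_ge0 (le_trans _ (bound s s01))// (le_trans (ler_norm _))//.
    by rewrite normrM e1 mul1r.
  rewrite -E; move: (expR _) (g _) (g _) (C / l) => a b c d; lra.
rewrite ler_norml; have := half 1 (normr1 _); have := half (-1) (normrN1 _).
by rewrite mul1r mulN1r => h1 h2; rewrite h2 andbT lerNl.
Qed.

(** By the tube lemma the integrands are uniformly close on a compact interval when the parameters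
    are close; [B] leaves room there for the moving endpoint. *)
Lemma prim_continuous (T : topologicalType) (k : T * R -> R) : continuous k ->
  continuous (fun z : T * R => prim (fun s => k (z.1, s)) z.2).
Proof.
move=> ck; have ckt t : continuous (fun s => k (t, s)).
  move=> s; apply: (@continuous_comp _ _ _ (fun s : R => (t, s)) k); last exact: ck.
  exact: (cvg_pair (cvg_cst t) cvg_id).
move=> [t0 s0]; apply/cvgrPdist_lt => e e0 /=.
set B := `|s0| + 1; have B0 : 0 < B by rewrite ltr_wpDl.
pose K := `[- B, B]%classic; pose e' := e / 2 / B.
have e'0 : 0 < e' by rewrite !divr_gt0.
have tube : \forall t \near t0, forall s, K s -> `|k (t0, s) - k (t, s)| < e'.
  have /compact_near_coveringP := @segment_compact R (- B) B.
  move=> /(_ T (nbhs t0) (fun t s => `|k (t0, s) - k (t, s)| < e') _).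
  apply=> s _.
  have e'2 : 0 < e' / 2 by rewrite divr_gt0.
  have /cvgrPdist_lt/(_ _ e'2) ck0 := ck (t0, s).
  have /cvgrPdist_lt/(_ _ e'2) ck1 := ckt t0 s.
  have [[A C] /= [At Cs] AC] := ck0.
  exists (C `&` [set x | `|k (t0, s) - k (t0, x)| < e' / 2], A) => /=.
    by split=> //; exact: filterI.
  move=> [x i] [/= [Cx xs] Ai]; rewrite (splitr e') -(subrKA (k (t0, s))).
  by rewrite (le_lt_trans (ler_normD _ _))// ltrD//; [rewrite distrC|exact: (AC (i, x))].
have dp t (x : R) : is_derive x 1 (prim (fun s => k (t, s))) (k (t, x)).
  exact: (primP (ckt t)).2.
have cp : {for s0, continuous (prim (fun s => k (t0, s)))}.
  by apply/differentiable_continuous/derivable1_diffP; case: (dp t0 s0).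
have e20 : 0 < e / 2 by rewrite divr_gt0.
have /cvgrPdist_lt/(_ _ e20) cp' := cp.
have nB : \forall s \near s0, `|s| < B.
  have /cvgr_lt : {for s0, continuous (fun s : R => `|s|)} by exact: norm_continuous.
  by apply; rewrite /B ltrDl.
have : \forall z \near (t0, s0), [/\ forall s, K s -> `|k (t0, s) - k (z.1, s)| < e',
   `|prim (fun s => k (t0, s)) s0 - prim (fun s => k (t0, s)) z.2| < e / 2 & `|z.2| < B].
  exists ([set t | forall s, K s -> `|k (t0, s) - k (t, s)| < e'],
    [set s | `|prim (fun s => k (t0, s)) s0 - prim (fun s => k (t0, s)) s| < e / 2 /\
      `|s| < B]) => /=.
    by split=> //; exact: filterI.
  by move=> [t s] [/= tP []].
apply: filterS => -[t s] /= [tP sP sB].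
rewrite (splitr e) -(subrKA (prim (fun s =>
  k (t0, s)) s)) (le_lt_trans (ler_normD _ _))// ltr_leD//.
have [x x01|x x01] := @MVT_line R R (fun y =>
  prim (fun s => k (t0, s)) y - prim (fun s => k (t, s)) y) 0 s
  (fun x => s * (k (t0, x * s) - k (t, x * s))).
  rewrite add0r.
  have E : is_derive (x *: s) (s *: (1 : R)) (fun y =>
    prim (fun s => k (t0, s)) y - prim (fun s => k (t, s)) y) (s *:
      (k (t0, x * s) - k (t, x * s))).
    by apply: is_derive_scale; apply: is_deriveB.
  by move: E; rewrite [s *: 1]mulr1.
rewrite add0r !(primP (ckt _)).1 subrr subr0 => ->.
have xK : K (x * s).
  rewrite /K /= in_itv /= -ler_norml normrM (le_trans _ (ltW sB))// ler_piMl//.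
  by case/andP: x01 => x0 x1; rewrite ger0_norm.
rewrite normrM (@le_trans _ _ (B * e'))//.
  by rewrite ler_pM// ltW// tP.
by rewrite /e' mulrC divfK// gt_eqF.
Qed.

(** The increments from [k] on add up to at most [2 * c / 2 ^+ k], so the intervals of that radius
    around the [a k] are nested; the limit is the supremum of their left ends. *)
Lemma geometric_limit (a : nat -> R) (c : R) :
  (forall k, `|a k.+1 - a k| <= c / 2 ^+ k) ->
  exists l : R, forall k, `|l - a k| <= 2 * c / 2 ^+ k.
Proof.
move=> aP.
pose b k := a k - 2 * c / 2 ^+ k; pose d k := a k + 2 * c / 2 ^+ k.
have half k : c / 2 ^+ k.+1 = c / 2 ^+ k / 2 by rewrite exprS invfM mulrA mulrAC.
have half2 k : 2 * c / 2 ^+ k.+1 = c / 2 ^+ k by rewrite exprS; field; rewrite expf_neq0.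
have b2 k : 2 * c / 2 ^+ k = 2 * (c / 2 ^+ k) by rewrite mulrA.
have bS k : b k <= b k.+1.
  by rewrite /b half2 b2; have := aP k; rewrite ler_norml => /andP[]; lra.
have dS k : d k.+1 <= d k.
  by rewrite /d half2 b2; have := aP k; rewrite ler_norml => /andP[]; lra.
have bm : {homo b : m n / (m <= n)%N >-> m <= n} by apply/nondecreasing_seqP.
have dm m n : (m <= n)%N -> d n <= d m by move: m n; apply/nonincreasing_seqP.
have c0 k : 0 <= c / 2 ^+ k by exact: le_trans (aP k).
have bd k : b k <= d k by rewrite /b /d b2; have := c0 k; lra.
have bdmn m n : b m <= d n.
  have [mn|/ltnW nm] := leqP m n; first by rewrite (le_trans (bm _ _ mn)).
  by rewrite (le_trans (bd m))// dm.
have bsup : has_sup (range b).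
  split; first by exists (b 0%N), 0%N.
  by exists (d 0%N) => _ [m _ <-].
exists (sup (range b)) => k.
have h1 : b k <= sup (range b) by apply: ub_le_sup; [case: bsup|exists k].
have h2 : sup (range b) <= d k by apply: ge_sup; [case: bsup|move=> _ [m _ <-]].
by rewrite ler_norml; move: h1 h2; rewrite /b /d; lra.
Qed.

Lemma le_geometric0 (x c : R) : (forall k, `|x| <= c / 2 ^+ k) -> x = 0.
Proof.
move=> xP; apply/eqP; rewrite -normr_le0 leNgt; apply/negP => x0.
have c0 : 0 <= c / `|x|.
  by rewrite divr_ge0//; have := xP 0%N; rewrite expr0 divr1; apply: le_trans.
have := xP (Num.bound (c / `|x|)); rewrite leNgt => /negP; apply.
rewrite ltr_pdivrMr ?exprn_gt0// mulrC -ltr_pdivrMr//.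
rewrite (lt_le_trans (archi_boundP c0))// -natrX ler_nat.
by rewrite ltnW// ltn_expl.
Qed.

End antiderivative.

(** * Integration from the initial line, Gronwall's inequality and Picard iteration *)

Section characteristics.
Variable R : realType.
Implicit Types (p q : R * R) (d : bool).

(* [ell p] is the signed distance from [p] to the initial line [y = - x] along
   either coordinate direction [evec d], and [bpt d p] the point of that line
   which is reached. *)
Definition ell p : R := p.1 + p.2.
Definition evec d : R * R := if d then (1, 0) else (0, 1).
Definition bpt d p := p - ell p *: evec d.

Lemma ell_evec d : ell (evec d) = 1.
Proof. by case: d; rewrite /ell /= ?addr0 ?add0r. Qed.

Lemma ellDZ p q (s : R) : ell (p + s *: q) = ell p + s * ell q.
Proof. by rewrite /ell /= /GRing.scale/=; ring. Qed.

Lemma ell_line p d (s : R) : ell (p + s *: evec d) = ell p + s.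
Proof. by rewrite ellDZ ell_evec mulr1. Qed.

Lemma bptK d p : bpt d p + ell p *: evec d = p.
Proof. by rewrite subrK. Qed.

Lemma ell_bpt d p : ell (bpt d p) = 0.
Proof. by rewrite /bpt -scaleNr ell_line subrr. Qed.

Lemma bpt_line d p (s : R) : bpt d (p + s *: evec d) = bpt d p.
Proof.
by rewrite /bpt ell_line scalerDl opprD addrACA subrr addr0.
Qed.

Lemma bpt_id d p : ell p = 0 -> bpt d p = p.
Proof. by rewrite /bpt => ->; rewrite scale0r subr0. Qed.

Lemma ell_continuous : continuous ell.
Proof. by move=> p; apply: cvgD; [exact: cvg_fst|exact: cvg_snd]. Qed.

Lemma bpt_continuous d : continuous (bpt d).
Proof.
move=> p; apply: cvgB; first exact: cvg_id.
by apply: cvgZr_tmp; exact: ell_continuous.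
Qed.

Lemma mx_subE m n (A B : 'M[R]_(m, n)) i j : (A - B) i j = A i j - B i j.
Proof. by rewrite !mxE. Qed.

Lemma mx_entry_le m n (M : 'M[R]_(m, n)) i j : `|M i j| <= `|M|.
Proof.
rewrite [leRHS]/Num.Def.normr/= mx_normrE.
exact: (le_bigmax _ (fun k : 'I_m * 'I_n => `|M k.1 k.2|) (i, j)).
Qed.

Lemma mx_norm_le m n (M : 'M[R]_(m, n)) (c : R) :
  0 <= c -> (forall i j, `|M i j| <= c) -> `|M| <= c.
Proof.
move=> c0 Mc; rewrite [leLHS]/Num.Def.normr/= mx_normrE.
by apply: bigmax_le => // -[i j] _; exact: Mc.
Qed.

Lemma mx_continuous (T : topologicalType) m n (f : T -> 'M[R]_(m, n)) :
  (forall i j, continuous (fun t => f t i j)) -> continuous f.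
Proof.
move=> cf t; apply/cvgrPdist_le => e e0; near=> s.
apply: mx_norm_le (ltW e0) _ => i j; rewrite !mxE; move: i j; near: s.
apply: filter_forall => i; apply: filter_forall => j.
by have /cvgrPdist_le := cf i j t; apply.
Unshelve. all: by end_near. Qed.

Lemma mx_entry_continuous (T : topologicalType) m n (f : T -> 'M[R]_(m, n)) i j :
  continuous f -> continuous (fun t => f t i j).
Proof.
move=> cf t; apply: (@continuous_comp _ _ _ f (fun M : 'M[R]_(m, n) => M i j)).
  exact: cf.
exact: coord_continuous.
Qed.

Lemma seg_growth d (w dw : R * R -> R) p (C l : R) : 0 < l ->
  (forall s : R, 0 <= s <= 1 -> is_derive (bpt d p + (s * ell p) *: evec d) (evec d) w
     (dw (bpt d p + (s * ell p) *: evec d))) ->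
  (forall s : R, 0 <= s <= 1 ->
     `|dw (bpt d p + (s * ell p) *: evec d)| <= C * expR (l * `|s * ell p|)) ->
  `|w p - w (bpt d p)| <= C / l * (expR (l * `|ell p|) - 1).
Proof.
move=> l0 dwP bound.
rewrite -{1}(bptK d p).
apply: (@growth_line _ _ w (bpt d p) (ell p *: evec d)
  (fun s => ell p * dw (bpt d p + (s * ell p) *: evec d)) C l `|ell p| l0 (normr_ge0 _)) =>
    s s01.
  by rewrite scalerA; apply: is_derive_scale; exact: dwP.
rewrite normrM ler_wpM2l//; have := bound s s01; rewrite normrM.
by case/andP: s01 => s0 _; rewrite (ger0_norm s0) [`|ell p| * s]mulrC.
Qed.

(** The signed integral of [h] along the coordinate line of direction [d], from the initial line to
    [p]. *)
Definition cint d (h : R * R -> R) p :=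
  prim (fun s => h (bpt d p + s *: evec d)) (ell p).

Lemma line_continuous d p (h : R * R -> R) : continuous h ->
  continuous (fun s : R => h (p + s *: evec d)).
Proof.
move=> ch s; apply: (@continuous_comp _ _ _ (fun s : R => p + s *: evec d) h);
  last exact: ch.
by apply: cvgD; [exact: cvg_cst|exact: scalel_continuous].
Qed.

Lemma cint_derive d h p : continuous h -> is_derive p (evec d) (cint d h) (h p).
Proof.
move=> ch; rewrite -[X in is_derive X](addr0 p) -(scale0r (evec d)); apply/line_derive.
have E : (fun t : R => cint d h (p + t *: evec d)) =
    prim (fun s => h (bpt d p + s *: evec d)) \o (fun t : R => t + ell p).
  by apply/funext => t; rewrite /cint /= bpt_line ell_line addrC.
rewrite E -[X in is_derive _ _ _ X]mulr1; apply: is_derive1_comp;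
  last exact: is_derive_shift.
have := (primP (@line_continuous d (bpt d p) h ch)).2 (0 + ell p).
by rewrite add0r bptK.
Qed.

Lemma cint_bpt d h p : continuous h -> ell p = 0 -> cint d h p = 0.
Proof. by move=> ch p0; rewrite /cint p0 (primP (@line_continuous _ _ _ ch)).1. Qed.

Lemma cint_continuous d h : continuous h -> continuous (cint d h).
Proof.
move=> ch p.
pose k (z : (R * R) * R) := h (z.1 + z.2 *: evec d).
have ck : continuous k.
  move=> z; apply: (@continuous_comp _ _ _ (fun z : (R * R) * R => z.1 + z.2 *: evec d) h);
    last exact: ch.
  apply: cvgD; first exact: cvg_fst.
  by apply: cvgZr_tmp; exact: cvg_snd.
apply: (@continuous_comp _ _ _ (fun p => (bpt d p, ell p))
  (fun z : (R * R) * R => prim (fun s => k (z.1, s)) z.2)); last exact: prim_continuous.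
exact: (cvg_pair (@bpt_continuous d p) (@ell_continuous p)).
Qed.

(** Against an exponential weight of rate [l], an integration gains the factor [1 / l]; this is the
    source of the contraction. *)
Lemma cint_bound d h p (C l : R) : 0 < l -> 0 <= C -> continuous h ->
  (forall s : R, 0 <= s <= 1 ->
     `|h (bpt d p + (s * ell p) *: evec d)| <= C * expR (l * `|s * ell p|)) ->
  `|cint d h p| <= C / l * expR (l * `|ell p|).
Proof.
move=> l0 C0 ch bound.
have := @seg_growth d (cint d h) h p C l l0 (fun s _ => @cint_derive d h _ ch) bound.
rewrite (@cint_bpt _ _ (bpt d p))// ?ell_bpt// subr0 => /le_trans; apply.
apply: ler_wpM2l; first by rewrite divr_ge0// ltW.
by rewrite gerBl.
Qed.

Lemma cintB d h k p : continuous h -> continuous k ->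
  cint d (fun q => h q - k q) p = cint d h p - cint d k p.
Proof.
move=> ch ck; have chk : continuous (fun q => h q - k q).
  by move=> q; apply: cvgB; [exact: ch|exact: ck].
rewrite /cint.
have [h0 dh] := primP (@line_continuous d (bpt d p) h ch).
have [k0 dk] := primP (@line_continuous d (bpt d p) k ck).
have [hk0 dhk] := primP (@line_continuous d (bpt d p) _ chk).
have dB y := is_deriveB (dh y) (dk y).
apply: (eq_antiderivative (c := 0) (D := setT) _ (fun y _ => dhk y) (fun y _ => dB y)) =>
  //.
by rewrite -[RHS]/(prim _ 0 - prim _ 0) h0 k0 hk0 subrr.
Qed.

(** Let [M] be the maximum over [K] of the norm of [w] times the weight of rate [- l], with
    [l = 2 L]. Integrating up to the point of maximum gives [M <= c + (L M + e) / l], that is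
    [M <= c + M / 2 + e / (2 L)], whence the constants. A maximum is taken because the entries of
    [w] are differentiated in different directions. *)
Lemma gronwall m n (dir : 'I_m -> 'I_n -> bool) (K : set (R * R))
    (w dw : R * R -> 'M[R]_(m, n)) (L c e : R) :
  compact K ->
  (forall i j p (s : R), K p -> 0 <= s <= 1 ->
     K (bpt (dir i j) p + (s * ell p) *: evec (dir i j))) ->
  0 < L -> 0 <= c -> 0 <= e ->
  {within K, continuous w} ->
  (forall p i j, K p -> is_derive p (evec (dir i j)) (fun q => w q i j) (dw p i j)) ->
  (forall p i j, K p -> `|dw p i j| <= L * `|w p| + e) ->
  (forall p, K p -> ell p = 0 -> `|w p| <= c) ->
  forall p, K p -> `|w p| <= (2 * c + e / L) * expR (2 * L * `|ell p|).
Proof.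
move=> cK segK L0 c0 e0 cw dwP dwb wc p Kp.
pose l := 2 * L; have l0 : 0 < l by rewrite mulr_gt0.
pose f q : R := `|w q| * expR (- (l * `|ell q|)).
have cell q : {for q, continuous (fun q => expR (- (l * `|ell q|)))}.
  apply: (@continuous_comp _ _ _ (fun q => - (l * `|ell q|)) expR);
    last exact: continuous_expR.
  apply: cvgN; apply: cvgM; first exact: cvg_cst.
  by apply: (continuous_comp (@ell_continuous q)); exact: norm_continuous.
have cf : {within K, continuous f}.
  move=> q; apply: (@cvgM _ (subspace K)).
    by apply: (continuous_comp (cw q)); exact: norm_continuous.
  by apply: continuous_subspaceT => //.
have [|q Kq qmax] := @compact_EVT_max _ _ f K _ cK cf; first by exists p.
rewrite inE in Kq.
set M := f q in qmax.
have M0 : 0 <= M by rewrite mulr_ge0// expR_ge0.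
have wM r : K r -> `|w r| <= M * expR (l * `|ell r|).
  move=> Kr; have : f r <= M by apply: qmax; rewrite inE.
  by rewrite /f expRN ler_pdivrMr ?expR_gt0.
have e1 (x : R) : 1 <= expR (l * `|x|) by rewrite -expR0 ler_expR mulr_ge0// ltW.
have key : `|w q| <= (c + (L * M + e) / l) * expR (l * `|ell q|).
  have LMe : 0 <= L * M + e by rewrite addr_ge0// mulr_ge0// ltW.
  apply: mx_norm_le => [|i j].
    by rewrite mulr_ge0 ?expR_ge0// addr_ge0// divr_ge0// ltW.
  have := @seg_growth (dir i j) (fun r => w r i j) (fun r => dw r i j) q (L * M + e) l l0.
  have bK : K (bpt (dir i j) q).
    by have := segK i j q 0 Kq; rewrite mul0r scale0r addr0; apply; rewrite lexx ler01.
  move=> /(_ (fun s s01 => dwP _ _ _ (segK _ _ _ _ Kq s01))) gr.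
  have {}gr : `|w q i j - w (bpt (dir i j) q) i j| <=
    (L * M + e) / l * (expR (l * `|ell q|) - 1).
    apply: gr => s s01; have Ks := segK i j q s Kq s01.
    rewrite (le_trans (dwb _ _ _ Ks))// mulrDl lerD//.
      have := wM _ Ks; rewrite ell_line ell_bpt add0r => h.
      by rewrite -mulrA ler_wpM2l// ltW.
    by rewrite ler_peMr.
  have wb : `|w (bpt (dir i j) q) i j| <= c.
    by rewrite (le_trans (mx_entry_le _ _ _))// wc// ell_bpt.
  rewrite -(subrK (w (bpt (dir i j) q) i j) (w q i j)) (le_trans (ler_normD _ _))//.
  have : c <= c * expR (l * `|ell q|) by rewrite ler_peMr.
  have : 0 <= (L * M + e) / l by rewrite divr_ge0// ltW.
  move: gr wb; rewrite !mulrBr !mulrDl mulr1; lra.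
have Mle : M <= 2 * c + e / L.
  have : M <= c + (L * M + e) / l.
    by rewrite -[leLHS]/(`|w q| * expR (- (l * `|ell q|))) expRN ler_pdivrMr ?expR_gt0.
  rewrite /l (_ : (L * M + e) / (2 * L) = M / 2 + e / L / 2); last by field; rewrite gt_eqF.
  lra.
by rewrite (le_trans (wM p Kp))// ler_wpM2r// expR_ge0.
Qed.

Lemma volterra m n (dir : 'I_m -> 'I_n -> bool) (F : R * R -> 'M[R]_(m, n) -> 'M[R]_(m, n))
    (g : R * R -> 'M[R]_(m, n)) (L B : R) :
  0 < L -> 0 <= B -> continuous g ->
  (forall u, continuous u -> continuous (fun p => F p (u p))) ->
  (forall p u v, `|F p u - F p v| <= L * `|u - v|) ->
  (forall p, `|F p (g p)| <= B) ->
  exists2 u : R * R -> 'M[R]_(m, n), continuous u &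
    forall p i j, u p i j = g p i j + cint (dir i j) (fun q => F q (u q) i j) p.
Proof.
(* Picard iteration converges on the whole plane for a norm weighted by
   [expR (l * `|ell p|)]. *)
move=> L0 B0 cg cF lipF Fg.
pose T (u : R * R -> 'M[R]_(m, n)) p : 'M[R]_(m, n) :=
  \matrix_(i, j) (g p i j + cint (dir i j) (fun q => F q (u q) i j) p).
pose u_ k := iter k T g.
have cFe u i j : continuous u -> continuous (fun p => F p (u p) i j).
  by move=> cu; apply: mx_entry_continuous; exact: cF.
have cT u : continuous u -> continuous (T u).
  move=> cu; apply: mx_continuous => i j.
  have -> : (fun t => T u t i j) = (fun p => g p i j +
    cint (dir i j) (fun q => F q (u q) i j) p).
    by apply/funext => p; rewrite mxE.
  move=> p; apply: cvgD; first exact: mx_entry_continuous.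
  by apply: cint_continuous; exact: cFe.
have cu k : continuous (u_ k) by elim: k => // k; exact: cT.
(* With this rate the map [T] contracts by [L / l], that is by one half. *)
pose l := 2 * L; have l0 : 0 < l by rewrite mulr_gt0.
have l2 : L / l = 2^-1 by rewrite /l; field; rewrite gt_eqF.
pose A := B / l; have A0 : 0 <= A by rewrite divr_ge0// ltW.
pose W p := expR (l * `|ell p|).
have W0 p : 0 <= W p by exact: expR_ge0.
have Tcontr u v C : continuous u -> continuous v -> 0 <= C ->
    (forall p, `|u p - v p| <= C * W p) ->
    forall p i j, `|T u p i j - T v p i j| <= C / 2 * W p.
  move=> cu' cv' C0 uv p i j; rewrite !mxE opprD addrACA subrr add0r.
  rewrite -cintB; [|exact: cFe|exact: cFe].
  have -> : C / 2 = L * C / l by rewrite mulrAC l2 mulrC.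
  apply: cint_bound => //; first by rewrite mulr_ge0// ltW.
    by move=> q; apply: cvgB; exact: cFe.
  move=> s s01; set q := bpt _ _ + _.
  have -> : F q (u q) i j - F q (v q) i j = (F q (u q) - F q (v q)) i j by rewrite !mxE.
  rewrite (le_trans (mx_entry_le _ _ _))// (le_trans (lipF _ _ _))// -mulrA.
  apply: (ler_wpM2l (ltW L0)).
  by rewrite (le_trans (uv q))// /W /q ell_line ell_bpt add0r.
have step k p : `|u_ k.+1 p - u_ k p| <= A / 2 ^+ k * W p.
  elim: k p => [|k IHk] p.
    rewrite expr0 divr1; apply: mx_norm_le => [|i j]; first by rewrite mulr_ge0.
    rewrite !mxE addrC addKr.
    apply: cint_bound => //; first exact: cFe.
    move=> s s01; rewrite (le_trans (mx_entry_le _ _ _))// (le_trans (Fg _))//.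
    by rewrite ler_peMr// -expR0 ler_expR mulr_ge0// ltW.
  apply: mx_norm_le => [|i j]; first by rewrite mulr_ge0// divr_ge0// exprn_ge0.
  rewrite mx_subE exprS invfM [2^-1 * _]mulrC mulrA.
  have := Tcontr (u_ k.+1) (u_ k) (A / 2 ^+ k) (cu _) (cu _) _ IHk p i j.
  by apply; rewrite divr_ge0// exprn_ge0.
have lim p i j : exists x : R, forall k, `|x - u_ k p i j| <= 2 * (A * W p) / 2 ^+ k.
  apply: geometric_limit => k.
  have -> : u_ k.+1 p i j - u_ k p i j = (u_ k.+1 p - u_ k p) i j by rewrite !mxE.
  by rewrite (le_trans (mx_entry_le _ _ _))// (le_trans (step k p))// mulrAC.
pose u p : 'M[R]_(m, n) := \matrix_(i, j) sval (cid (lim p i j)).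
have uP k p : `|u p - u_ k p| <= 2 * A / 2 ^+ k * W p.
  apply: mx_norm_le => [|i j]; first by rewrite mulr_ge0// divr_ge0 ?exprn_ge0// mulr_ge0.
  rewrite !mxE; case: cid => x /= /(_ k) /le_trans; apply.
  by rewrite mulrA mulrAC.
have small (C e : R) : 0 <= C -> 0 < e -> exists k, C / 2 ^+ k < e.
  move=> C0 e0; have Ce : 0 <= C / e by rewrite divr_ge0// ltW.
  exists (Num.bound (C / e)); rewrite ltr_pdivrMr ?exprn_gt0// mulrC -ltr_pdivrMr//.
  by rewrite (lt_le_trans (archi_boundP Ce))// -natrX ler_nat ltnW// ltn_expl.
have cW : continuous W.
  move=> q; apply: (@continuous_comp _ _ _ (fun q => l * `|ell q|) expR);
    last exact: continuous_expR.
  apply: cvgM; first exact: cvg_cst.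
  by apply: (continuous_comp (@ell_continuous q)); exact: norm_continuous.
(* The weight is unbounded, so convergence is uniform only locally: near [p] the weight stays below
   [W p + 1], which suffices for the limit to be continuous. *)
have cu' : continuous u.
  move=> p; apply/cvgrPdist_lt => e e0 /=.
  have e30 : 0 < e / 3 by rewrite divr_gt0.
  have [k kP] := small (2 * A * (W p + 1)) (e / 3) (mulr_ge0 (mulr_ge0 (ler0n _ 2) A0) (addr_ge0 (W0 p) ler01)) e30.
  have near1 : \forall q \near p, W q < W p + 1.
    by have /cvgr_lt := cW p; apply; rewrite ltrDl.
  have /cvgrPdist_lt/(_ _ e30) near2 := cu k p.
  apply: filterS2 near1 near2 => q q1 q2.
  have b (r : R * R) : W r <= W p + 1 -> `|u r - u_ k r| < e / 3.
    move=> rp; rewrite (le_lt_trans (uP k r))// (le_lt_trans _ kP)//.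
    by rewrite mulrAC ler_wpM2r ?invr_ge0 ?exprn_ge0// ler_wpM2l// mulr_ge0.
  have b1 := b p; have b2 := b q (ltW q1).
  have {}b1 : `|u p - u_ k p| < e / 3 by apply: b1; rewrite lerDl.
  rewrite -(subrKA (u_ k p)) (le_lt_trans (ler_normD _ _))//.
  rewrite -[X in _ + `|X|](subrKA (u_ k q)).
  have := ler_normD (u_ k p - u_ k q) (u_ k q - u q).
  rewrite [`|u_ k q - u q|]distrC; move: b1 b2 q2; lra.
exists u => // p i j.
have -> : g p i j + cint (dir i j) (fun q => F q (u q) i j) p = T u p i j by rewrite mxE.
apply/eqP; rewrite -subr_eq0; apply/eqP.
(* Both [u] and [T u] are within a geometric bound of [u_ k.+1 = T (u_ k)], for every [k]; hence
   they agree. *)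
apply: (@le_geometric0 _ _ (2 * A * W p)) => k.
have h1 : `|u p i j - u_ k.+1 p i j| <= 2 * A / 2 ^+ k.+1 * W p.
  have -> : u p i j - u_ k.+1 p i j = (u p - u_ k.+1 p) i j by rewrite !mxE.
  by rewrite (le_trans (mx_entry_le _ _ _))//; exact: uP.
have h2 : `|T u p i j - T (u_ k) p i j| <= 2 * A / 2 ^+ k / 2 * W p.
  by apply: Tcontr => //; rewrite divr_ge0 ?exprn_ge0// mulr_ge0.
rewrite -(subrKA (u_ k.+1 p i j)) (le_trans (ler_normD _ _))//.
rewrite [X in _ + X]distrC.
have -> : 2 * A * W p / 2 ^+ k = 2 * A / 2 ^+ k.+1 * W p + 2 * A / 2 ^+ k / 2 * W p.
  by rewrite exprS; field; rewrite expf_neq0.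
by rewrite lerD.
Qed.

End characteristics.

Arguments evec {R}.

(** * Truncation, boxes and local Lipschitz bounds *)

Section clamping.
Variable R : realType.

(** A truncation with Lipschitz constant 1: it extends data from a segment, and right-hand sides
    from a cube, to bounded ones on the whole space. *)
Definition clamp (a b x : R) : R := if x <= a then a else if b <= x then b else x.

Lemma clamp_in a b x : a <= b -> a <= clamp a b x <= b.
Proof.
by rewrite /clamp => ab; case: (leP x a) => xa; [|case: (leP b x) => bx]; lra.
Qed.

Lemma clamp_id a b x : a <= x <= b -> clamp a b x = x.
Proof.
by rewrite /clamp => axb; case: (leP x a) => xa; [|case: (leP b x) => bx]; lra.
Qed.

Lemma clamp_lip a b x y : a <= b -> `|clamp a b x - clamp a b y| <= `|x - y|.
Proof.
move=> ab; have := ler_norm (x - y); have := ler_norm (y - x).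
rewrite [`|y - x|]distrC; set N := `|x - y| => h1 h2; rewrite ler_norml /clamp.
case: (leP x a) => xa; case: (leP y a) => ya; case: (leP b x) => bx; case: (leP b y) => byy;
  lra.
Qed.

Lemma clamp_continuous a b : a <= b -> continuous (clamp a b).
Proof.
move=> ab x; apply/cvgrPdist_lt => e e0 /=.
apply: filterS (nbhsx_ballx x e e0) => y; rewrite -ball_normE /=.
exact: le_lt_trans (clamp_lip _ _ ab).
Qed.

(* The points whose horizontal and vertical lines meet the initial line between
   the parameters [a] and [b]. *)
Definition box (a b : R) : set (R * R) := [set p | a < p.1 < b /\ a < - p.2 < b].
Definition cbox (a b : R) : set (R * R) := [set p | a <= p.1 <= b /\ a <= - p.2 <= b].
Definition boxclamp (a b : R) (p : R * R) : R * R := (clamp a b p.1, - clamp a b (- p.2)).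

Lemma boxclamp_in a b p : a <= b -> cbox a b (boxclamp a b p).
Proof. by move=> ab; rewrite /cbox /= opprK !clamp_in. Qed.

Lemma boxclamp_id a b p : cbox a b p -> boxclamp a b p = p.
Proof.
by move=> [h1 h2]; rewrite /boxclamp !clamp_id// opprK [RHS]surjective_pairing.
Qed.

Lemma boxclamp_continuous a b : a <= b -> continuous (boxclamp a b).
Proof.
move=> ab p.
have c1 : {for p, continuous (fun p : R * R => clamp a b p.1)}.
  apply: (@continuous_comp _ _ _ (fst : R * R -> R) (clamp a b));
    last exact: clamp_continuous.
  exact: cvg_fst.
have c2 : {for p, continuous (fun p : R * R => - clamp a b (- p.2))}.
  apply: cvgN; apply: (@continuous_comp _ _ _ (fun p : R * R => - p.2) (clamp a b));
    last exact: clamp_continuous.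
  by apply: cvgN; exact: cvg_snd.
exact: (cvg_pair c1 c2).
Qed.

Lemma cbox_compact a b : compact (cbox a b).
Proof.
have -> : cbox a b = `[a, b] `*` `[- b, - a].
  apply/seteqP; split=> [[x y]|[x y]] [/= xab].
    by rewrite lerNr lerNl andbC => yab; split; rewrite /= in_itv.
  by move: xab; rewrite !in_itv /= => xab yab; split; rewrite //= lerNr lerNl andbC.
by apply: compact_setX; exact: segment_compact.
Qed.

Lemma box_open a b : open (box a b).
Proof.
have -> : box a b = [set p | a < p.1] `&` [set p | p.1 < b] `&` ([set p | p.2 < - a] `&` [set p | - b < p.2]).
  apply/seteqP; split=> [[x y]|[x y]] /=; rewrite /box /= ltrNr ltrNl.
    by move=> [/andP[-> ->] /andP[-> ->]].
  by move=> [[-> ->] [-> ->]].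
have c1 : continuous (fst : R * R -> R) by move=> p; exact: cvg_fst.
have c2 : continuous (snd : R * R -> R) by move=> p; exact: cvg_snd.
apply: openI; apply: openI.
- exact: (open_comp (fun p _ => c1 p) (@open_gt _ a)).
- exact: (open_comp (fun p _ => c1 p) (@open_lt _ b)).
- exact: (open_comp (fun p _ => c2 p) (@open_lt _ (- a))).
- exact: (open_comp (fun p _ => c2 p) (@open_gt _ (- b))).
Qed.

Lemma box_cbox a b : box a b `<=` cbox a b.
Proof. by move=> p [/andP[h1 h2] /andP[h3 h4]]; split; apply/andP; split; exact: ltW. Qed.

Lemma cbox_box a b a' b' : a < a' -> b' < b -> cbox a' b' `<=` box a b.
Proof.
move=> aa bb p [/andP[h1 h2] /andP[h3 h4]]; split; apply/andP; split.
- exact: lt_le_trans h1.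
- exact: le_lt_trans bb.
- exact: lt_le_trans h3.
- exact: le_lt_trans bb.
Qed.

Lemma between_segment (a b u v s : R) : a < u < b -> a < v < b -> 0 <= s <= 1 ->
  a < u + s * (v - u) < b.
Proof.
move=> /andP[au ub] /andP[av vb] /andP[s0 s1].
have [->|s_neq0] := eqVneq s 0; first by rewrite mul0r addr0 au.
have sp : 0 < s by rewrite lt_neqAle eq_sym s_neq0.
have : 0 < s * (v - a) by rewrite mulr_gt0// subr_gt0.
have : 0 < s * (b - v) by rewrite mulr_gt0// subr_gt0.
have : 0 <= (1 - s) * (u - a) by rewrite mulr_ge0 ?subr_ge0// ltW.
have : 0 <= (1 - s) * (b - u) by rewrite mulr_ge0 ?subr_ge0// ltW.
by move=> *; apply/andP; split; nra.
Qed.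

(** On the horizontal way from the initial line to [(x, y)] the first coordinate runs from [- y] to
    [x]; on the vertical way the negated second one runs from [x] to [- y]. A box bounds exactly
    these two numbers, so it is its own domain of dependence. *)
Lemma box_seg a b d p (s : R) : box a b p -> 0 <= s <= 1 ->
  box a b (bpt d p + (s * ell p) *: evec d).
Proof.
case: p => x y [/= xb yb] s01.
rewrite /box /bpt /ell /evec /=; case: d => /=;
  rewrite /GRing.scale /= ?mulr0 ?mulr1 ?subr0 ?addr0.
  split=> //; rewrite (_ : x - (x + y) + s * (x + y) = - y + s * (x - - y)); last by ring.
  exact: between_segment.
split=> //; rewrite (_ : - (y - (x + y) + s * (x + y)) = x + s * (- y - x)); last by ring.
exact: between_segment.
Qed.

Lemma cbox_seg a b d p (s : R) : cbox a b p -> 0 <= s <= 1 ->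
  cbox a b (bpt d p + (s * ell p) *: evec d).
Proof.
move=> [/andP[h1 h2] /andP[h3 h4]] /andP[s0 s1].
case: p h1 h2 h3 h4 => x y /= h1 h2 h3 h4.
rewrite /cbox /bpt /ell /evec /=; case: d => /=;
  rewrite /GRing.scale /= ?mulr0 ?mulr1 ?subr0 ?addr0.
  by split; apply/andP; split; nra.
by split; apply/andP; split; nra.
Qed.

Lemma box_diag a b (t : R) : box a b (t, - t) <-> a < t < b.
Proof. by rewrite /box /= opprK; split=> [[]|]. Qed.

Lemma ell0_diag (p : R * R) : ell p = 0 -> p = (p.1, - p.1).
Proof. by case: p => x y; rewrite /ell /= => /eqP; rewrite addr_eq0 => /eqP ->;
  rewrite opprK. Qed.

Lemma ell_diag (t : R) : ell (t, - t) = 0.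
Proof. by rewrite /ell /= subrr. Qed.

Lemma compact_bound (T : topologicalType) (K : set T) (f : T -> R) :
  compact K -> {within K, continuous f} -> exists2 C : R, 0 < C & forall q, K q ->
    `|f q| <= C.
Proof.
move=> cK cf.
have /ex_strict_bound_gt0[C C0 CP] : bounded_set (f @` K).
  exact/compact_bounded/continuous_compact.
by exists C => // q Kq; apply/ltW/CP; exists q.
Qed.

(** The neighbourhood is one of the pair [(q, h)]; in this joint form, compactness of a segment
    yields a single bound on [h] for all [q]. *)
Lemma shift_near (V : normedModType R) (q0 v : V) (P : set V) :
  (\forall x \near q0, P x) ->
  \forall q \near q0 & h \near (0 : R), forall s : R, `|s| <= `|h| -> P (q + s *: v).
Proof.
move=> /nbhs_ballP[r /= r0 rP].
have v1 : 0 < `|v| + 1 by rewrite ltr_wpDl.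
exists (ball q0 (r / 2), ball 0 (r / 2 / (`|v| + 1))) => /=.
  by split; apply: nbhsx_ballx; rewrite !divr_gt0.
move=> [q h] [/= qr]; rewrite -ball_normE /= sub0r normrN => hr s sh; apply: rP.
move: qr; rewrite -!ball_normE /= => qr.
rewrite opprD addrA (le_lt_trans (ler_normB _ _))// [ltRHS]splitr ltr_leD// normrZ.
have : `|s| * `|v| <= r / 2 / (`|v| + 1) * (`|v| + 1).
  apply: ler_pM => //; first exact: le_trans sh (ltW hr).
  by rewrite lerDl.
by rewrite divfK// gt_eqF.
Qed.

Lemma is_derive_at (V : normedModType R) (f : V -> R) p v (d : R) :
  (forall e : R, 0 < e -> \forall h \near (0 : R),
    `|f (p + h *: v) - f p - h * d| <= e * `|h|) ->
  is_derive p v f d.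
Proof.
move=> H; rewrite -[p]addr0 -(scale0r v); apply/line_derive.
have [||e e0|df dE] := @differentiable_at R R R (fun t => f (p + t *: v)) 0 (fun h =>
  h * d).
- by move=> a x y /=; rewrite mulrDl -mulrA.
- exact: mulrr_continuous.
- by apply: filterS (H e e0) => h; rewrite add0r scale0r addr0.
constructor; first exact: diff_derivable.
by rewrite dE mul1r.
Qed.

Lemma local_lipschitz (V : normedModType R) (F : frame V) (D : set V) (g : V -> R) p :
  open D -> D p -> Cn 1 D g ->
  exists L : R, 0 < L /\ \forall r \near 0^'+, ball p r `<=` D /\
    forall a b, ball p r a -> ball p r b -> `|g a - g b| <= L * `|a - b|.
Proof.
move=> oD Dp cg; have [C C0 CP] := frame_coord_bound F.
have [r [r0 rD rP]] := strict_diff F oD Dp cg ltr01.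
pose S := \sum_i `|'D_(frame_vec F i) g p|.
have S0 : 0 <= S by apply: sumr_ge0.
exists (C * S + 1); split; first by rewrite ltr_wpDl// mulr_ge0// ltW.
near=> x; have xr : x <= r by near: x; exact: nbhs_right_le.
split=> [q|a b pa pb]; first by move/(le_ball xr)/rD.
have {}pa := le_ball xr pa; have {}pb := le_ball xr pb.
have := rP a b p pa pb (ballxx _ r0); rewrite mul1r => h.
rewrite -(subrK ('D_(a - b) g p) (g a - g b)) (le_trans (ler_normD _ _))//.
rewrite mulrDl mul1r addrC lerD//.
rewrite (derive_frame F (a - b)); last exact: Cn_differentiable cg Dp.
rewrite (le_trans (ler_norm_sum _ _ _))// mulrAC.
apply: (@le_trans _ _ (\sum_i `|frame_coord F i (a - b)| * S)).
  apply: ler_sum => i _; rewrite normrM ler_wpM2l//.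
  by rewrite /S (bigD1 i)//= lerDl sumr_ge0.
by rewrite -mulr_suml ler_wpM2r.
Unshelve. all: by end_near. Qed.

(** Each entry of the initial value is transported along its own direction. This is the free term of
    the integral equation, since its derivative in that direction vanishes. *)
Lemma volterra_line m n (dir : 'I_m -> 'I_n -> bool)
    (F : R * R -> 'M[R]_(m, n) -> 'M[R]_(m, n)) (g : R * R -> 'M[R]_(m, n)) (L B C : R) :
  0 < L -> 0 <= B -> 0 <= C -> continuous g ->
  (forall u, continuous u -> continuous (fun p => F p (u p))) ->
  (forall p u v, `|F p u - F p v| <= L * `|u - v|) ->
  (forall p, `|F p 0| <= B) -> (forall p, `|g p| <= C) ->
  exists u : R * R -> 'M[R]_(m, n), [/\ continuous u,
    forall p i j, is_derive p (evec (dir i j)) (fun q => u q i j) (F p (u p) i j) &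
    forall p, ell p = 0 -> u p = g p].
Proof.
move=> L0 B0 C0 cg cF lipF F0 gC.
pose g' p : 'M[R]_(m, n) := \matrix_(i, j) g (bpt (dir i j) p) i j.
have cg' : continuous g'.
  apply: mx_continuous => i j.
  have -> : (fun p => g' p i j) = (fun p => g p i j) \o bpt (dir i j).
    by apply/funext => p; rewrite mxE.
  move=> p; apply: continuous_comp; first exact: bpt_continuous.
  exact: mx_entry_continuous.
have Fg p : `|F p (g' p)| <= B + L * C.
  rewrite -(subrK (F p 0) (F p (g' p))) addrC (le_trans (ler_normD _ _))// lerD//.
  rewrite (le_trans (lipF _ _ _))// subr0; apply: (ler_wpM2l (ltW L0)).
  by apply: mx_norm_le => // i j; rewrite mxE (le_trans (mx_entry_le _ _ _)).
have BLC : 0 <= B + L * C by rewrite addr_ge0// mulr_ge0// ltW.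
have [u cu uE] := volterra dir L0 BLC cg' cF lipF Fg.
have cFe i j : continuous (fun p => F p (u p) i j).
  by apply: mx_entry_continuous; exact: cF.
exists u; split=> // [p i j|p p0].
  have -> : (fun q => u q i j) = (fun q => g' q i j +
    cint (dir i j) (fun q => F q (u q) i j) q).
    by apply/funext => q; exact: uE.
  rewrite -[F p (u p) i j]add0r; apply: is_deriveD; last exact: cint_derive.
  rewrite -[p in is_derive p](addr0 p) -(scale0r (evec (dir i j))); apply/line_derive.
  have -> : (fun t : R => g' (p + t *: evec (dir i j)) i j) = cst (g' p i j).
    by apply/funext => t; rewrite !mxE bpt_line.
  exact: is_derive_cst.
by apply/matrixP => i j; rewrite uE cint_bpt// addr0 mxE bpt_id.
Qed.

End clamping.

(** * Semilinear hyperbolic systems *)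

Section semilinear.
Variable R : realType.

Lemma cvg_bigsum (T : topologicalType) (I : Type) (r : seq I) (f : I -> T -> R) t :
  (forall i, {for t, continuous (f i)}) ->
  {for t, continuous (fun s => \sum_(i <- r) f i s)}.
Proof.
move=> cf; elim: r => [|i r IHr].
  rewrite (_ : (fun s => _) = cst 0); first exact: cvg_cst.
  by apply/funext => s; rewrite big_nil.
rewrite (_ : (fun s => _) = (fun s => f i s + \sum_(j <- r) f j s)).
  by apply: cvgD; [exact: cf|exact: IHr].
by apply/funext => s; rewrite big_cons.
Qed.

Lemma mx_continuous_at (T : topologicalType) m n (f : T -> 'M[R]_(m, n)) t :
  (forall i j, {for t, continuous (fun s => f s i j)}) -> {for t, continuous f}.
Proof.
move=> cf; apply/cvgrPdist_le => e e0; near=> s.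
apply: mx_norm_le (ltW e0) _ => i j; rewrite !mxE; move: i j; near: s.
apply: filter_forall => i; apply: filter_forall => j.
by have /cvgrPdist_le := cf i j; apply.
Unshelve. all: by end_near. Qed.

Lemma mx_entry_continuous_at (T : topologicalType) m n (f : T -> 'M[R]_(m, n)) i j t :
  {for t, continuous f} -> {for t, continuous (fun s => f s i j)}.
Proof.
move=> cf; apply: (@continuous_comp _ _ _ f (fun M : 'M[R]_(m, n) => M i j)) => //.
exact: coord_continuous.
Qed.

Lemma within_continuous (T : topologicalType) (V : normedModType R) (K : set T) (f : T ->
  V) :
  (forall t, K t -> {for t, continuous f}) -> {within K, continuous f}.
Proof. by move=> cf; apply: continuous_in_subspaceT => t; rewrite inE => /cf. Qed.

Lemma is_derive_translate (V W : normedModType R) (f : V -> W) (q v e : V) (d : W) :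
  is_derive (q + v) e f d -> is_derive q e (fun x => f (x + v)) d.
Proof.
rewrite -[in is_derive (q + v)](addr0 (q + v)) -[in X in _ -> X](addr0 q) -(scale0r e).
move=> /line_derive H; apply/line_derive; move: H; congr is_derive.
by apply/funext => t; rewrite addrAC.
Qed.

Lemma ball_subset_near (V : normedModType R) (A : set V) x : open A -> A x ->
  \forall r \near 0^'+, ball x r `<=` A.
Proof.
move=> oA Ax; have /nbhs_ballP[e /= e0 eA] := open_nbhs_nbhs (conj oA Ax).
by apply: filterS (nbhs_right_le e0) => r re t /(le_ball re)/eA.
Qed.

Lemma box_near (t0 eta : R) (P : set (R * R)) : 0 < eta ->
  (\forall p \near (t0, - t0), P p) ->
  exists d : R, [/\ 0 < d, d <= eta & box (t0 - d) (t0 + d) `<=` P].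
Proof.
move=> eta0 /nbhs_ballP[r /= r0 rP].
exists (Num.min r eta); split; [by rewrite lt_min r0 | by rewrite ge_min lexx orbT|].
move=> [x y] [/=]; set d := Num.min r eta => xb yb; apply: rP.
have dr : d <= r by rewrite ge_min lexx.
by split; rewrite -ball_normE /= ltr_norml; lra.
Qed.

Lemma box_inside (a b : R) p : box a b p ->
  exists a' b', [/\ a < a', b' < b, a' <= b' & box a' b' p].
Proof.
move=> [/andP[h1 h2] /andP[h3 h4]].
exists ((a + Num.min p.1 (- p.2)) / 2), ((b + Num.max p.1 (- p.2)) / 2).
rewrite /box /=; case: (leP p.1 (- p.2)) => h; split; try lra; split; lra.
Qed.

(* The entry [u i j] is differentiated along [x] if [dir i j] and along [y]
   otherwise; the initial values are given on [y = - x]. *)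
Definition solves m n (D : set (R * R)) (dir : 'I_m -> 'I_n -> bool)
    (F : 'M[R]_(m, n) -> 'M[R]_(m, n)) (u0 : R -> 'M[R]_(m, n))
    (u : R * R -> 'M[R]_(m, n)) : Prop :=
  [/\ forall p, D p -> {for p, continuous u},
      forall p i j, D p -> is_derive p (evec (dir i j)) (fun q => u q i j) (F (u p) i j) &
      forall t, D (t, - t) -> u (t, - t) = u0 t].

(** [F] is composed with a truncation to a cube around [u0 t0], and [u0] with one of its parameter.
    The truncated problem is solvable on the whole plane, and by continuity its solution stays in
    the cube on a small box, where the truncation does nothing. *)
Lemma local_solution m n (dir : 'I_m -> 'I_n -> bool) (O : set 'M[R]_(m, n))
    (F : 'M[R]_(m, n) -> 'M[R]_(m, n)) (A : set R) (u0 : R -> 'M[R]_(m, n)) (t0 : R) :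
  open O -> Cn 1 O F -> open A -> A t0 -> (forall t, A t -> {for t, continuous u0}) ->
  O (u0 t0) ->
  exists d u, [/\ 0 < d, forall t, t0 - d < t < t0 + d -> A t,
    solves (box (t0 - d) (t0 + d)) dir F u0 u &
    forall p, box (t0 - d) (t0 + d) p -> O (u p)].
Proof.
move=> oO cF oA At0 cu0 Ous; set us := u0 t0 in Ous.
have lip i j : exists L : R, 0 < L /\ \forall r \near 0^'+, ball us r `<=` O /\
    forall a b, ball us r a -> ball us r b -> `|F a i j - F b i j| <= L * `|a - b|.
  apply: (@local_lipschitz _ _ (frame_mx R m n) O (fun v => F v i j)) => //.
  by move/Cn_mxP : cF => /(_ oO); apply.
pose L_ i j := sval (cid (lip i j)).
have L_P i j := svalP (cid (lip i j)).
(* The sum dominates the constants of all entries; the 1 makes it positive. *)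
pose L := 1 + \sum_i \sum_j L_ i j.
have L_ge0 i j : 0 <= L_ i j by rewrite ltW// (L_P i j).1.
have S0 : 0 <= \sum_i \sum_j L_ i j by apply: sumr_ge0 => i _; exact: sumr_ge0.
have L0 : 0 < L by rewrite ltr_wpDr.
have LL i j : L_ i j <= L.
  have h1 : L_ i j <= \sum_k L_ i k by rewrite (bigD1 j)//= lerDl sumr_ge0.
  have h2 : \sum_k L_ i k <= \sum_l \sum_k L_ l k.
    by rewrite (bigD1 i)//= lerDl; apply: sumr_ge0 => k _; exact: sumr_ge0.
  by rewrite /L (le_trans h1)// (le_trans h2)// lerDr.
have : \forall r \near 0^'+, [/\ (0 : R) < r, ball t0 r `<=` A, ball us r `<=` O &
  forall i j,
    (ball us r `<=` O /\
    forall a b, ball us r a -> ball us r b -> `|F a i j - F b i j| <= L_ i j * `|a - b|)].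
  near=> r; split.
  - by near: r; exact: nbhs_right_gt.
  - by near: r; exact: ball_subset_near.
  - by near: r; exact: ball_subset_near.
  - by near: r; apply: filter_forall => i; apply: filter_forall => j; exact: (L_P i j).2.
move=> /filter_ex[rho [rho0 rhoA rhoO rhoL]].
(* Half the radius, so that truncated values lie in the open ball. *)
pose h := rho / 2; have h0 : 0 < h by rewrite divr_gt0.
have hrho : h < rho by rewrite /h; lra.
pose cl (v : 'M[R]_(m, n)) : 'M[R]_(m, n) :=
  \matrix_(i, j) clamp (us i j - h) (us i j + h) (v i j).
have ush i j : us i j - h <= us i j + h by lra.
have clus v : ball us rho (cl v).
  rewrite -ball_normE /=; apply: le_lt_trans hrho.
  apply: mx_norm_le (ltW h0) _ => i j; rewrite !mxE.
  by have := clamp_in (v i j) (ush i j); rewrite ler_norml; lra.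
have cllip v w : `|cl v - cl w| <= `|v - w|.
  apply: mx_norm_le => // i j; rewrite mx_subE !mxE.
  by rewrite (le_trans (clamp_lip _ _ (ush i j)))// -mx_subE mx_entry_le.
have Flip v w : `|F (cl v) - F (cl w)| <= L * `|v - w|.
  apply: mx_norm_le => [|i j]; first by rewrite mulr_ge0// ltW.
  rewrite mx_subE (le_trans ((rhoL i j).2 _ _ (clus v) (clus w)))//.
  by apply: ler_pM.
have th : t0 - h <= t0 + h by lra.
pose tc := clamp (t0 - h) (t0 + h).
have tcA t : A (tc t).
  apply: rhoA; rewrite -ball_normE /=.
  by have := clamp_in t th; rewrite -/(tc t) => /andP[]; rewrite ltr_norml; lra.
pose g (p : R * R) := u0 (tc p.1).
have ctc : continuous (u0 \o tc).
  by move=> t; apply: continuous_comp; [exact: clamp_continuous|exact: cu0].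
have cg : continuous g.
  move=> p; apply: (@continuous_comp _ _ _ (fst : R * R -> R) (u0 \o tc)); last exact: ctc.
  exact: cvg_fst.
have [C C0 CP] : exists2 C : R, 0 < C & forall t, `[t0 - h, t0 + h]%classic t ->
  `|(`|u0 t| : R)| <= C.
  apply: compact_bound; first exact: segment_compact.
  apply: within_continuous => t; rewrite /= in_itv /= => tin.
  apply: (@continuous_comp _ _ _ u0 (fun v => `|v|)); last exact: norm_continuous.
  by apply: cu0; rewrite -(clamp_id tin); exact: tcA.
have gC p : `|g p| <= C.
  by have := CP (tc p.1); rewrite normr_id; apply; rewrite /= in_itv /= clamp_in.
have cFcl v : continuous v -> continuous (fun p : R * R => F (cl (v p))).
  move=> cv p; apply: (@continuous_comp _ _ _ (fun p => cl (v p)) F).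
    apply/cvgrPdist_lt => e e0; have /cvgrPdist_lt/(_ _ e0) := cv p.
    by apply: filterS => q; apply: le_lt_trans; exact: cllip.
  by apply: Cn_continuous cF _; apply: rhoO; exact: clus.
have [u [cu du u0E]] := volterra_line dir L0 (normr_ge0 (F (cl 0))) (ltW C0) cg cFcl
  (fun _ => Flip) (fun _ => lexx _) gC.
have uus : u (t0, - t0) = us.
  by rewrite u0E ?ell_diag// /g /= /tc clamp_id//; lra.
have near_us : \forall p \near (t0, - t0), `|us - u p| < h.
  by have /cvgrPdist_lt/(_ _ h0) := cu (t0, - t0); rewrite uus.
have [d [d0 dh dP]] := box_near h0 near_us.
exists d, u; split=> // [t /andP[t1 t2]||p pd].
- by apply: rhoA; rewrite -ball_normE /= ltr_norml; lra.
- split=> [p _|p i j pd|t /box_diag/andP[t1 t2]]; first exact: cu.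
    have -> : F (u p) i j = F (cl (u p)) i j; last exact: du.
    congr (F _ i j); apply/matrixP => k l; rewrite mxE clamp_id//.
    have := le_lt_trans (mx_entry_le (us - u p) k l) (dP p pd).
    by rewrite mx_subE ltr_norml; lra.
  rewrite u0E ?ell_diag// /g /= /tc clamp_id//; lra.
- apply: rhoO; rewrite -ball_normE /=; exact: lt_trans (dP p pd) hrho.
Unshelve. all: by end_near. Qed.

End semilinear.

Section derivable_estimate.

Lemma derivable_estimate (R : realType) (V : normedModType R) (f : V -> R) p v (d : R) :
  is_derive p v f d ->
  forall e : R, 0 < e -> \forall h \near (0 : R),
    `|f (p + h *: v) - f p - h * d| <= e * `|h|.
Proof.
move=> fd e e0; pose g (t : R) := f (p + t *: v).
have dg : is_derive (0 : R) 1 g d by apply/line_derive; rewrite scale0r addr0.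
have gd : differentiable g 0 by apply/derivable1_diffP; case: dg.
have /eqaddoP/(_ _ e0) := diff_locally gd.
apply: filterS => k; rewrite !fctE /= addr0 /g scale0r addr0 opprD addrA.
have -> // : 'd g 0 k = k * d.
rewrite -[in LHS](mulr1 k) -[k * 1]/(k *: 1) linearZ -deriveE//.
by case: dg => _ ->.
Qed.

End derivable_estimate.

(** * First derivatives of a solution *)

Section first_order.
Variables (R : realType) (m n : nat).
Notation M := 'M[R]_(m, n).
Implicit Types (dir : 'I_m -> 'I_n -> bool) (O : set M) (F : M -> M).

(** For [A = F u] and [B = r] this is the full derivative of [u] along [evec d]: the entries given
    by the system together with those collected in [r]. *)
Definition mixed dir (d : bool) (A B : M) : M :=
  \matrix_(k, l) if dir k l == d then A k l else B k l.

(* If [u] solves the system of [F] and [r] collects the derivatives of the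
   entries of [u] in the directions in which the system does not give them,
   then [r] solves the system of [ext_field dir F u]. *)
Definition ext_field dir F (u r : M) : M :=
  \matrix_(i, j) 'D_(mixed dir (~~ dir i j) (F u) r) (fun v => F v i j) u.

(** Along the initial line [u0' = u_x - u_y], and [F] gives one of the two derivatives of each
    entry; solving for the other one produces the sign. *)
Definition ext_init dir F (u0 : R -> M) (t : R) : M :=
  \matrix_(i, j) (F (u0 t) i j + (if dir i j then -1 else 1) * 'D_1 u0 t i j).

Definition grad_size F (u : M) : R :=
  \sum_i \sum_j \sum_k `|'D_(frame_vec (frame_mx R m n) k) (fun v => F v i j) u|.

Lemma mixed_le dir d (A B B' : M) : `|mixed dir d A B - mixed dir d A B'| <= `|B - B'|.
Proof.
apply: mx_norm_le => // i j; rewrite mx_subE !mxE.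
by case: ifP => _; [rewrite subrr normr0|rewrite -mx_subE mx_entry_le].
Qed.

Lemma mixed_norm dir d (A B : M) : `|mixed dir d A B| <= `|A| + `|B|.
Proof.
apply: mx_norm_le => [|i j]; first by rewrite addr_ge0.
rewrite !mxE; case: ifP => _; rewrite (le_trans (mx_entry_le _ _ _))//.
  by rewrite lerDl.
by rewrite lerDr.
Qed.

Lemma grad_sizeP O F (u v : M) i j : open O -> Cn 1 O F -> O u ->
  `|'D_v (fun w => F w i j) u| <= grad_size F u * `|v|.
Proof.
move=> oO cF Ou.
rewrite (derive_frame (frame_mx R m n)); last
  exact: Cn_differentiable (Cn_entry i j oO cF) Ou.
rewrite (le_trans (ler_norm_sum _ _ _))//.
have -> : grad_size F u * `|v| = \sum_i \sum_j (\sum_k `|'D_(frame_vec (frame_mx R m n) k) (fun v => F v i j) u|) * `|v|.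
  by rewrite mulr_suml; apply: eq_bigr => k _; rewrite mulr_suml.
have pos k l : 0 <= (\sum_x `|'D_(frame_vec (frame_mx R m n) x) (fun v =>
  F v k l) u|) * `|v|.
  by rewrite mulr_ge0// sumr_ge0.
rewrite (bigD1 i)//= (bigD1 j)//= -addrA.
apply: (@le_trans _ _ ((\sum_x `|'D_(frame_vec (frame_mx R m n) x) (fun v =>
  F v i j) u|) * `|v|)).
  rewrite mulr_suml; apply: ler_sum => k _; rewrite normrM mulrC ler_wpM2l//.
  exact: mx_entry_le.
rewrite lerDl addr_ge0//; first by apply: sumr_ge0.
by apply: sumr_ge0 => k _; apply: sumr_ge0.
Qed.

Lemma derive_linear O F i j (u v w : M) (h : R) : open O -> Cn 1 O F -> O u ->
  'D_(v + h *: w) (fun x => F x i j) u = 'D_v (fun x => F x i j) u +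
    h * 'D_w (fun x => F x i j) u.
Proof.
move=> oO cF Ou; have df := Cn_differentiable (Cn_entry i j oO cF) Ou.
by rewrite !deriveE// linearD linearZ.
Qed.

Lemma grad_size_continuous (T : topologicalType) O F (U : T -> M) t :
  open O -> Cn 1 O F -> O (U t) -> {for t, continuous U} ->
  {for t, continuous (fun s => grad_size F (U s))}.
Proof.
move=> oO cF Ot cU.
apply: cvg_bigsum => i; apply: cvg_bigsum => j; apply: cvg_bigsum => k.
apply: (@continuous_comp _ _ _ (fun s => 'D_(frame_vec (frame_mx R m n) k) (fun v =>
  F v i j) (U s)) (fun x : R => `|x|)); last exact: norm_continuous.
apply: (@continuous_comp _ _ _ U ('D_(frame_vec (frame_mx R m n) k) (fun v => F v i j))) =>
  //.
by have /(_ (U t) Ot) := Cn_derive (frame_vec (frame_mx R m n) k) (Cn_entry i j oO cF).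
Qed.

Lemma derive_along_continuous (T : topologicalType) O F i j (U w : T -> M) t :
  open O -> Cn 1 O F -> (forall s, O (U s)) -> {for t, continuous U} ->
    {for t, continuous w} ->
  {for t, continuous (fun s => 'D_(w s) (fun v => F v i j) (U s))}.
Proof.
move=> oO cF OU cU cw.
rewrite (_ : (fun s => _) = (fun s => \sum_k frame_coord (frame_mx R m n) k (w s) *
   'D_(frame_vec (frame_mx R m n) k) (fun v => F v i j) (U s))).
  apply: cvg_bigsum => k; apply: cvgM; first exact: mx_entry_continuous_at.
  apply: (@continuous_comp _ _ _ U ('D_(frame_vec (frame_mx R m n) k) (fun v => F v i j)))
    => //.
  by have /(_ (U t) (OU t)) := Cn_derive (frame_vec (frame_mx R m n) k) (Cn_entry i j oO cF).
apply/funext => s; rewrite (derive_frame (frame_mx R m n))//.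
exact: Cn_differentiable (Cn_entry i j oO cF) (OU s).
Qed.

Lemma mixed_continuous (T : topologicalType) dir d (A B : T -> M) t :
  {for t, continuous A} -> {for t, continuous B} ->
  {for t, continuous (fun s => mixed dir d (A s) (B s))}.
Proof.
move=> cA cB; apply: mx_continuous_at => i j.
rewrite (_ : (fun s => _) = (fun s => if dir i j == d then A s i j else B s i j)).
  by case: (dir i j == d); exact: mx_entry_continuous_at.
by apply/funext => s; rewrite mxE.
Qed.

(** The system for [r] is linear, with coefficients depending on the known [u]. Composing [u] with
    [boxclamp] makes them bounded and continuous on the whole plane, so [r] exists over the entire
    closed box and not only near the diagonal. That [r] consists of derivatives of [u] is the
    subject of [other_derivative]. *)
Lemma linearized_solution dir O F (a b : R) (u0 : R -> M) (u : R * R -> M) (a' b' : R) :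
  open O -> Cn 1 O F -> solves (box a b) dir F u0 u -> (forall p, box a b p -> O (u p)) ->
  Cn 1 [set t | a < t < b] u0 ->
  a < a' -> b' < b -> a' <= b' ->
  exists r : R * R -> M, [/\ continuous r,
    forall p i j, cbox a' b' p ->
      is_derive p (evec (dir i j)) (fun q => r q i j) (ext_field dir F (u p) (r p) i j) &
    forall t, a' <= t <= b' -> r (t, - t) = ext_init dir F u0 t].
Proof.
move=> oO cF [cu du u0E] Ou cu0 aa bb ab'.
have cbD : cbox a' b' `<=` box a b := cbox_box aa bb.
pose U p := u (boxclamp a' b' p).
have cbU p : cbox a' b' (boxclamp a' b' p) := boxclamp_in p ab'.
have cU : continuous U.
  by move=> p; apply: continuous_comp; [exact: boxclamp_continuous|exact/cu/cbD].
have OU p : O (U p) by apply/Ou/cbD.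
have cFO v : O v -> {for v, continuous F} by move=> Ov; exact: Cn_continuous cF Ov.
have cFU p : {for p, continuous (fun q => F (U q))}.
  by apply: (@continuous_comp _ _ _ U F); [exact: cU|exact: cFO].
have [L L0 LP] : exists2 L : R, 0 < L & forall q, cbox a' b' q -> `|grad_size F (u q)| <= L.
  apply: compact_bound; first exact: cbox_compact.
  apply: within_continuous => q /cbD qD.
  by apply: (grad_size_continuous oO cF); [exact: Ou|exact: cu].
have [L' L'0 L'P] : exists2 L : R, 0 < L & forall q, cbox a' b' q ->
  `|(`|F (u q)| : R)| <= L.
  apply: compact_bound; first exact: cbox_compact.
  apply: within_continuous => q /cbD qD.
  apply: (@continuous_comp _ _ _ (fun q => F (u q)) (fun v => `|v|));
    last exact: norm_continuous.
  by apply: (@continuous_comp _ _ _ u F); [exact: cu|exact/cFO/Ou].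
pose G p r := ext_field dir F (U p) r.
have gradU p i j v : `|'D_v (fun w => F w i j) (U p)| <= L * `|v|.
  rewrite (le_trans (grad_sizeP v i j oO cF (OU p)))// ler_wpM2r//.
  exact: le_trans (ler_norm _) (LP _ (cbU p)).
have Glip p v w : `|G p v - G p w| <= L * `|v - w|.
  apply: mx_norm_le => [|i j]; first by rewrite mulr_ge0// ltW.
  rewrite mx_subE !mxE.
  have -> : mixed dir (~~ dir i j) (F (U p)) v = mixed dir (~~ dir i j) (F (U p)) w +
     1 *: (mixed dir (~~ dir i j) (F (U p)) v - mixed dir (~~ dir i j) (F (U p)) w).
    by rewrite scale1r addrC subrK.
  rewrite (derive_linear _ _ _ _ _ oO cF (OU p)) mul1r addrC addKr.
  rewrite (le_trans (gradU _ _ _ _))//.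
  by apply: (ler_wpM2l (ltW L0)); exact: mixed_le.
have G0 p : `|G p 0| <= L * L'.
  apply: mx_norm_le => [|i j]; first by rewrite mulr_ge0// ltW.
  rewrite mxE (le_trans (gradU _ _ _ _))//; apply: (ler_wpM2l (ltW L0)).
  rewrite (le_trans (mixed_norm _ _ _ _))// normr0 addr0.
  by have := L'P _ (cbU p); rewrite normr_id.
have cG v : continuous v -> continuous (fun p => G p (v p)).
  move=> cv p; apply: mx_continuous_at => i j.
  rewrite (_ : (fun s => _) = (fun s => 'D_(mixed dir (~~ dir i j) (F (U s)) (v s)) (fun w
    => F w i j) (U s))).
    apply: (derive_along_continuous oO cF); [exact: OU|exact: cU|].
    by apply: mixed_continuous; [exact: cFU|exact: cv].
  by apply/funext => s; rewrite mxE.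
have tin t : a' <= t <= b' -> a < t < b.
  move=> /andP[t1 t2]; apply/andP; split; [exact: lt_le_trans t1|exact: le_lt_trans bb].
have ci t : a < t < b -> {for t, continuous (ext_init dir F u0)}.
  move=> tab; apply: mx_continuous_at => i j.
  have tD : box a b (t, - t) by apply/box_diag.
  rewrite (_ : (fun s => _) = (fun s => F (u0 s) i j +
    (if dir i j then -1 else 1) * 'D_1 u0 s i j)).
    apply: cvgD.
      apply: mx_entry_continuous_at; apply: (@continuous_comp _ _ _ u0 F).
        exact: Cn_continuous cu0 _.
      by apply: cFO; rewrite -u0E//; exact: Ou.
    apply: cvgM; first exact: cvg_cst.
    have cD : {for t, continuous ('D_1 u0)} :=
      Cn_continuous (Cn_derive (1 : R) cu0) tab.
    apply: (@continuous_comp _ _ _ ('D_1 u0) (fun A : M => A i j)); first exact: cD.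
    exact: coord_continuous.
  by apply/funext => s; rewrite mxE.
pose g (p : R * R) := ext_init dir F u0 (clamp a' b' p.1).
have cg : continuous g.
  move=> p; apply: (@continuous_comp _ _ _ (fun p : R * R =>
    clamp a' b' p.1) (ext_init dir F u0)).
    apply: (@continuous_comp _ _ _ (fst : R * R -> R) (clamp a' b'));
      last exact: clamp_continuous.
    exact: cvg_fst.
  by apply: ci; apply: tin; exact: clamp_in.
have [C C0 CP] : exists2 C : R, 0 < C & forall t, `[a', b']%classic t ->
  `|(`|ext_init dir F u0 t| : R)| <= C.
  apply: compact_bound; first exact: segment_compact.
  apply: within_continuous => t; rewrite /= in_itv /= => /tin tab.
  apply: (@continuous_comp _ _ _ (ext_init dir F u0) (fun v => `|v|));
    last exact: norm_continuous.
  exact: ci.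
have gC p : `|g p| <= C.
  by have := CP (clamp a' b' p.1); rewrite normr_id; apply; rewrite /= in_itv /= clamp_in.
have LL' : 0 <= L * L' by rewrite mulr_ge0// ltW.
have [r [cr dr r0E]] := volterra_line dir L0 LL' (ltW C0) cg cG Glip G0 gC.
exists r; split=> // [p i j pc|t tab].
  by have := dr p i j; rewrite /G /U boxclamp_id.
by rewrite (r0E _ (ell_diag t)) /g /= (clamp_id tab).
Qed.

(** The characteristic segment from the initial line to [p]. *)
Definition seg d (p : R * R) : set (R * R) :=
  (fun s : R => bpt d p + (s * ell p) *: evec d) @` `[0, 1].

Lemma seg_compact d p : compact (seg d p).
Proof.
apply: continuous_compact; last exact: segment_compact.
apply: continuous_subspaceT => s; apply: cvgD; first exact: cvg_cst.
apply: cvgZr_tmp; apply: cvgM; [exact: cvg_id|exact: cvg_cst].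
Qed.

Lemma seg_box d p a b : box a b p -> seg d p `<=` box a b.
Proof. by move=> pb q [s]; rewrite /= in_itv /= => s01 <-; exact: box_seg. Qed.

Lemma seg_seg d p q (s : R) : seg d p q -> 0 <= s <= 1 ->
  seg d p (bpt d q + (s * ell q) *: evec d).
Proof.
move=> [t]; rewrite /= in_itv /= => /andP[t0 t1] <- /andP[s0 s1].
exists (s * t).
  by rewrite /= in_itv /= mulr_ge0// mulr_ile1.
by rewrite bpt_line ell_line ell_bpt add0r (bpt_id _ (ell_bpt _ _)) mulrA.
Qed.

Lemma seg_end d p : seg d p p.
Proof. by exists 1; [rewrite /= in_itv /= ler01 lexx|rewrite mul1r bptK]. Qed.

Lemma seg_bpt d p : seg d p (bpt d p).
Proof. by exists 0; [rewrite /= in_itv /= ler01 lexx|rewrite mul0r scale0r addr0]. Qed.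

Lemma seg_ell0 d p q : seg d p q -> ell q = 0 -> q = bpt d p.
Proof.
move=> [s _ <-]; rewrite ell_line ell_bpt add0r => ->.
by rewrite scale0r addr0.
Qed.

Lemma diag_derivative dir O F (a b : R) (u0 : R -> M) (u : R * R -> M) i j (t : R) :
  open O -> Cn 1 O F -> solves (box a b) dir F u0 u -> (forall p, box a b p -> O (u p)) ->
  Cn 1 [set t | a < t < b] u0 -> a < t < b ->
  is_derive (t, - t) (evec (~~ dir i j)) (fun q => u q i j) (ext_init dir F u0 t i j).
Proof.
move=> oO cF [cu du u0E] Ou cu0 tab; set d := dir i j; set c := (t, - t).
have cD : box a b c by apply/box_diag.
pose sg : R := if d then -1 else 1.
have sg1 : `|sg| = 1 by rewrite /sg; case: ifP; rewrite ?normrN1 ?normr1.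
(* A step [h] in the direction other than [evec d] is a step along the initial line followed by a
   step [h] along [evec d], where the system gives the derivative. *)
have sgE (h : R) : c + h *: evec (~~ d) = (t + sg * h, - (t + sg * h)) + h *: evec d.
  rewrite /c /sg /evec /d; case: (dir i j); congr pair; rewrite /= /GRing.scale/=; ring.
apply: is_derive_at => e e0; rewrite mxE.
have e20 : 0 < e / 2 by rewrite divr_gt0.
have D0 : is_derive t 1 (fun s => u0 s i j) ('D_1 u0 t i j).
  have du0 : derivable u0 t 1 by apply: diff_derivable; exact: Cn_differentiable cu0 _.
  by rewrite derive_mx// mxE; apply: derivable_is; move/derivable_mxP : du0.
have near1 : \forall h \near (0 : R), `|u0 (t +
  sg * h) i j - u0 t i j - sg * h * 'D_1 u0 t i j| <= e / 2 * `|h|.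
  have /nbhs_ballP[r /= r0 rP] := derivable_estimate D0 e20.
  apply/nbhs_ballP; exists r => //= h hr.
  have := rP (sg * h); rewrite normrM sg1 mul1r [_ *: 1]mulr1; apply.
  by move: hr; rewrite -!ball_normE /= !sub0r !normrN normrM sg1 mul1r.
have cFc : \forall x \near c, box a b x /\ `|F (u c) i j - F (u x) i j| < e / 2.
  have oc : \forall x \near c, box a b x by exact: (open_nbhs_nbhs (conj (@box_open _ a b) cD)).
  have cc : {for c, continuous (fun x => F (u x) i j)}.
    apply: mx_entry_continuous_at; apply: (@continuous_comp _ _ _ u F); first exact: cu.
    by apply: Cn_continuous cF _; exact: Ou.
  have /cvgrPdist_lt/(_ _ e20) cc' := cc.
  by apply: filterS2 oc cc'.
move: cFc => /nbhs_ballP[r /= r0 rP].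
have near2 : \forall h \near (0 : R), `|h| < r / 2.
  by apply/nbhs_ballP; exists (r / 2) => /=;
    [rewrite divr_gt0|move=> h; rewrite -ball_normE /= sub0r normrN].
apply: filterS2 near1 near2 => h n1 hr.
have inball (s : R) : `|s| <= `|h| -> ball c r ((t + sg * h, - (t + sg * h)) + s *: evec d).
  move=> sh; have shn : `|sg * h| = `|h| by rewrite normrM sg1 mul1r.
  move: (ler_norm (sg * h)) (ler_norm (- (sg * h))) (ler_norm s) (ler_norm (- s)).
  rewrite !normrN shn => n3 n4 n5 n6; rewrite -ball_normE /= prod_normE gt_max /c /evec.
  by case: (d); rewrite /= /GRing.scale /= ?mulr0 ?mulr1; apply/andP; split;
    rewrite ltr_norml; lra.
have [s sh sE] := @MVT_dir _ _ (fun q => u q i j) (t + sg * h, - (t + sg * h)) (evec d) h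
    (fun q => F (u q) i j) (fun s sh => du _ _ _ (rP _ (inball s sh)).1).
have [_ fs] := rP _ (inball s sh).
have ch : box a b (t + sg * h, - (t + sg * h)).
  by have := (rP _ (inball 0 _)).1; rewrite scale0r addr0; apply; rewrite normr0.
rewrite sgE -(subrK (u (t + sg * h, - (t + sg * h)) i j) (u (_ + _) i j)) sE.
rewrite (u0E _ ch) (u0E _ cD) -/sg in fs *.
have -> : h * F (u ((t + sg * h, - (t + sg * h)) + s *: evec d)) i j +
  u0 (t + sg * h) i j - u0 t i j
   - h * (F (u0 t) i j + sg * 'D_1 u0 t i j) =
   - (h * (F (u0 t) i j - F (u ((t + sg * h, - (t + sg * h)) + s *: evec d)) i j)) +
   (u0 (t + sg * h) i j - u0 t i j - sg * h * 'D_1 u0 t i j) by ring.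
rewrite (le_trans (ler_normD _ _))// normrN normrM.
have := ler_wpM2l (normr_ge0 h) (ltW fs).
move: n1; lra.
Qed.

(** The error [u (q + h *: e') - u q - h *: r q], in the entries of direction [d], satisfies a
    linear differential inequality along the segment from the initial line to [p], with an
    inhomogeneity small compared with [h]. By Gronwall's inequality the error at [p] is small
    compared with [h] too, so no second derivative of [u] has to exist beforehand. *)
Lemma other_derivative dir O F (a b : R) (u0 : R -> M) (u : R * R -> M) (a' b' : R)
    (r : R * R -> M) p i0 j0 :
  open O -> Cn 1 O F -> solves (box a b) dir F u0 u -> (forall p, box a b p -> O (u p)) ->
  Cn 1 [set t | a < t < b] u0 ->
  a < a' -> b' < b -> continuous r ->
  (forall p i j, cbox a' b' p ->
      is_derive p (evec (dir i j)) (fun q => r q i j) (ext_field dir F (u p) (r p) i j)) ->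
  (forall t, a' <= t <= b' -> r (t, - t) = ext_init dir F u0 t) ->
  box a' b' p ->
  is_derive p (evec (~~ dir i0 j0)) (fun q => u q i0 j0) (r p i0 j0).
Proof.
move=> oO cF su Ou cu0 aa bb cr dr r0E pb.
have [cu du u0E] := su.
set d := dir i0 j0; set e' := evec (~~ d).
pose K := seg d p; have Kb : K `<=` box a' b' := seg_box pb.
have bD : box a' b' `<=` box a b by move=> q /box_cbox/(cbox_box aa bb).
have KD q : K q -> box a b q by move=> /Kb/bD.
have cFO v : O v -> {for v, continuous F} by move=> Ov; exact: Cn_continuous cF Ov.
(* The candidate for the full derivative of [u] along [e']. *)
pose S q := mixed dir (~~ d) (F (u q)) (r q).
have [L L0 LP] : exists2 L : R, 0 < L & forall q, K q -> `|grad_size F (u q)| <= L.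
  apply: compact_bound; first exact: seg_compact.
  apply: within_continuous => q /KD qD.
  by apply: (grad_size_continuous oO cF); [exact: Ou|exact: cu].
have [Cs Cs0 CsP] : exists2 C : R, 0 < C & forall q, K q -> `|(`|S q| : R)| <= C.
  apply: compact_bound; first exact: seg_compact.
  apply: within_continuous => q /KD qD.
  apply: (@continuous_comp _ _ _ S (fun v => `|v|)); last exact: norm_continuous.
  apply: mixed_continuous; last exact: cr.
  by apply: (@continuous_comp _ _ _ u F); [exact: cu|exact/cFO/Ou].
(* The bound of [gronwall] for the initial error [eps |h|] and the inhomogeneity
   [eps |h| (1 + Cs + L)], divided by [eps |h|]. *)
pose Q := (2 + (1 + Cs + L) / (1 + L)) * expR (2 * (1 + L) * `|ell p|).
have L10 : 0 < 1 + L by rewrite addr_gt0.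
have Q0 : 0 < Q.
  by rewrite mulr_gt0 ?expR_gt0// addr_gt0// divr_gt0// !addr_gt0.
apply: is_derive_at => e e0.
pose eps := Num.min 1 (e / Q).
have eps0 : 0 < eps by rewrite lt_min ltr01 divr_gt0.
have eps1 : eps <= 1 by rewrite ge_min lexx.
have epsQ : eps * Q <= e by rewrite -ler_pdivlMr// ge_min lexx orbT.
have eps20 : 0 < eps / 2 by rewrite divr_gt0.
pose P (h : R) q := (forall s : R, `|s| <= `|h| -> box a' b' (q + s *: e') /\
    forall k l, `|F (u (q + s *: e')) k l - F (u q) k l| <= eps) /\
  (forall k l, `|F (u (q + h *: e')) k l - F (u q) k l -
     'D_(u (q + h *: e') - u q) (fun v => F v k l) (u q)| <=
       eps * `|u (q + h *: e') - u q|).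
(* The estimates hold near each point of the segment for small [h]; compactness makes the smallness
   uniform. *)
have tube : \forall h \near (0 : R), forall q, K q -> P h q.
  suff nearP (q0 : R * R) : K q0 -> \forall q \near q0 & h \near (0 : R), P h q.
    have /compact_near_coveringP := @seg_compact d p.
    by move=> /(_ R (nbhs 0) P _); apply.
  move=> Kq0.
  have sd k l : exists r : R, [/\ 0 < r, ball (u q0) r `<=` O &
      forall a b c, ball (u q0) r a -> ball (u q0) r b -> ball (u q0) r c ->
      `|F a k l - F b k l - 'D_(a - b) (fun v => F v k l) c| <= eps * `|a - b|].
    apply: (strict_diff (frame_mx R m n)) => //; first exact/Ou/KD.
    exact: Cn_entry.
  pose rr k l := sval (cid (sd k l)).
  have rrP k l := svalP (cid (sd k l)).
  have nearq : \forall x \near q0, [/\ box a' b' x,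
      forall k l, `|F (u q0) k l - F (u x) k l| < eps / 2 &
      forall k l, ball (u q0) (rr k l) (u x)].
    have n1 : \forall x \near q0, box a' b' x.
      exact: (open_nbhs_nbhs (conj (@box_open _ a' b') (Kb _ Kq0))).
    have cuq : {for q0, continuous u} by exact/cu/KD.
    have FF : Filter (nbhs q0) by exact: nbhs_filter.
    have n2 : \forall x \near q0, forall k l, `|F (u q0) k l - F (u x) k l| < eps / 2.
      apply: (@filter_forall _ _ _ (nbhs q0) FF) => k;
        apply: (@filter_forall _ _ _ (nbhs q0) FF) => l.
      have : {for q0, continuous (fun x => F (u x) k l)}.
        apply: mx_entry_continuous_at; apply: (@continuous_comp _ _ _ u F) => //.
        exact/cFO/Ou/KD.
      by move/cvgrPdist_lt; apply.
    have n3 : \forall x \near q0, forall k l, ball (u q0) (rr k l) (u x).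
      apply: (@filter_forall _ _ _ (nbhs q0) FF) => k;
        apply: (@filter_forall _ _ _ (nbhs q0) FF) => l.
      apply: cuq.
      by apply: nbhsx_ballx; have [] := rrP k l.
    by apply: filterS3 n1 n2 n3.
  have := shift_near e' nearq; apply: filterS => -[q h] /= qh.
  have [b0 F0 u0q] : [/\ box a' b' q, forall k l, `|F (u q0) k l - F (u q) k l| < eps / 2 &
      forall k l, ball (u q0) (rr k l) (u q)].
    by have := qh 0; rewrite normr0 scale0r addr0; apply.
  split=> [s sh|k l].
    have [bs Fs us] := qh s sh; split=> // k l.
    by apply: (ler_dist_half (z := F (u q0) k l)); rewrite distrC.
  have [bs Fs us] := qh h (lexx _).
  have [_ _ st] := rrP k l; exact: st (us k l) (u0q k l) (u0q k l).
have nearC : \forall h \near (0 : R), forall k l, dir k l = d ->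
    `|u (bpt d p + h *: e') k l - u (bpt d p) k l - h * r (bpt d p) k l| <= eps * `|h|.
  have FF : Filter (nbhs (0 : R)) by exact: nbhs_filter.
  apply: (@filter_forall _ _ _ (nbhs (0 : R)) FF) => k;
    apply: (@filter_forall _ _ _ (nbhs (0 : R)) FF) => l.
  have [dkl|/eqP dkl] := eqVneq (dir k l) d; last by apply: nearW => h /dkl.
  have Kc := Kb _ (seg_bpt d p).
  have cE : bpt d p = ((bpt d p).1, - (bpt d p).1) by apply: ell0_diag; exact: ell_bpt.
  have tin : a' <= (bpt d p).1 <= b' by have [/andP[/ltW -> /ltW ->]] := Kc.
  have tab : a < (bpt d p).1 < b by have [] := bD _ Kc.
  have := diag_derivative k l oO cF su Ou cu0 tab.
  rewrite -cE -(r0E _ tin) -cE dkl -/e' => /derivable_estimate/(_ _ eps0).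
  by apply: filterS => h hP _.
apply: filterS2 tube nearC => h hP hC.
(* Entries of the other direction are set to 0: [F] gives their derivative along [e'], so they
   contribute to the inhomogeneity only. *)
pose w q : M := \matrix_(k, l) if dir k l ==
  d then u (q + h *: e') k l - u q k l - h * r q k l else 0.
pose dw q : M := \matrix_(k, l) if dir k l == d then
   F (u (q + h *: e')) k l - F (u q) k l - h * ext_field dir F (u q) (r q) k l else 0.
have eh0 : 0 <= eps * `|h| by rewrite mulr_ge0// ltW.
have eh1 : 0 <= eps * `|h| * (1 + Cs + L).
  apply: mulr_ge0 => //; apply: addr_ge0; last exact: ltW.
  by apply: addr_ge0 => //; exact: ltW.
have wp : `|w p| <= (2 * (eps * `|h|) + eps * `|h| * (1 + Cs + L) / (1 + L)) *
    expR (2 * (1 + L) * `|ell p|).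
  apply: (@gronwall R m n (fun _ _ => d) K w dw (1 + L)).
  - exact: seg_compact.
  - by move=> _ _; exact: seg_seg.
  - exact: L10.
  - exact: eh0.
  - exact: eh1.
  - apply: within_continuous => q Kq; apply: mx_continuous_at => k l.
    rewrite (_ : (fun s => w s k l) = (fun q => if dir k l ==
      d then u (q + h *: e') k l - u q k l - h * r q k l else 0)); last first.
      by apply/funext => s; rewrite mxE.
    case: (dir k l == d); last exact: cvg_cst.
    have [bq _] := (hP q Kq).1 h (lexx _).
    have cuh : {for q, continuous (fun x : R * R => u (x + h *: e'))}.
      apply: (@continuous_comp _ _ _ (fun x : R * R => x + h *: e') u).
        by apply: cvgD; [exact: cvg_id|exact: cvg_cst].
      by apply: cu; exact: bD.
    have cuq := cu _ (KD _ Kq).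
    apply: cvgB; first apply: cvgB.
    + by apply: mx_entry_continuous_at; exact: cuh.
    + by apply: mx_entry_continuous_at; exact: cuq.
    + apply: cvgM; first exact: cvg_cst.
      by apply: mx_entry_continuous_at; exact: cr.
  - move=> q k l Kq.
    have [bq _] := (hP q Kq).1 h (lexx _).
    rewrite (_ : (fun s => w s k l) = (fun q => if dir k l ==
      d then u (q + h *: e') k l - u q k l - h * r q k l else 0)); last first.
      by apply/funext => s; rewrite mxE.
    rewrite mxE; case: eqVneq => [dkl|_]; last exact: is_derive_cst.
    rewrite -dkl; apply: is_deriveB; first apply: is_deriveB.
    + by apply: (@is_derive_translate _ _ _ (fun q => u q k l)); apply: du; exact: bD.
    + by apply: du; exact: KD.
    + by apply: (@is_deriveZ _ _ _ (fun q => r q k l) h); apply: dr; exact/box_cbox/Kb.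
  - move=> q k l Kq; rewrite mxE; case: eqVneq => [dkl|_]; last first.
      by rewrite normr0; apply: addr_ge0 eh1; apply: mulr_ge0 => //; exact: ltW.
    have [hA hB] := hP q Kq.
    set D := u (q + h *: e') - u q.
    have Ouq : O (u q) by exact/Ou/KD.
    pose W := D - h *: S q.
    (* [W] is the error in all entries: that of [w] in those of direction [d], and in the others, by
       the mean value theorem, [h] times an oscillation of [F (u _)]. *)
    have Wle : `|W| <= `|w q| + eps * `|h|.
      apply: mx_norm_le => [|k' l']; first by rewrite addr_ge0.
      have [dkl'|dkl'] := eqVneq (dir k' l') d.
        have -> : W k' l' = w q k' l'.
          rewrite /W /D /S !mxE dkl' eqxx.
          by have -> : (d == ~~ d) = false by case: (d).
        by rewrite (le_trans (mx_entry_le _ _ _))// lerDl.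
      have -> : W k' l' = u (q + h *: e') k' l' - u q k' l' - h * F (u q) k' l'.
        rewrite /W /D /S !mxE.
        by have -> : dir k' l' == ~~ d by move: dkl'; case: (dir k' l'); case: (d).
      have dF (s : R) : `|s| <= `|h| -> is_derive (q + s *: e') e' (fun x =>
        u x k' l') (F (u (q + s *: e')) k' l').
        move=> sh; have [bs _] := hA s sh; have := du _ k' l' (bD _ bs).
        by have -> : evec (dir k' l') = e' by congr evec; move: dkl'; case: (dir k' l');
          case: (d).
      have [s sh ->] := @MVT_dir _ _ (fun x => u x k' l') q e' h (fun x =>
        F (u x) k' l') dF.
      have [_ /(_ k' l') Fs] := hA s sh.
      by rewrite -mulrBr normrM mulrC (le_trans (ler_wpM2r (normr_ge0 _) Fs))// lerDr.
    have Dle : `|D| <= `|W| + `|h| * Cs.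
      have -> : D = W + h *: S q by rewrite subrK.
      rewrite (le_trans (ler_normD _ _))// lerD// normrZ ler_wpM2l//.
      by have := CsP q Kq; rewrite normr_id.
    (* The linearisation error of [F] over the true increment [D], plus the differential applied to
       [W]; [ext_field] is the differential applied to [S q]. *)
    have -> : F (u (q + h *: e')) k l - F (u q) k l - h * ext_field dir F (u q) (r q) k l =
      (F (u (q + h *: e')) k l - F (u q) k l - 'D_D (fun v => F v k l) (u q)) +
      'D_W (fun v => F v k l) (u q).
      have -> : W = D + (- h) *: S q by rewrite scaleNr.
      rewrite (derive_linear k l D (S q) (- h) oO cF Ouq) mxE dkl -/(S q); ring.
    rewrite (le_trans (ler_normD _ _))//.
    have b1 := hB k l.
    have b2 : `|'D_W (fun v => F v k l) (u q)| <= L * `|W|.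
      rewrite (le_trans (grad_sizeP _ _ _ oO cF Ouq))// ler_wpM2r//.
      exact: le_trans (ler_norm _) (LP q Kq).
    have b3 : eps * `|D| <= `|w q| + eps * `|h| + eps * (`|h| * Cs).
      rewrite (le_trans (ler_wpM2l (ltW eps0) Dle))// mulrDr lerD2r.
      rewrite (le_trans _ Wle)// ler_piMl//.
    have b4 := ler_wpM2l (ltW L0) Wle.
    have := le_trans (lerD (le_trans b1 b3) (le_trans b2 b4)) (lexx _).
    by move/le_trans; apply; rewrite le_eqVlt; apply/orP; left; apply/eqP; ring.
  - move=> q Kq q0; rewrite (seg_ell0 Kq q0); apply: mx_norm_le => // k l.
    rewrite mxE; case: eqVneq => [dkl|_]; last by rewrite normr0.
    exact: hC.
  - exact: seg_end.
have -> : u (p + h *: e') i0 j0 - u p i0 j0 - h * r p i0 j0 = w p i0 j0 by rewrite mxE eqxx.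
rewrite (le_trans (mx_entry_le _ _ _))// (le_trans wp)//.
have -> : (2 * (eps * `|h|) + eps * `|h| * (1 + Cs + L) / (1 + L)) * expR (2 * (1 +
  L) * `|ell p|) =
  eps * Q * `|h| by rewrite /Q; ring.
by rewrite ler_wpM2r.
Qed.

End first_order.

(** * Smoothness of solutions *)

Section regularity.
Variable R : realType.

Lemma oo_interval_open (a b : R) : open [set t : R | a < t < b].
Proof.
have -> : [set t | a < t < b] = `]a, b[%classic by apply/seteqP; split=> s;
  rewrite /= in_itv.
exact: itv_open.
Qed.

Lemma near_box (a b : R) p (P : set (R * R)) : box a b p ->
  (forall q, box a b q -> P q) -> \forall q \near p, P q.
Proof.
by move=> pb bP; apply: filterS bP _; exact: (open_nbhs_nbhs (conj (@box_open _ a b) pb)).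
Qed.

(** The linearised system is solved over closed boxes inside the given one. As [r] is defined as the
    actual derivative, all these solutions coincide with it, and it inherits their properties
    locally. *)
Lemma solution_derivative m n (dir : 'I_m -> 'I_n -> bool) (O : set 'M[R]_(m, n))
    (F : 'M[R]_(m, n) -> 'M[R]_(m, n)) (a b : R) (u0 : R -> 'M[R]_(m, n))
    (u : R * R -> 'M[R]_(m, n)) :
  open O -> Cn 1 O F -> solves (box a b) dir F u0 u -> (forall p, box a b p -> O (u p)) ->
  Cn 1 [set t | a < t < b] u0 ->
  exists r : R * R -> 'M[R]_(m, n), [/\ forall p, box a b p -> {for p, continuous r},
    forall p i j, box a b p ->
      is_derive p (evec (~~ dir i j)) (fun q => u q i j) (r p i j),
    forall p i j, box a b p ->
      is_derive p (evec (dir i j)) (fun q => r q i j) (ext_field dir F (u p) (r p) i j) &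
    forall t, a < t < b -> r (t, - t) = ext_init dir F u0 t].
Proof.
move=> oO cF su Ou cu0.
pose r p : 'M[R]_(m, n) := \matrix_(i, j) 'D_(evec (~~ dir i j)) (fun q => u q i j) p.
have loc p : box a b p -> exists a' b' (s : R * R -> 'M[R]_(m, n)), [/\ box a' b' p,
    forall q i j, box a' b' q -> is_derive q (evec (~~ dir i j)) (fun q =>
      u q i j) (s q i j),
    continuous s,
    forall q i j, box a' b' q ->
      is_derive q (evec (dir i j)) (fun q => s q i j) (ext_field dir F (u q) (s q) i j) &
    forall t, a' <= t <= b' -> s (t, - t) = ext_init dir F u0 t].
  move=> /box_inside[a' [b' [aa bb ab' pb]]].
  have [s [cs ds s0]] := linearized_solution oO cF su Ou cu0 aa bb ab'.
  exists a', b', s; split=> // q i j qb; last by apply: ds; exact: box_cbox.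
  exact: (other_derivative i j oO cF su Ou cu0 aa bb cs ds s0 qb).
have rE p : box a b p -> exists a' b' (s : R * R -> 'M[R]_(m, n)), [/\ box a' b' p,
    forall q, box a' b' q -> s q = r q, continuous s,
    (forall q i j, box a' b' q ->
      is_derive q (evec (~~ dir i j)) (fun q => u q i j) (s q i j)) /\
    (forall q i j, box a' b' q ->
      is_derive q (evec (dir i j)) (fun q => s q i j) (ext_field dir F (u q) (s q) i j)) &
    forall t, a' <= t <= b' -> s (t, - t) = ext_init dir F u0 t].
  move=> /loc[a' [b' [s [pb us cs ds s0]]]]; exists a', b', s; split=> // q qb.
  by apply/matrixP => i j; rewrite mxE; have [_ ->] := us q i j qb.
exists r; split=> [p|p i j|p i j|t tab].
- move=> /rE[a' [b' [s [pb sr cs _ _]]]].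
  have near_sr : \forall q \near p, s q = r q by exact: near_box pb sr.
  rewrite /prop_for /continuous_at -(sr p pb).
  by apply: cvg_trans (cs p); exact: near_eq_cvg.
- by move=> /rE[a' [b' [s [pb <-// _ [us _] _]]]]; exact: us.
- move=> /rE[a' [b' [s [pb sr _ [_ ds] _]]]]; rewrite -(sr p pb).
  apply: near_eq_is_derive (ds p i j pb).
  by apply: near_box pb _ => q /sr ->.
- have /rE[a' [b' [s [pb sr _ _ s0]]]] : box a b (t, - t) by apply/box_diag.
  rewrite -(sr _ pb) s0//; have [/= /andP[t1 t2] _] := pb.
  by rewrite !ltW.
Qed.

Section prolongation.
Variables (m n : nat) (dir : 'I_m -> 'I_n -> bool) (F : 'M[R]_(m, n) -> 'M[R]_(m, n)).

Definition prol_dir (i : 'I_(m + m)) (j : 'I_n) : bool :=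
  match fintype.split i with inl k => dir k j | inr k => dir k j end.

Lemma prol_dirl i j : prol_dir (lshift m i) j = dir i j.
Proof. by rewrite /prol_dir (unsplitK (inl _ i)). Qed.

Lemma prol_dirr i j : prol_dir (rshift m i) j = dir i j.
Proof. by rewrite /prol_dir (unsplitK (inr _ i)). Qed.

Definition prol_field (v : 'M[R]_(m + m, n)) : 'M[R]_(m + m, n) :=
  col_mx (F (usubmx v)) (ext_field dir F (usubmx v) (dsubmx v)).

Lemma usubmx_continuous : continuous (@usubmx R m m n).
Proof.
apply: mx_continuous => i j.
rewrite (_ : (fun t => _) = (fun v : 'M[R]_(m + m, n) => v (lshift m i) j)).
  exact: coord_continuous.
by apply/funext => v; rewrite mxE.
Qed.

Lemma Cn_entries k (O : set 'M[R]_(m + m, n)) i j : open O -> Cn k O (fun v => v i j).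
Proof.
move=> oO; apply: (@Cn_linear _ _ _ _ _ _ (fun A : 'M[R]_(m + m, n) => A i j) id) => //.
- by move=> x y z; rewrite !mxE.
- exact: coord_continuous.
exact: smooth_id.
Qed.

(** One order is lost because [ext_field] contains the first derivatives of [F]. *)
Lemma prol_field_Cn (O : set 'M[R]_(m, n)) k : open O -> Cn k.+1 O F ->
  Cn k [set v | O (usubmx v)] prol_field.
Proof.
move=> oO cF; set O' := [set v | O (usubmx v)].
have oO' : open O' by apply: open_comp oO => v _; exact: usubmx_continuous.
have cu : Cn k O' (@usubmx R m m n).
  apply/Cn_mxP => // i j; apply: eq_Cn oO' _ (Cn_entries k (lshift m i) j oO') => v _.
  by rewrite mxE.
have cFu : Cn k O' (fun v => F (usubmx v)).
  by apply: (Cn_comp_mx (frame_mx R m n) oO' oO _ cu (CnW cF)).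
have cd i j : Cn k O' (fun v => dsubmx v i j).
  by apply: eq_Cn oO' _ (Cn_entries k (rshift m i) j oO') => v _; rewrite mxE.
apply/Cn_mxP => // i j.
case: (split_ordP i) => i' ->{i}.
  have cFi := Cn_entry i' j oO' cFu.
  by apply: eq_Cn oO' _ cFi => v _; rewrite col_mxEu.
have : Cn k O' (fun v => \sum_l (if dir l.1 l.2 ==
  ~~ dir i' j then F (usubmx v) l.1 l.2 else dsubmx v l.1 l.2) *
   'D_(frame_vec (frame_mx R m n) l) (fun w => F w i' j) (usubmx v)).
  apply: Cn_sum => // l; apply: CnM => //.
    case: (_ == _); [exact: Cn_entry cFu|exact: cd].
  apply: (Cn_comp_scalar (frame_mx R m n) (E := O) (g :=
    'D_(frame_vec (frame_mx R m n) l) (fun w => F w i' j))) => //.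
  exact: Cn_derive (Cn_entry i' j oO cF).
apply: eq_Cn => // v Ov; rewrite col_mxEd mxE (derive_frame (frame_mx R m n)); last first.
  exact: Cn_differentiable (Cn_entry i' j oO cF) Ov.
by apply: eq_bigr => l _; rewrite -[RHS]/(mixed _ _ _ _ _ _ * _) [mixed _ _ _ _ _ _]mxE.
Qed.

End prolongation.

Lemma ext_init_Cn m n (dir : 'I_m -> 'I_n -> bool) (O : set 'M[R]_(m, n))
    (F : 'M[R]_(m, n) -> 'M[R]_(m, n)) k (A : set R) (u0 : R -> 'M[R]_(m, n)) :
  open O -> open A -> Cn k O F -> Cn k.+1 A u0 -> (forall t, A t -> O (u0 t)) ->
  Cn k A (ext_init dir F u0).
Proof.
move=> oO oA cF cu0 Ou0; apply/Cn_mxP => // i j.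
have cFu : Cn k A (fun t => F (u0 t)).
  by apply: (Cn_comp_mx (frame_mx R m n) oA oO _ (CnW cu0) cF).
have cD := Cn_derive (1 : R) cu0.
have := CnD oA (Cn_entry i j oA cFu) (CnZl (if dir i j then -1 else 1) oA (Cn_entry i j oA cD)).
by apply: eq_Cn => // t _; rewrite mxE.
Qed.

(* By induction on the order: [u] together with its remaining first derivatives
   solves the system of [prol_field], to which the induction hypothesis applies. *)
Theorem solution_smooth m n (dir : 'I_m -> 'I_n -> bool) (O : set 'M[R]_(m, n))
    (F : 'M[R]_(m, n) -> 'M[R]_(m, n)) (a b : R) (u0 : R -> 'M[R]_(m, n))
    (u : R * R -> 'M[R]_(m, n)) :
  open O -> smooth O F -> smooth [set t | a < t < b] u0 ->
  solves (box a b) dir F u0 u -> (forall p, box a b p -> O (u p)) ->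
  smooth (box a b) u.
Proof.
move=> oO sF su0 sol Ou k.
elim: k m n dir O F u0 u oO sF su0 sol Ou => [|k IHk] m n dir O F u0 u oO sF su0 sol Ou.
  by case: sol.
have [r [cr ur dr r0]] := solution_derivative oO (sF 1%N) sol Ou (su0 1%N).
have [cu du u0E] := sol.
have oI := @oo_interval_open a b.
have oB := @box_open R a b.
pose w p := col_mx (u p) (r p).
have Cw : Cn k (box a b) w.
  apply: (IHk _ _ (prol_dir dir) [set v | O (usubmx v)] (prol_field dir F)
     (fun t => col_mx (u0 t) (ext_init dir F u0 t))).
  - by apply: open_comp oO => v _; exact: usubmx_continuous.
  - by move=> l; exact: prol_field_Cn.
  - move=> l; apply/Cn_mxP => // i j; case: (split_ordP i) => i' ->{i}.
      by apply: eq_Cn oI _ (Cn_entry i' j oI (su0 l)) => v _; rewrite col_mxEu.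
    have Ou0 t : a < t < b -> O (u0 t).
      by move=> tab; rewrite -u0E; [exact/Ou/box_diag|exact/box_diag].
    have := ext_init_Cn dir oO oI (sF l) (su0 l.+1) Ou0.
    by move=> /(Cn_entry i' j oI); apply: eq_Cn => // t _; rewrite col_mxEd.
  - split=> [p pb|p i j pb|t tb].
    + apply: mx_continuous_at => i j; case: (split_ordP i) => i' ->{i}.
        rewrite (_ : (fun s => _) = (fun s => u s i' j)).
          by apply: mx_entry_continuous_at; exact: cu.
        by apply/funext => s; rewrite col_mxEu.
      rewrite (_ : (fun s => _) = (fun s => r s i' j)).
        by apply: mx_entry_continuous_at; exact: cr.
      by apply/funext => s; rewrite col_mxEd.
    + rewrite /prol_field /w col_mxKu col_mxKd; case: (split_ordP i) => i' ->{i}.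
        rewrite (_ : (fun s => _) = (fun s => u s i' j)); last first.
          by apply/funext => s; rewrite col_mxEu.
        by rewrite col_mxEu prol_dirl; exact: du.
      rewrite (_ : (fun s => _) = (fun s => r s i' j)); last first.
        by apply/funext => s; rewrite col_mxEd.
      by rewrite col_mxEd prol_dirr; exact: dr.
    + by rewrite /w u0E// r0//; apply/box_diag.
  - by move=> p pb; rewrite /w /= col_mxKu; exact: Ou.
have Cu : Cn k (box a b) u.
  apply/Cn_mxP => // i j; apply: eq_Cn oB _ (Cn_entry (lshift m i) j oB Cw) => p _.
  by rewrite /w col_mxEu.
have Cr i j : Cn k (box a b) (fun p => r p i j).
  apply: eq_Cn oB _ (Cn_entry (rshift m i) j oB Cw) => p _.
  by rewrite /w col_mxEd.
have CFu : Cn k (box a b) (fun p => F (u p)).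
  by apply: (Cn_comp_mx (frame_mx R m n) oB oO Ou Cu (sF k)).
apply/Cn_mxP => // i j.
(* Of the two partial derivatives of an entry of [u], one is an entry of [F (u _)] and the other one
   of [r]. *)
apply: (@Cn_partials _ _ _ _ (fun p => if dir i j then F (u p) i j else r p i j)
  (fun p => if dir i j then r p i j else F (u p) i j)) => //.
- by move=> p pb; have := du p i j pb; have := ur p i j pb; case: (dir i j).
- by move=> p pb; have := du p i j pb; have := ur p i j pb; case: (dir i j).
- by case: (dir i j); [exact: Cn_entry CFu|exact: Cr].
- by case: (dir i j); [exact: Cr|exact: Cn_entry CFu].
Qed.

End regularity.

(** * Inverse function theorem in the plane *)

Section real_estimates.
Variable R : realType.

Lemma sqr_lt (x c : R) : `|x| < c -> x ^+ 2 < c ^+ 2.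
Proof. by move=> xc; rewrite -[ltLHS]real_normK ?num_real//; have := normr_ge0 x; nra. Qed.

Lemma sqr_le (x c : R) : 0 <= c -> c <= `|x| -> c ^+ 2 <= x ^+ 2.
Proof. by move=> c0 cx; rewrite -[leRHS]real_normK ?num_real//; nra. Qed.

Lemma norm_lin_bound (a b x y k e : R) : `|a| <= e -> `|b| <= e -> 0 <= k ->
  `|a * x - b * y| <= (`|x| + `|y| + k) * e.
Proof.
move=> ae be k0; have e0 : 0 <= e := le_trans (normr_ge0 _) ae.
rewrite (le_trans (ler_normB _ _))// !normrM !mulrDl -[leLHS]addr0.
apply: lerD; last exact: mulr_ge0.
by apply: lerD; rewrite mulrC; exact: ler_wpM2l.
Qed.

End real_estimates.

Lemma line_near (R : realType) (V : normedModType R) (p v : V) (P : set V) :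
  (\forall x \near p, P x) -> \forall h \near (0 : R), P (p + h *: v).
Proof.
move=> /(shift_near v)[[A B] /= [Ap B0] AB]; apply: filterS B0 => h Bh.
exact: AB (p, h) (conj (nbhs_singleton Ap) Bh) h (lexx _).
Qed.

Section inverse_function.
Variable R : realType.
Variables (Z1 Z2 : R * R -> R) (D : set (R * R)).
Hypothesis oD : open D.
Hypotheses (sZ1 : smooth D Z1) (sZ2 : smooth D Z2).

Let Z z := (Z1 z, Z2 z).
Let X1 := 'D_(1, 0) Z1.
Let X2 := 'D_(1, 0) Z2.
Let Y1 := 'D_(0, 1) Z1.
Let Y2 := 'D_(0, 1) Z2.

Definition jac z := X1 z * Y2 z - X2 z * Y1 z.

Lemma derive_RR (g : R * R -> R) z v : differentiable g z ->
  'D_v g z = v.1 * 'D_(1, 0) g z + v.2 * 'D_(0, 1) g z.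
Proof. by move=> dg; exact: deriveRR. Qed.

Lemma cramer z (v : R * R) : D z -> jac z != 0 ->
  v.1 = ('D_v Z1 z * Y2 z - 'D_v Z2 z * Y1 z) / jac z /\
  v.2 = (X1 z * 'D_v Z2 z - X2 z * 'D_v Z1 z) / jac z.
Proof.
move=> Dz J0.
have e1 := derive_RR v (Cn_differentiable (sZ1 1%N) Dz).
have e2 := derive_RR v (Cn_differentiable (sZ2 1%N) Dz).
rewrite e1 e2 -/(X1 z) -/(X2 z) -/(Y1 z) -/(Y2 z); move: J0; rewrite /jac.
move: (X1 z) (X2 z) (Y1 z) (Y2 z) => x1 x2 y1 y2 J0.
by split; field.
Qed.

Lemma cramer_le (x1 x2 y1 y2 J d1 d2 c1 c2 e : R) : `|d1 - c1| <= e -> `|d2 - c2| <= e ->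
  `|(d1 * y2 - d2 * y1) / J - (c1 * y2 - c2 * y1) / J| <=
     (`|x1| + `|x2| + `|y1| + `|y2| + 1) / `|J| * e /\
  `|(x1 * d2 - x2 * d1) / J - (x1 * c2 - x2 * c1) / J| <=
     (`|x1| + `|x2| + `|y1| + `|y2| + 1) / `|J| * e.
Proof.
move=> h1 h2; have e0 : 0 <= e := le_trans (normr_ge0 _) h1.
split; rewrite -mulrBl normrM normfV mulrAC ler_wpM2r ?invr_ge0//.
- have -> : d1 * y2 - d2 * y1 - (c1 * y2 - c2 * y1) =
  (d1 - c1) * y2 - (d2 - c2) * y1 by ring.
  have -> : `|x1| + `|x2| + `|y1| + `|y2| + 1 = `|y2| + `|y1| + (`|x1| + `|x2| + 1) by ring.
  by apply: norm_lin_bound => //; rewrite !addr_ge0.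
- have -> : x1 * d2 - x2 * d1 - (x1 * c2 - x2 * c1) =
  (d2 - c2) * x1 - (d1 - c1) * x2 by ring.
  have -> : `|x1| + `|x2| + `|y1| + `|y2| + 1 = `|x1| + `|x2| + (`|y1| + `|y2| + 1) by ring.
  by apply: norm_lin_bound => //; rewrite !addr_ge0.
Qed.

(** Cramer's rule when the image of [v] under the differential is known only up to [e]. With [c = 0]
    it gives the injectivity of [Z], with [c] a multiple of a direction the derivative of the
    inverse. *)
Lemma cramer_bound z : D z -> jac z != 0 ->
  exists2 C : R, 0 < C & forall v c : R * R,
    (forall e : R, `|'D_v Z1 z - c.1| <= e -> `|'D_v Z2 z - c.2| <= e ->
     `|v.1 - (c.1 * Y2 z - c.2 * Y1 z) / jac z| <= C * e /\
     `|v.2 - (X1 z * c.2 - X2 z * c.1) / jac z| <= C * e).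
Proof.
move=> Dz J0; pose S := `|X1 z| + `|X2 z| + `|Y1 z| + `|Y2 z| + 1.
have J1 : 0 < `|jac z| by rewrite normr_gt0.
have S0 : 0 < S by rewrite ltr_wpDl// !addr_ge0.
exists (S / `|jac z|); first by rewrite divr_gt0.
move=> v c e h1 h2; have [e1 e2] := cramer v Dz J0.
rewrite {1}e1 {1}e2; exact: cramer_le.
Qed.

Lemma pair_norm_le (v : R * R) (e : R) : `|v.1| <= e -> `|v.2| <= e -> `|v| <= e.
Proof. by move=> h1 h2; rewrite prod_normE ge_max h1. Qed.

Lemma inverse_estimate z0 : D z0 -> jac z0 != 0 ->
  exists r C : R, [/\ 0 < r, 0 < C, forall z, ball z0 r z -> D z /\ jac z != 0 &
    forall a b, ball z0 r a -> ball z0 r b -> `|a - b| <= C * `|Z a - Z b|].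
Proof.
move=> Dz J0; have [C C0 CP] := cramer_bound Dz J0.
(* This makes [C * e] equal to one half, so that the linearisation error is absorbed and the
   constant [2 * C] remains. *)
pose e := (2 * C)^-1; have e0 : 0 < e by rewrite invr_gt0 mulr_gt0.
have [r1 [r10 _ s1]] := strict_diff (frame_RR R) oD Dz (sZ1 1%N) e0.
have [r2 [r20 _ s2]] := strict_diff (frame_RR R) oD Dz (sZ2 1%N) e0.
have cJ : {for z0, continuous jac}.
  by apply: cvgB; apply: cvgM;
    [exact: (sZ1 1%N).2|exact: (sZ2 1%N).2|exact: (sZ2 1%N).2|exact: (sZ1 1%N).2].
have n1 : \forall z \near z0, jac z != 0.
  have J00 : 0 < `|jac z0| by rewrite normr_gt0.
  have /cvgrPdist_lt/(_ _ J00) := cJ; apply: filterS => z.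
  by apply: contraTneq => ->; rewrite subr0 ltxx.
have n2 : \forall z \near z0, D z by exact: (open_nbhs_nbhs (conj oD Dz)).
have /nbhs_ballP[r3 /= r30 r3P] : \forall z \near z0,
  D z /\ jac z != 0 by exact: filterS2 n2 n1.
pose r := Num.min r1 (Num.min r2 r3).
have rr1 : r <= r1 by rewrite ge_min lexx.
have rr2 : r <= r2 by rewrite !ge_min lexx orbT.
have rr3 : r <= r3 by rewrite !ge_min lexx !orbT.
exists r, (2 * C); split.
- by rewrite !lt_min r10 r20.
- by rewrite mulr_gt0.
- by move=> z /(le_ball rr3)/r3P.
move=> a b ar br.
have h1 := s1 a b z0 (le_ball rr1 ar) (le_ball rr1 br) (ballxx _ r10).
have h2 := s2 a b z0 (le_ball rr2 ar) (le_ball rr2 br) (ballxx _ r20).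
have m1 : `|Z1 a - Z1 b| <= `|Z a - Z b| by rewrite [leRHS]prod_normE le_max lexx.
have m2 : `|Z2 a - Z2 b| <= `|Z a - Z b| by rewrite [leRHS]prod_normE le_max lexx orbT.
set N := `|Z a - Z b| in m1 m2 *.
have k1 : `|'D_(a - b) Z1 z0 - 0| <= e * `|a - b| + N.
  rewrite subr0 -(subrK (Z1 a - Z1 b) ('D_(a - b) Z1 z0)) (le_trans (ler_normD _ _))// lerD//.
  by rewrite distrC.
have k2 : `|'D_(a - b) Z2 z0 - 0| <= e * `|a - b| + N.
  rewrite subr0 -(subrK (Z2 a - Z2 b) ('D_(a - b) Z2 z0)) (le_trans (ler_normD _ _))// lerD//.
  by rewrite distrC.
have [g1 g2] := CP (a - b) (0, 0) _ k1 k2.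
move: g1 g2; rewrite /= !mul0r !mulr0 !subr0 !mul0r !subr0 => g1 g2.
have := @pair_norm_le (a - b) _ g1 g2; rewrite mulrDr mulrA.
have -> : C * e = 2^-1 by rewrite /e; field; rewrite gt_eqF.
lra.
Qed.

Lemma open_image r C z0 : 0 < r -> 0 < C -> (forall z, ball z0 r z -> D z /\ jac z != 0) ->
  (forall a b, ball z0 r a -> ball z0 r b -> `|a - b| <= C * `|Z a - Z b|) ->
  open (Z @` ball z0 r).
Proof.
move=> r0 C0 DJ est; rewrite openE => _ [z1 z1r <-].
have /nbhs_ballP[rho' /= rho'0 rhoP] : nbhs z1 (ball z0 r).
  by apply: open_nbhs_nbhs; split => //; exact: ball_open.
pose rho := rho' / 2; have rho0 : 0 < rho by rewrite divr_gt0.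
pose K : set (R * R) := `[z1.1 - rho, z1.1 + rho] `*` `[z1.2 - rho, z1.2 + rho].
have cK : compact K by apply: compact_setX; exact: segment_compact.
have KE z : K z <-> `|z - z1| <= rho.
  rewrite /K /= !in_itv /= prod_normE ge_max /= !ler_distl.
  by split=> [[-> ->]|/andP[-> ->]].
have KB z : K z -> ball z0 r z.
  move=> /KE zK; apply: rhoP; rewrite -ball_normE /= distrC (le_lt_trans zK)// /rho; lra.
pose m := rho / C; have m0 : 0 < m by rewrite divr_gt0.
(* On the boundary of [K], [Z] is at distance at least [m] from [Z z1]. With a quarter of it, [phi]
   below is less than [m ^+ 2 / 8] at [z1] and at least [9 / 16 * m ^+ 2] on the boundary, which
   puts its minimum in the interior. *)
apply/nbhs_ballP; exists (m / 4) => /=; first by rewrite divr_gt0.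
move=> w; rewrite -ball_normE /= => wm.
have w1 : `|Z1 z1 - w.1| < m / 4 by apply: le_lt_trans wm;
  rewrite [leRHS]prod_normE le_max lexx.
have w2 : `|Z2 z1 - w.2| < m / 4 by apply: le_lt_trans wm;
  rewrite [leRHS]prod_normE le_max lexx orbT.
(* [phi] has an interior minimum on [K], where [Z z = w] since [jac z != 0]. *)
pose phi z := (Z1 z - w.1) ^+ 2 + (Z2 z - w.2) ^+ 2.
have dZ1 z : K z -> differentiable Z1 z by move=> /KB/DJ[Dz _];
  exact: Cn_differentiable (sZ1 1%N) Dz.
have dZ2 z : K z -> differentiable Z2 z by move=> /KB/DJ[Dz _];
  exact: Cn_differentiable (sZ2 1%N) Dz.
have cphi : {within K, continuous phi}.
  apply: within_continuous => z Kz; apply: cvgD.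
    apply: cvgM; (apply: cvgB; last exact: cvg_cst);
      exact: differentiable_continuous (dZ1 z Kz).
  apply: cvgM; (apply: cvgB; last exact: cvg_cst);
    exact: differentiable_continuous (dZ2 z Kz).
have K1 : K z1 by apply/KE; rewrite subrr normr0 ltW.
have [|z /[!inE] Kz zmin] := compact_EVT_min _ cK cphi; first by exists z1.
have phi1 : phi z1 < m ^+ 2 / 8.
  have := sqr_lt w1; have := sqr_lt w2; rewrite /phi (_ : (m / 4) ^+ 2 = m ^+ 2 / 16);
    last by field.
  lra.
have zin : `|z - z1| < rho.
  rewrite lt_neqAle; apply/andP; split; last exact/KE.
  apply/eqP => zrho.
  have := est z z1 (KB _ Kz) z1r; rewrite zrho mulrC -ler_pdivrMr// -/m => mle.
  have phile := zmin z1 (mem_set K1).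
  have h (x y : R) : m <= `|x - y| -> forall c : R, `|y - c| < m / 4 ->
    m ^+ 2 * 9 / 16 <= (x - c) ^+ 2.
    move=> mx c cm; have : 3 / 4 * m <= `|x - c|.
      have := ler_normD (x - c) (c - y); rewrite subrKA [`|c - y|]distrC; lra.
    have p34 : 0 <= 3 / 4 * m by rewrite mulr_ge0// ltW.
    by move=> /(sqr_le p34); rewrite (_ : (3 / 4 * m) ^+ 2 = m ^+ 2 * 9 / 16)//; field.
  have sq (x : R) : 0 <= x ^+ 2 by exact: sqr_ge0.
  have m20 : 0 < m ^+ 2 by rewrite exprn_gt0.
  move: mle; rewrite [leRHS]prod_normE le_max => /orP[] mle.
    have := h (Z1 z) (Z1 z1) mle _ w1; have := sq (Z2 z - w.2); move: phile phi1;
      rewrite /phi; lra.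
  have := h (Z2 z) (Z2 z1) mle _ w2; have := sq (Z1 z - w.1); move: phile phi1;
    rewrite /phi; lra.
have [Dz Jz] := DJ _ (KB _ Kz).
have dphi e : is_derive z e phi (2 * (Z1 z - w.1) * 'D_e Z1 z +
  2 * (Z2 z - w.2) * 'D_e Z2 z).
  have d1 := derivable_is (diff_derivable (v := e) (dZ1 z Kz)).
  have d2 := derivable_is (diff_derivable (v := e) (dZ2 z Kz)).
  have d1' : is_derive z e (fun z => Z1 z - w.1) ('D_e Z1 z).
    by rewrite -[X in is_derive _ _ _ X]subr0; apply: is_deriveB.
  have d2' : is_derive z e (fun z => Z2 z - w.2) ('D_e Z2 z).
    by rewrite -[X in is_derive _ _ _ X]subr0; apply: is_deriveB.
  have := is_deriveD (is_deriveM d1' d1') (is_deriveM d2' d2').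
  congr is_derive.
  by rewrite /GRing.scale /=; ring.
have crit (e : R * R) : `|e| <= 1 -> 2 * (Z1 z - w.1) * 'D_e Z1 z +
  2 * (Z2 z - w.2) * 'D_e Z2 z = 0.
  move=> e1; pose s := rho - `|z - z1|.
  have s0 : 0 < s by rewrite subr_gt0.
  have inK t : t \in `]- s, s[ -> K (z + t *: e).
    rewrite in_itv /= -ltr_norml => ts; apply/KE.
    rewrite addrAC (le_trans (ler_normD _ _))// normrZ.
    have : `|t| * `|e| <= `|t| by rewrite ler_piMr.
    rewrite /s in ts; lra.
  have := @derive1_at_min R (fun t : R => phi (z + t *: e)) (- s) s 0.
  have [||||_ <-] := @derive1_at_min R (fun t : R => phi (z + t *: e)) (- s) s 0.
  - lra.
  - move=> t /inK Kt; apply: diff_derivable.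
    apply: (@differentiable_comp _ _ _ _ (fun t : R => z + t *: e) phi).
      by apply: differentiableD => //; apply: differentiableZl.
    by apply: differentiableD; apply: differentiableM; apply: differentiableB => //;
      [exact: dZ1|exact: dZ1|exact: dZ2|exact: dZ2].
  - rewrite in_itv /=; lra.
  - by move=> t /inK Kt; rewrite scale0r addr0; apply: zmin; rewrite inE.
  have := dphi e; rewrite -[in is_derive z](addr0 z) -(scale0r e) => /line_derive[_ <-].
  by [].
have c1 : 2 * (Z1 z - w.1) * X1 z + 2 * (Z2 z - w.2) * X2 z = 0.
  by apply: crit; rewrite prod_normE /= normr0 normr1 ge_max lexx ler01.
have c2 : 2 * (Z1 z - w.1) * Y1 z + 2 * (Z2 z - w.2) * Y2 z = 0.
  by apply: crit; rewrite prod_normE /= normr0 normr1 ge_max lexx ler01.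
exists z; first by have := KB _ Kz; rewrite -ball_normE.
have e1 : Z1 z - w.1 = 0.
  apply: (mulIf Jz); rewrite mul0r.
  have -> : (Z1 z - w.1) * jac z = 2^-1 * ((2 * (Z1 z - w.1) * X1 z +
    2 * (Z2 z - w.2) * X2 z) * Y2 z -
     (2 * (Z1 z - w.1) * Y1 z + 2 * (Z2 z - w.2) * Y2 z) * X2 z) by rewrite /jac; field.
  rewrite c1 c2 !mul0r subr0; exact: mulr0.
have e2 : Z2 z - w.2 = 0.
  apply: (mulIf Jz); rewrite mul0r.
  have -> : (Z2 z - w.2) * jac z = 2^-1 * ((2 * (Z1 z - w.1) * Y1 z +
    2 * (Z2 z - w.2) * Y2 z) * X1 z -
     (2 * (Z1 z - w.1) * X1 z + 2 * (Z2 z - w.2) * X2 z) * Y1 z) by rewrite /jac; field.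
  rewrite c1 c2 !mul0r subr0; exact: mulr0.
rewrite [w]surjective_pairing /Z; congr pair; apply/eqP; rewrite -subr_eq0; exact/eqP.
Qed.

(** The inverse is Lipschitz by [inverse_estimate], hence differentiable with derivatives given by
    Cramer's rule. These are rational in the first derivatives of [Z] at [zeta w], so each order of
    smoothness of [zeta] yields the next one. *)
Theorem inverse_function z0 : D z0 -> jac z0 != 0 ->
  exists (r : R) (zeta : R * R -> R * R), [/\ 0 < r,
    forall z, ball z0 r z -> D z /\ jac z != 0,
    open (Z @` ball z0 r),
    forall z, ball z0 r z -> zeta (Z z) = z &
    smooth (Z @` ball z0 r) zeta].
Proof.
move=> Dz0 J0; have [r [C [r0 C0 DJ est]]] := inverse_estimate Dz0 J0.
have oI := open_image r0 C0 DJ est.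
set B := ball z0 r in DJ est oI *; set I := Z @` B in oI *.
pose zeta w := xget z0 [set z | B z /\ Z z = w].
have Zinj a b : B a -> B b -> Z a = Z b -> a = b.
  move=> Ba Bb ab; have := est a b Ba Bb; rewrite ab subrr normr0 mulr0 normr_le0.
  by rewrite subr_eq0 => /eqP.
have zetaK z : B z -> zeta (Z z) = z.
  move=> Bz; rewrite /zeta; case: xgetP => [y _ [By /Zinj]|/(_ z)[]//]; exact.
have zetaB w : I w -> B (zeta w) by case=> z Bz <-; rewrite zetaK.
have Zzeta w : I w -> Z (zeta w) = w by case=> z Bz <-; rewrite zetaK.
have zlip w w' : I w -> I w' -> `|zeta w - zeta w'| <= C * `|w - w'|.
  move=> Iw Iw'; rewrite -[in leRHS](Zzeta w Iw) -[in leRHS](Zzeta w' Iw').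
  by apply: est; exact: zetaB.
have czeta w : I w -> {for w, continuous zeta}.
  move=> Iw; apply/cvgrPdist_lt => e e0 /=.
  have n1 : \forall w' \near w, I w' by exact: (open_nbhs_nbhs (conj oI Iw)).
  have eC : 0 < e / C by rewrite divr_gt0.
  apply: filterS2 n1 (nbhsx_ballx w _ eC) => w' Iw'.
  rewrite -ball_normE /= ltr_pdivlMr// mulrC; apply: le_lt_trans; exact: zlip.
pose q1 (e w : R * R) := (e.1 * Y2 (zeta w) - e.2 * Y1 (zeta w)) / jac (zeta w).
pose q2 (e w : R * R) := (X1 (zeta w) * e.2 - X2 (zeta w) * e.1) / jac (zeta w).
have dzeta w (e : R * R) : I w -> is_derive w e (fun w => (zeta w).1) (q1 e w) /\
    is_derive w e (fun w => (zeta w).2) (q2 e w).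
  move=> Iw; have [Dz Jz] := DJ _ (zetaB _ Iw).
  have [K K0 KP] := cramer_bound Dz Jz.
  suff est2 (eps : R) : 0 < eps -> \forall h \near (0 : R),
      `|(zeta (w + h *: e)).1 - (zeta w).1 - h * q1 e w| <= eps * `|h| /\
      `|(zeta (w + h *: e)).2 - (zeta w).2 - h * q2 e w| <= eps * `|h|.
    by split; apply: is_derive_at => eps /est2; apply: filterS => h [].
  move=> eps0; pose M := K * (C * (`|e| + 1)).
  have M0 : 0 < M by rewrite !mulr_gt0// ltr_wpDl.
  have em0 : 0 < eps / M by rewrite divr_gt0.
  have [r1 [r10 _ s1]] := strict_diff (frame_RR R) oD Dz (sZ1 1%N) em0.
  have [r2 [r20 _ s2]] := strict_diff (frame_RR R) oD Dz (sZ2 1%N) em0.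
  have n1 : \forall v \near w, I v by exact: (open_nbhs_nbhs (conj oI Iw)).
  have n2 : \forall v \near w, ball (zeta w) r1 (zeta v) by apply: czeta => //;
    exact: nbhsx_ballx.
  have n3 : \forall v \near w, ball (zeta w) r2 (zeta v) by apply: czeta => //;
    exact: nbhsx_ballx.
  have n : \forall v \near w, [/\ I v, ball (zeta w) r1 (zeta v) &
    ball (zeta w) r2 (zeta v)].
    exact: filterS3 n1 n2 n3.
  have := line_near e n.
  apply: filterS => h [Iv b1 b2].
  set dl := zeta (w + h *: e) - zeta w.
  have dle : `|dl| <= C * (`|e| + 1) * `|h|.
    rewrite (le_trans (zlip _ _ Iv Iw))// addrC addKr normrZ -mulrA ler_wpM2l ?(ltW C0)//.
    by rewrite mulrC ler_wpM2r// lerDl.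
  have ZE := Zzeta _ Iv; have ZE0 := Zzeta _ Iw.
  have E1 : Z1 (zeta (w + h *: e)) - Z1 (zeta w) = h * e.1.
    have -> : Z1 (zeta (w + h *: e)) = (w + h *: e).1 by rewrite -{2}ZE.
    have -> : Z1 (zeta w) = w.1 by rewrite -{2}ZE0.
    by rewrite /= addrC addKr.
  have E2 : Z2 (zeta (w + h *: e)) - Z2 (zeta w) = h * e.2.
    have -> : Z2 (zeta (w + h *: e)) = (w + h *: e).2 by rewrite -{2}ZE.
    have -> : Z2 (zeta w) = w.2 by rewrite -{2}ZE0.
    by rewrite /= addrC addKr.
  have h1 := s1 _ _ (zeta w) b1 (ballxx _ r10) (ballxx _ r10).
  have h2 := s2 _ _ (zeta w) b2 (ballxx _ r20) (ballxx _ r20).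
  rewrite -/dl E1 distrC in h1; rewrite -/dl E2 distrC in h2.
  have [g1 g2] := KP dl (h *: e) _ h1 h2.
  have fin : K * (eps / M * `|dl|) <= eps * `|h|.
    have := ler_wpM2l (ltW (mulr_gt0 K0 em0)) dle; rewrite -mulrA => /le_trans; apply.
    have -> : K * (eps / M) * (C * (`|e| + 1) * `|h|) = eps * `|h|; last by [].
    by rewrite /M; field; rewrite !gt_eqF// ltr_wpDl.
  split; [move: g1|move: g2] => /le_trans/(_ fin).
    by congr (`|_ - _| <= _); rewrite /q1 /=; rewrite /GRing.scale /=; ring.
  by congr (`|_ - _| <= _); rewrite /q2 /=; rewrite /GRing.scale /=; ring.
exists r, zeta; split=> // k; elim: k => [|k IHk]; first exact: czeta.
have Cz (g : R * R -> R) : Cn k D g -> Cn k I (fun w => g (zeta w)).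
  by apply: (Cn_comp_scalar (frame_RR R) oI) => // w /zetaB/DJ[].
have CX1 : Cn k I (fun w => X1 (zeta w)) := Cz _ (Cn_derive ((1, 0) : R * R) (sZ1 k.+1)).
have CX2 : Cn k I (fun w => X2 (zeta w)) := Cz _ (Cn_derive ((1, 0) : R * R) (sZ2 k.+1)).
have CY1 : Cn k I (fun w => Y1 (zeta w)) := Cz _ (Cn_derive ((0, 1) : R * R) (sZ1 k.+1)).
have CY2 : Cn k I (fun w => Y2 (zeta w)) := Cz _ (Cn_derive ((0, 1) : R * R) (sZ2 k.+1)).
have CJ : Cn k I (fun w => (jac (zeta w))^-1).
  apply: CnV => // [w /zetaB/DJ[]//|].
  exact: (CnB oI (CnM oI CX1 CY2) (CnM oI CX2 CY1)).
have Cc (c : R) : Cn k I (fun=> c) := Cn_cst k I c.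
apply/Cn_pairP => //; split.
  apply: (@Cn_partials _ _ _ _ (q1 (1, 0)) (q1 (0, 1))) => //.
  - by move=> w Iw; have [] := dzeta w (1, 0) Iw.
  - by move=> w Iw; have [] := dzeta w (0, 1) Iw.
  - exact: (CnM oI (CnB oI (CnM oI (Cc _) CY2) (CnM oI (Cc _) CY1)) CJ).
  - exact: (CnM oI (CnB oI (CnM oI (Cc _) CY2) (CnM oI (Cc _) CY1)) CJ).
apply: (@Cn_partials _ _ _ _ (q2 (1, 0)) (q2 (0, 1))) => //.
- by move=> w Iw; have [] := dzeta w (1, 0) Iw.
- by move=> w Iw; have [] := dzeta w (0, 1) Iw.
- exact: (CnM oI (CnB oI (CnM oI CX1 (Cc _)) (CnM oI CX2 (Cc _))) CJ).
- exact: (CnM oI (CnB oI (CnM oI CX1 (Cc _)) (CnM oI CX2 (Cc _))) CJ).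
Qed.

End inverse_function.

(** * The Lorentzian cross product *)

Section Lorentz_cross_product.
Variable R : realType.
Implicit Types X Y Z N P Q : 'rV[R]_3.

(** Characterised by [lprod (lcross X Y) Z = det (X, Y, Z)]; the sign of the first component
    compensates that of the metric. *)
Definition lcross X Y : 'rV[R]_3 :=
  \row_j if j == 0 then - (X 0 1 * Y 0 2 - X 0 2 * Y 0 1)
         else if j == 1 then X 0 2 * Y 0 0 - X 0 0 * Y 0 2
         else X 0 0 * Y 0 1 - X 0 1 * Y 0 0.

Lemma forall_I3 (P : 'I_3 -> Prop) : P 0 -> P 1 -> P 2 -> forall j, P j.
Proof.
move=> P0 P1 P2 [[|[|[|//]]] jlt].
- by rewrite (_ : Ordinal jlt = 0)//; exact/val_inj.
- by rewrite (_ : Ordinal jlt = 1)//; exact/val_inj.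
- by rewrite (_ : Ordinal jlt = 2)//; exact/val_inj.
Qed.

Lemma lcross0 X Y : lcross X Y 0 0 = - (X 0 1 * Y 0 2 - X 0 2 * Y 0 1).
Proof. by rewrite mxE. Qed.
Lemma lcross1 X Y : lcross X Y 0 1 = X 0 2 * Y 0 0 - X 0 0 * Y 0 2.
Proof. by rewrite mxE. Qed.
Lemma lcross2 X Y : lcross X Y 0 2 = X 0 0 * Y 0 1 - X 0 1 * Y 0 0.
Proof. by rewrite mxE. Qed.
Definition lcrossE := (lcross0, lcross1, lcross2).

Lemma rV3P X Y : X 0 0 = Y 0 0 -> X 0 1 = Y 0 1 -> X 0 2 = Y 0 2 -> X = Y.
Proof. by move=> h0 h1 h2; apply/rowP; exact: forall_I3. Qed.

Lemma mxDE X Y i : (X + Y) 0 i = X 0 i + Y 0 i. Proof. by rewrite mxE. Qed.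
Lemma mxNE X i : (- X) 0 i = - X 0 i. Proof. by rewrite mxE. Qed.
Lemma mxZE (k : R) X i : (k *: X) 0 i = k * X 0 i. Proof. by rewrite mxE. Qed.
Lemma mx0E i : (0 : 'rV[R]_3) 0 i = 0. Proof. by rewrite mxE. Qed.
Definition rvE := (mxDE, mxNE, mxZE, mx0E).

Lemma lprodC X Y : lprod X Y = lprod Y X.
Proof. by rewrite /lprod; ring. Qed.

Lemma lprodDl X Y Z : lprod (X + Y) Z = lprod X Z + lprod Y Z.
Proof. by rewrite /lprod !rvE; ring. Qed.

Lemma lprodDr X Y Z : lprod Z (X + Y) = lprod Z X + lprod Z Y.
Proof. by rewrite /lprod !rvE; ring. Qed.

Lemma lprodZl (k : R) X Y : lprod (k *: X) Y = k * lprod X Y.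
Proof. by rewrite /lprod !rvE; ring. Qed.

Lemma lprodZr (k : R) X Y : lprod X (k *: Y) = k * lprod X Y.
Proof. by rewrite /lprod !rvE; ring. Qed.

Lemma lprodNl X Y : lprod (- X) Y = - lprod X Y.
Proof. by rewrite /lprod !rvE; ring. Qed.

Lemma lprodNr X Y : lprod X (- Y) = - lprod X Y.
Proof. by rewrite /lprod !rvE; ring. Qed.

Lemma lprod0l X : lprod 0 X = 0.
Proof. by rewrite /lprod !rvE; ring. Qed.

Lemma lprod0r X : lprod X 0 = 0.
Proof. by rewrite /lprod !rvE; ring. Qed.

Lemma lcross_l X Y : lprod (lcross X Y) X = 0.
Proof. by rewrite /lprod !lcrossE; ring. Qed.

Lemma lcross_r X Y : lprod (lcross X Y) Y = 0.
Proof. by rewrite /lprod !lcrossE; ring. Qed.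

Lemma lcrossK X Y Z : lcross (lcross X Y) Z = lprod Y Z *: X - lprod X Z *: Y.
Proof. by apply: rV3P; rewrite !(lcrossE, rvE) /lprod; ring. Qed.

Lemma lcross_norm X Y :
  lprod (lcross X Y) (lcross X Y) = lprod X Y ^+ 2 - lprod X X * lprod Y Y.
Proof. by rewrite /lprod !lcrossE; ring. Qed.

(** The expansion of [N] in the basis dual to [X], [Y], [Z], multiplied by the determinant to avoid
    a division. *)
Lemma lprod_dual X Y Z N : lprod (lcross X Y) Z *: N =
  lprod N X *: lcross Y Z + lprod N Y *: lcross Z X + lprod N Z *: lcross X Y.
Proof. by apply: rV3P; rewrite !(lcrossE, rvE) /lprod !lcrossE; ring. Qed.

Lemma det2 (B : 'M[R]_2) : \det B = B 0 0 * B 1 1 - B 0 1 * B 1 0.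
Proof.
have l0 : lift (0 : 'I_2) (0 : 'I_1) = 1 by exact/val_inj.
have l1 : lift (1 : 'I_2) (0 : 'I_1) = 0 by exact/val_inj.
rewrite (expand_det_row B 0) !big_ord_recl big_ord0 addr0 /cofactor !det_mx11 !mxE.
by rewrite !l0 l1 /= expr0 expr1 mul1r mulN1r mulrN.
Qed.

Lemma positively_orientedE X Y Z : positively_oriented X Y Z <-> 0 < lprod (lcross X Y) Z.
Proof.
rewrite /positively_oriented; suff -> : \det (col_mx X (col_mx Y Z) : 'M[R]_3) =
  lprod (lcross X Y) Z by [].
set A := (col_mx X (col_mx Y Z) : 'M[R]_3).
have A0 j : A 0 j = X 0 j.
  have e0 : (0 : 'I_3) = lshift 2 (0 : 'I_1) by exact/val_inj.
  by rewrite /A e0 (col_mxEu X (col_mx Y Z)).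
have A1 j : A 1 j = Y 0 j.
  have e1 : (1 : 'I_3) = rshift 1 (lshift 1 (0 : 'I_1)) by exact/val_inj.
  by rewrite /A e1 (col_mxEd X (col_mx Y Z)) (col_mxEu Y Z).
have A2 j : A 2 j = Z 0 j.
  have e2 : (2 : 'I_3) = rshift 1 (rshift 1 (0 : 'I_1)) by exact/val_inj.
  by rewrite /A e2 (col_mxEd X (col_mx Y Z)) (col_mxEd Y Z).
clearbody A.
have l01 : lift (0 : 'I_3) (0 : 'I_2) = 1 by exact/val_inj.
have l02 : lift (0 : 'I_3) (1 : 'I_2) = 2 by exact/val_inj.
have l10 : lift (1 : 'I_3) (0 : 'I_2) = 0 by exact/val_inj.
have l11 : lift (1 : 'I_3) (1 : 'I_2) = 2 by exact/val_inj.
have l20 : lift (2 : 'I_3) (0 : 'I_2) = 0 by exact/val_inj.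
have l21 : lift (2 : 'I_3) (1 : 'I_2) = 1 by exact/val_inj.
have ord3 (G : 'I_3 -> R) : \sum_j G j = G 0 + G 1 + G 2.
  rewrite !big_ord_recl big_ord0 addr0 addrA; congr (_ + G _ + G _); exact/val_inj.
rewrite (expand_det_row A 0) ord3 /cofactor !det2 !mxE.
rewrite !(l01, l02, l10, l11, l20, l21) !(A0, A1, A2) /lprod !lcrossE /= .
rewrite !expr0 !expr1 sqrrN expr1n; ring.
Qed.

(** Both sides are normal to the plane of [P] and [Q], and have the same square length by
    [lcross_norm] as [P] and [Q] are null; the orientation fixes the sign. *)
Lemma null_cross P Q N : lprod P P = 0 -> lprod Q Q = 0 ->
  lprod N N = 1 -> lprod P N = 0 -> lprod Q N = 0 ->
  0 < lprod P Q -> 0 < lprod (lcross P Q) N -> lcross P Q = lprod P Q *: N.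
Proof.
move=> PP QQ NN PN QN PQ orient.
have dual := lprod_dual P Q N N.
rewrite (lprodC N P) (lprodC N Q) PN QN NN !scale0r !add0r scale1r in dual.
set d := lprod (lcross P Q) N in orient dual.
have sq : d ^+ 2 = lprod P Q ^+ 2.
  have := lcross_norm P Q; rewrite PP QQ mulr0 subr0 -dual lprodZl lprodZr NN mulr1 => <-.
  by rewrite expr2.
rewrite -dual; congr (_ *: _).
by apply/eqP; rewrite -(@eqrXn2 _ 2)// ?ltW//; apply/eqP.
Qed.

Lemma normal_component P Q N X : lprod N N = 1 -> lprod P N = 0 -> lprod Q N = 0 ->
  lprod (lcross P Q) N != 0 -> lprod X P = 0 -> lprod X Q = 0 -> X = lprod X N *: N.
Proof.
move=> NN PN QN D0 XP XQ.
have dualN := lprod_dual P Q N N.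
rewrite (lprodC N P) (lprodC N Q) PN QN NN !scale0r !add0r scale1r in dualN.
have dualX := lprod_dual P Q N X.
rewrite XP XQ !scale0r !add0r in dualX.
by apply: (scalerI D0); rewrite dualX -[in LHS]dualN !scalerA mulrC.
Qed.

End Lorentz_cross_product.

(** * Calculus of vector-valued maps *)

Section vector_calculus.
Variable R : realType.
Implicit Types (U : normedModType R).

Lemma is_derive_mx U m n (f : U -> 'M[R]_(m, n)) p v (d : 'M[R]_(m, n)) :
  (forall i j, is_derive p v (fun q => f q i j) (d i j)) <-> is_derive p v f d.
Proof.
split=> [df|[df <-] i j].
  have dfp : derivable f p v by apply/derivable_mxP => i j; case: (df i j).
  constructor => //; rewrite derive_mx//; apply/matrixP => i j; rewrite mxE.
  by case: (df i j).
rewrite derive_mx// mxE; apply: derivable_is.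
by move/derivable_mxP : df; exact.
Qed.

Lemma is_derive_lprod U (f g : U -> 'rV[R]_3) p v df dg :
  is_derive p v f df -> is_derive p v g dg ->
  is_derive p v (fun q => lprod (f q) (g q)) (lprod df (g p) + lprod (f p) dg).
Proof.
move=> /is_derive_mx f' /is_derive_mx g'; rewrite /lprod.
have := is_deriveD (is_deriveD (is_deriveN (is_deriveM (f' 0 0) (g' 0 0)))
  (is_deriveM (f' 0 1) (g' 0 1))) (is_deriveM (f' 0 2) (g' 0 2)).
congr is_derive; rewrite /GRing.scale /=; ring.
Qed.

Lemma Cn_lprod U k (D : set U) (f g : U -> 'rV[R]_3) : open D ->
  Cn k D f -> Cn k D g -> Cn k D (fun p => lprod (f p) (g p)).
Proof.
move=> oD cf cg; have cfi i := Cn_entry 0 i oD cf; have cgi i := Cn_entry 0 i oD cg.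
by apply: CnD => //; [apply: CnD => //; [apply: CnN => //|]|]; apply: CnM.
Qed.

Lemma Cn_lcross U k (D : set U) (f g : U -> 'rV[R]_3) : open D ->
  Cn k D f -> Cn k D g -> Cn k D (fun p => lcross (f p) (g p)).
Proof.
move=> oD cf cg; have cfi i := Cn_entry 0 i oD cf; have cgi i := Cn_entry 0 i oD cg.
apply/Cn_mxP => // i; rewrite ord1; apply: forall_I3.
- apply: eq_Cn (oD) (fun p _ => esym (lcross0 _ _)) _.
  by apply: CnN => //; apply: CnB => //; apply: CnM.
- apply: eq_Cn (oD) (fun p _ => esym (lcross1 _ _)) _.
  by apply: CnB => //; apply: CnM.
- apply: eq_Cn (oD) (fun p _ => esym (lcross2 _ _)) _.
  by apply: CnB => //; apply: CnM.
Qed.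

Lemma derive_mx_commute U m n (D : set U) (f : U -> 'M[R]_(m, n)) v w p :
  open D -> D p -> Cn 2 D f -> 'D_v ('D_w f) p = 'D_w ('D_v f) p.
Proof.
move=> oD Dp cf.
have half a b : 'D_a ('D_b f) p = \matrix_(i, j) 'D_a ('D_b (fun q => f q i j)) p.
  have db : derivable ('D_b f) p a.
    by apply: diff_derivable; exact: Cn_differentiable (Cn_derive b cf) Dp.
  rewrite derive_mx//; apply/matrixP => i j; rewrite !mxE.
  apply: (derive_eq_on _ oD _ Dp) => q Dq.
  have dq : derivable f q b by apply: diff_derivable; exact: Cn_differentiable cf Dq.
  by rewrite (derive_mx dq) mxE.
apply: etrans (half v w) _; apply: etrans _ (esym (half w v)); apply: eq_mx => i j.
exact: derive_commute oD Dp (Cn_entry i j oD cf).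
Qed.

Lemma Cn_is_derive U (V : normedModType R) k (D : set U) (f : U -> V) p v : Cn k.+1 D f ->
  D p ->
  is_derive p v f ('D_v f p).
Proof. by move=> cf Dp; apply: derivable_is; apply: diff_derivable;
  exact: Cn_differentiable cf Dp. Qed.

End vector_calculus.

(** * The equation of CMC surfaces in null coordinates *)

Section cmc_equation.
Variable R : realType.
Implicit Types (f g N : R * R -> 'rV[R]_3) (D : set (R * R)).

Lemma smooth_derive (U V : normedModType R) (D : set U) (f : U -> V) v :
  smooth D f -> smooth D ('D_v f).
Proof. by move=> sf k; exact: Cn_derive (sf k.+1). Qed.

Lemma smooth_is_derive (U V : normedModType R) (D : set U) (f : U -> V) p v :
  smooth D f -> D p -> is_derive p v f ('D_v f p).
Proof. by move=> sf; exact: Cn_is_derive (sf 1%N). Qed.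

Lemma smooth_differentiable (U V : normedModType R) (D : set U) (f : U -> V) p :
  smooth D f -> D p -> differentiable f p.
Proof. by move=> sf; exact: Cn_differentiable (sf 1%N). Qed.

Lemma smooth_continuous (U V : normedModType R) (D : set U) (f : U -> V) p :
  smooth D f -> D p -> {for p, continuous f}.
Proof. by move=> sf; exact: Cn_continuous (sf 0%N). Qed.

Definition cmc_equation (H : R) D f : Prop := forall z, D z ->
  'D_(0, 1) ('D_(1, 0) f) z = H *: lcross ('D_(1, 0) f z) ('D_(0, 1) f z).

Lemma is_derive_unique (U V : normedModType R) (f : U -> V) p v d d' :
  is_derive p v f d -> is_derive p v f d' -> d = d'.
Proof. by move=> [_ <-] [_ <-]. Qed.

Lemma null_second (D : set (R * R)) f v w z : open D -> D z -> smooth D f ->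
  (forall p, D p -> lprod ('D_v f p) ('D_v f p) = 0) ->
  lprod ('D_w ('D_v f) z) ('D_v f z) = 0.
Proof.
move=> oD Dz sf null.
have dv := smooth_is_derive w (smooth_derive v sf) Dz.
have := is_derive_lprod dv dv.
have zero : is_derive z w (fun q => lprod ('D_v f q) ('D_v f q)) 0.
  apply: near_eq_is_derive (is_derive_cst (0 : R) z w).
  by move: (open_nbhs_nbhs (conj oD Dz)); apply: filterS => q /null ->.
move=> /(is_derive_unique zero); rewrite [X in _ = _ + X]lprodC => /esym/eqP.
by rewrite -mulr2n mulrn_eq0 /= => /eqP.
Qed.

(** Differentiating [<f_x, f_x> = 0] along [y] and [<f_y, f_y> = 0] along [x] shows that [f_xy] is
    normal to the surface, so its product with [N] determines it; [null_cross] then replaces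
    [<f_x, f_y> N] by the cross product. *)
Lemma cmc_equation_null (H : R) D f N : open D -> smooth D f ->
  (forall z, D z -> [/\ lprod ('D_(1, 0) f z) ('D_(1, 0) f z) = 0,
     lprod ('D_(0, 1) f z) ('D_(0, 1) f z) = 0 &
       0 < lprod ('D_(1, 0) f z) ('D_(0, 1) f z)]) ->
  (forall z, D z -> [/\ lprod (N z) (N z) = 1, lprod ('D_(1, 0) f z) (N z) = 0,
     lprod ('D_(0, 1) f z) (N z) = 0 & 0 < lprod (lcross ('D_(1, 0) f z) ('D_(0,
       1) f z)) (N z)]) ->
  (forall z, D z -> lprod ('D_(0, 1) ('D_(1, 0) f) z) (N z) =
      H * lprod ('D_(1, 0) f z) ('D_(0, 1) f z)) ->
  cmc_equation H D f.
Proof.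
move=> oD sf null nor curv z Dz.
have [XX YY XY] := null z Dz; have [NN XN YN orient] := nor z Dz.
have SX : lprod ('D_(0, 1) ('D_(1, 0) f) z) ('D_(1, 0) f z) = 0.
  by apply: (null_second _ oD Dz sf) => p /null[].
have SY : lprod ('D_(0, 1) ('D_(1, 0) f) z) ('D_(0, 1) f z) = 0.
  rewrite (derive_mx_commute _ _ oD Dz (sf 2%N)).
  by apply: (null_second _ oD Dz sf) => p /null[].
rewrite (normal_component NN XN YN _ SX SY) ?gt_eqF// curv//.
by rewrite (null_cross XX YY NN XN YN XY orient) scalerA.
Qed.

(** By [a b - a' b' = a (b - b') + (a - a') b'], one factor of each pair has to be bounded; two such
    products make up an entry, hence the 4. *)
Lemma lcross_dist (a b a' b' : 'rV[R]_3) (M e : R) j :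
  `|a| <= M -> `|b'| <= M -> `|a - a'| <= e -> `|b - b'| <= e ->
  `|lcross a b 0 j - lcross a' b' 0 j| <= 4 * M * e.
Proof.
move=> aM bM ae be.
have M0 : 0 <= M := le_trans (normr_ge0 _) aM; have e0 : 0 <= e :=
  le_trans (normr_ge0 _) ae.
have prod2 k l : `|a 0 k * b 0 l - a' 0 k * b' 0 l| <= 2 * M * e.
  have -> : a 0 k * b 0 l - a' 0 k * b' 0 l = a 0 k * (b - b') 0 l + (a - a') 0 k * b' 0 l.
    by rewrite !rvE; ring.
  have -> : 2 * M * e = M * e + e * M by ring.
  rewrite (le_trans (ler_normD _ _))// !normrM lerD//.
    by apply: ler_pM => //; exact: le_trans (mx_entry_le _ _ _) _.
  by apply: ler_pM => //; exact: le_trans (mx_entry_le _ _ _) _.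
have two k l k' l' : `|(a 0 k * b 0 l - a' 0 k * b' 0 l) - (a 0 k' * b 0 l' - a' 0 k' * b' 0 l')| <= 4 * M * e.
  have := ler_normB (a 0 k * b 0 l - a' 0 k * b' 0 l) (a 0 k' * b 0 l' - a' 0 k' * b' 0 l').
  have := prod2 k l; have := prod2 k' l'; lra.
move: j; apply: forall_I3; rewrite !lcrossE.
- by have := two 1 2 2 1; rewrite -normrN; congr (`|_| <= _); ring.
- by have := two 2 0 0 2; congr (`|_| <= _); ring.
- by have := two 0 1 1 0; congr (`|_| <= _); ring.
Qed.

Definition stack3 (a b c : 'rV[R]_3) : 'M[R]_3 :=
  \matrix_(i, j) (if i == 0 then a else if i == 1 then b else c) 0 j.

Lemma stack30 a b c j : stack3 a b c 0 j = a 0 j. Proof. by rewrite mxE. Qed.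
Lemma stack31 a b c j : stack3 a b c 1 j = b 0 j. Proof. by rewrite mxE. Qed.
Lemma stack32 a b c j : stack3 a b c 2 j = c 0 j. Proof. by rewrite mxE. Qed.

(** Gronwall's inequality with vanishing initial and error terms, for the differences of [f], [f_x]
    and [f_y]; the first two are differentiated along [y], the third along [x]. *)
Lemma cmc_equation_unique (H a b : R) f g :
  smooth (box a b) f -> smooth (box a b) g ->
  cmc_equation H (box a b) f -> cmc_equation H (box a b) g ->
  (forall t, a < t < b -> [/\ f (t, - t) = g (t, - t),
     'D_(1, 0) f (t, - t) = 'D_(1, 0) g (t, - t) &
       'D_(0, 1) f (t, - t) = 'D_(0, 1) g (t, - t)]) ->
  forall z, box a b z -> f z = g z.
Proof.
move=> sf sg ef eg fg z zb.
have oB := @box_open R a b.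
have [a' [b' [aa bb _ zb']]] := box_inside zb.
pose K := cbox a' b'; have KB : K `<=` box a b := cbox_box aa bb.
have bnd (h : R * R -> 'rV[R]_3) : smooth (box a b) h -> exists2 M : R, 0 < M & forall q,
  K q -> `|h q| <= M.
  move=> sh; have [M M0 MP] : exists2 M : R, 0 < M & forall q, K q -> `|(`|h q| : R)| <= M.
    apply: compact_bound; first exact: cbox_compact.
    apply: within_continuous => q /KB qB.
    apply: (@continuous_comp _ _ _ h (fun v => `|v|)); last exact: norm_continuous.
    exact: smooth_continuous sh qB.
  by exists M => // q /MP; rewrite normr_id.
have fx := smooth_derive ((1, 0) : R * R) sf; have fy := smooth_derive ((0, 1) : R * R) sf.
have gx := smooth_derive ((1, 0) : R * R) sg; have gy := smooth_derive ((0, 1) : R * R) sg.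
have [M1 M10 M1P] := bnd _ fx.
have [M2 M20 M2P] := bnd _ gy.
pose M := M1 + M2.
pose w q := stack3 (f q - g q) ('D_(1, 0) f q - 'D_(1, 0) g q) ('D_(0, 1) f q - 'D_(0,
  1) g q).
pose cr q := H *: (lcross ('D_(1, 0) f q) ('D_(0, 1) f q) - lcross ('D_(1, 0) g q) ('D_(0,
  1) g q)).
have crE q : box a b q -> cr q = 'D_(0, 1) ('D_(1, 0) f) q - 'D_(0, 1) ('D_(1, 0) g) q.
  move=> qB; have e1 := ef q qB; have e2 := eg q qB.
  by apply: etrans (congr2 (fun x y => x - y) (esym e1) (esym e2)); exact: scalerBr.
pose dw q := stack3 ('D_(0, 1) f q - 'D_(0, 1) g q) (cr q) (cr q).
(* The 1 is for the row of [f], whose derivative is another row of [w]; the other term bounds the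
   rows governed by the cross product. *)
pose L := 1 + `|H| * (4 * M).
have M0 : 0 < M by rewrite addr_gt0.
have L0 : 0 < L by rewrite ltr_wpDr// mulr_ge0// mulr_ge0// ltW.
have entry (h : R * R -> 'rV[R]_3) p v d j : is_derive p v h d ->
  is_derive p v (fun q => h q 0 j) (d 0 j).
  by move=> /is_derive_mx; apply.
have rowle (q : R * R) i (v : 'rV[R]_3) : (forall j, w q i j = v 0 j) -> `|v| <= `|w q|.
  by move=> E; apply: mx_norm_le => // k j; rewrite ord1 -E mx_entry_le.
have w0 : `|w z| <= (2 * 0 + 0 / L) * expR (2 * L * `|ell z|).
  apply: (@gronwall R 3 3 (fun i _ => i == 2) K w dw L 0 0) => //.
  - exact: cbox_compact.
  - by move=> i j p s; exact: cbox_seg.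
  - apply: within_continuous => q /KB qB; apply: mx_continuous_at => i j.
    apply: (mx_entry_continuous_at (f := w));
      apply: (Cn_continuous (n := 0) (D := box a b)) => //.
    apply/Cn_mxP => // {}i {}j; move: i; apply: forall_I3.
    + apply: (eq_Cn oB (fun p _ => esym (stack30 _ _ _ _))).
      exact: (Cn_entry _ _ oB (CnB oB (sf 0%N) (sg 0%N))).
    + apply: (eq_Cn oB (fun p _ => esym (stack31 _ _ _ _))).
      exact: (Cn_entry _ _ oB (CnB oB (fx 0%N) (gx 0%N))).
    + apply: (eq_Cn oB (fun p _ => esym (stack32 _ _ _ _))).
      exact: (Cn_entry _ _ oB (CnB oB (fy 0%N) (gy 0%N))).
  - move=> p + j /KB pB; apply: forall_I3.
    + rewrite stack30 (_ : (fun q => w q 0 j) = (fun q => (f q - g q) 0 j)); last first.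
        by apply/funext => q; rewrite stack30.
      by apply: entry; apply: is_deriveB; exact: smooth_is_derive.
    + rewrite stack31 (_ : (fun q => w q 1 j) =
      (fun q => ('D_(1, 0) f q - 'D_(1, 0) g q) 0 j)); last first.
        by apply/funext => q; rewrite stack31.
      apply: entry; rewrite (crE p pB).
      by apply: is_deriveB; [exact: smooth_is_derive fx pB|exact: smooth_is_derive gx pB].
    + rewrite stack32 (_ : (fun q => w q 2 j) =
      (fun q => ('D_(0, 1) f q - 'D_(0, 1) g q) 0 j)); last first.
        by apply/funext => q; rewrite stack32.
      apply: entry; rewrite (crE p pB).
      rewrite (derive_mx_commute _ _ oB pB (sf 2%N)) (derive_mx_commute _ _ oB pB (sg 2%N)).
      by apply: is_deriveB; [exact: smooth_is_derive fy pB|exact: smooth_is_derive gy pB].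
  - move=> p + j Kp; rewrite addr0.
    have crle : `|cr p 0 j| <= L * `|w p|.
      rewrite mxZE normrM mx_subE.
      have := @lcross_dist ('D_(1, 0) f p) ('D_(0, 1) f p) ('D_(1, 0) g p) ('D_(0,
        1) g p) M `|w p| j.
      move=> /(_ (le_trans (M1P p Kp) _) (le_trans (M2P p Kp) _)) h.
      have {}h : `|lcross ('D_(1, 0) f p) ('D_(0, 1) f p) 0 j - lcross ('D_(1,
        0) g p) ('D_(0, 1) g p) 0 j| <= 4 * M * `|w p|.
        apply: h; [by rewrite /M lerDl ltW|by rewrite /M lerDr ltW| |].
          by apply: (@rowle p 1) => k; rewrite stack31.
        by apply: (@rowle p 2) => k; rewrite stack32.
      rewrite (le_trans (ler_wpM2l (normr_ge0 H) h))//.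
      have -> : `|H| * (4 * M * `|w p|) = L * `|w p| - `|w p| by rewrite /L; ring.
      by rewrite lerBlDr lerDl normr_ge0.
    apply: forall_I3; rewrite ?stack31 ?stack32//.
    rewrite stack30 (le_trans (mx_entry_le _ _ _))//.
    rewrite (@le_trans _ _ `|w p|)//; first by apply: (@rowle p 2) => k; rewrite stack32.
    by rewrite ler_peMl// /L lerDl mulr_ge0// mulr_ge0// ltW.
  - move=> p /KB pB /ell0_diag pE; have [e1 e2 e3] := fg p.1 pB.1.
    rewrite -pE in e1 e2 e3; rewrite /w e1 e2 e3 !subrr; apply: mx_norm_le;
      [exact: lexx|move=> i j].
    by rewrite mxE; case: ifP => _; [|case: ifP => _]; rewrite mx0E normr0.
  - exact: box_cbox.
move: w0; rewrite mulr0 mul0r addr0 mul0r normr_le0 => /eqP w0.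
apply/eqP; rewrite -subr_eq0; apply/eqP/rowP => j.
by rewrite -(stack30 _ ('D_(1, 0) f z - 'D_(1, 0) g z) ('D_(0, 1) f z - 'D_(0,
  1) g z)) -/(w z) w0 !mxE.
Qed.

Lemma constant_along d a b (w : R * R -> R) z :
  (forall p, box a b p -> is_derive p (evec d) w 0) -> box a b z -> w z = w (bpt d z).
Proof.
move=> dw zb; apply/eqP; rewrite -subr_eq0 -normr_le0.
have := @seg_growth R d w (fun=> 0) z 0 1 ltr01.
rewrite mul0r mul0r; apply=> s s01; first by apply: dw; exact: box_seg.
by rewrite normr0 mul0r.
Qed.

Lemma diag_derive (V : normedModType R) (f : R * R -> V) (f0 : R -> V) (t : R) :
  differentiable f (t, - t) -> (\forall s \near t, f (s, - s) = f0 s) ->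
  is_derive t 1 f0 ('D_(1, 0) f (t, - t) - 'D_(0, 1) f (t, - t)).
Proof.
move=> df ff0.
have lineE (s : R) : 0 + s *: ((1, -1) : R * R) = (s, - s).
  by rewrite add0r; congr pair; [exact: mulr1|exact: mulrN1].
have D1 : 'D_(1, -1) f (t, - t) = 'D_(1, 0) f (t, - t) - 'D_(0, 1) f (t, - t).
  by rewrite (derive_frame (frame_RR R))// big_bool /= scale1r scaleN1r.
rewrite -D1.
have : is_derive (0 + t *: ((1, -1) : R * R)) (1, -1) f ('D_(1, -1) f (t, - t)).
  by rewrite lineE; apply: derivable_is; exact: diff_derivable.
move=> /line_derive; apply: near_eq_is_derive; apply: filterS ff0 => s <-.
by rewrite lineE.
Qed.

End cmc_equation.

(** * Local existence for the Cauchy problem *)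

Section existence.
Variable R : realType.
Implicit Types (f g : R * R -> 'rV[R]_3) (D : set (R * R)).

Lemma bpt_box d (a b : R) z : box a b z -> exists2 t, a < t < b & bpt d z = (t, - t).
Proof.
move=> zb; have := @box_seg R a b d z 0 zb;
  rewrite mul0r scale0r addr0 lexx ler01 => /(_ isT) [bz _].
by exists (bpt d z).1 => //; apply: ell0_diag; exact: ell_bpt.
Qed.

Lemma eq_along d (a b : R) (w1 w2 dw : R * R -> R) :
  (forall p, box a b p -> is_derive p (evec d) w1 (dw p)) ->
  (forall p, box a b p -> is_derive p (evec d) w2 (dw p)) ->
  (forall t, a < t < b -> w1 (t, - t) = w2 (t, - t)) ->
  forall z, box a b z -> w1 z = w2 z.
Proof.
move=> d1 d2 eq0 z zb; apply/eqP; rewrite -subr_eq0.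
have [t tab tE] := bpt_box d zb.
rewrite (@constant_along R d a b (fun p => w1 p - w2 p) z _ zb); last first.
  by move=> p pb; rewrite -(subrr (dw p)); apply: is_deriveB; [exact: d1|exact: d2].
by rewrite tE eq0// subrr.
Qed.

Lemma eq_along_mx m n d (a b : R) (w1 w2 dw : R * R -> 'M[R]_(m, n)) :
  (forall p, box a b p -> is_derive p (evec d) w1 (dw p)) ->
  (forall p, box a b p -> is_derive p (evec d) w2 (dw p)) ->
  (forall t, a < t < b -> w1 (t, - t) = w2 (t, - t)) ->
  forall z, box a b z -> w1 z = w2 z.
Proof.
move=> d1 d2 eq0 z zb; apply/matrixP => i j.
apply: (@eq_along d a b (fun p => w1 p i j) (fun p => w2 p i j) (fun p =>
  dw p i j) _ _ _ z zb).
- by move=> p /d1/is_derive_mx; apply.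
- by move=> p /d2/is_derive_mx; apply.
- by move=> t /eq0 ->.
Qed.

(** Positivity of the product corresponds to [eps = 1] in [null_metric]. *)
Definition null_pair (P Q : 'rV[R]_3) : Prop :=
  [/\ lprod P P = 0, lprod Q Q = 0 & 0 < lprod P Q].

Definition null_cmc (H : R) D f : Prop :=
  [/\ smooth D f, forall z, D z -> null_pair ('D_(1, 0) f z) ('D_(0, 1) f z) &
      cmc_equation H D f].

Definition cauchy_data (A : set R) (f0 V : R -> 'rV[R]_3) f : Prop :=
  forall t, A t -> [/\ f (t, - t) = f0 t,
    'D_(1, 0) f (t, - t) = 2^-1 *: ('D_1 f0 t + V t) &
    'D_(0, 1) f (t, - t) = 2^-1 *: (V t - 'D_1 f0 t)].

(* The rows of the unknown stand for [f], [f_x] and [f_y]. *)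
Definition cmc_rhs (H : R) (v : 'M[R]_3) : 'M[R]_3 :=
  stack3 (row 2 v) (H *: lcross (row 1 v) (row 2 v)) (H *: lcross (row 1 v) (row 2 v)).

Lemma Cn_row k (U : normedModType R) m n (D : set U) (u : U -> 'M[R]_(m, n)) i : open D ->
  Cn k D u ->
  Cn k D (fun p => row i (u p)).
Proof.
move=> oD cu; apply/Cn_mxP => // i' j.
have cuij := Cn_entry i j oD cu.
by apply: (eq_Cn oD _ cuij) => p _; rewrite mxE.
Qed.

Lemma Cn_stack3 k (U : normedModType R) (D : set U) (u v w : U -> 'rV[R]_3) : open D ->
  Cn k D u -> Cn k D v -> Cn k D w -> Cn k D (fun p => stack3 (u p) (v p) (w p)).
Proof.
move=> oD cu cv cw; apply/Cn_mxP => // i j; move: i; apply: forall_I3.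
- by apply: (eq_Cn oD (fun p _ => esym (stack30 _ _ _ _))); exact: Cn_entry.
- by apply: (eq_Cn oD (fun p _ => esym (stack31 _ _ _ _))); exact: Cn_entry.
- by apply: (eq_Cn oD (fun p _ => esym (stack32 _ _ _ _))); exact: Cn_entry.
Qed.

Lemma smooth_cmc_rhs (H : R) : smooth [set: 'M[R]_3] (cmc_rhs H).
Proof.
move=> k; have oT := @openT 'M[R]_3; have cr i := Cn_row i oT (@smooth_id R _ setT k).
have cc := CnZl H oT (Cn_lcross oT (cr 1) (cr 2)).
exact: (Cn_stack3 oT (cr 2) cc cc).
Qed.

Lemma null_cmc_near (J : set R) (f0 V : R -> 'rV[R]_3) (H t0 : R) :
  open J -> smooth J f0 -> smooth J V ->
  (forall t, J t -> lprod ('D_1 f0 t) ('D_1 f0 t) < 0) ->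
  (forall t, J t -> lprod (V t) ('D_1 f0 t) = 0) ->
  (forall t, J t -> lprod (V t) (V t) = - lprod ('D_1 f0 t) ('D_1 f0 t)) ->
  J t0 -> exists (d : R) f, [/\ 0 < d, forall t, t0 - d < t < t0 + d -> J t,
    null_cmc H (box (t0 - d) (t0 + d)) f &
    cauchy_data [set t | t0 - d < t < t0 + d] f0 V f].
Proof.
move=> oJ sf0 sV time orth norm Jt0.
pose P0 t := 2^-1 *: ('D_1 f0 t + V t); pose Q0 t := 2^-1 *: (V t - 'D_1 f0 t).
pose u0 t := stack3 (f0 t) (P0 t) (Q0 t).
have sdf0 := smooth_derive (1 : R) sf0.
have su0 : smooth J u0.
  by move=> k; apply: Cn_stack3 => //; [exact: (CnZl _ oJ (CnD oJ (sdf0 k) (sV k)))|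
     exact: (CnZl _ oJ (CnB oJ (sV k) (sdf0 k)))].
pose dir (i j : 'I_3) : bool := i == 2.
have sF := smooth_cmc_rhs H.
have [d [u [d0 dJ sol _]]] := @local_solution R 3 3 dir setT (cmc_rhs H) J u0 t0 openT (sF 1%N)
   oJ Jt0 (fun t Jt => su0 0%N t Jt) I.
set B := box (t0 - d) (t0 + d) in sol; have oB : open B := @box_open R _ _.
have su : smooth B u.
  apply: (solution_smooth (@openT _) sF _ sol) => //.
  by move=> k; apply: Cn_subset (su0 k) => t /dJ.
have [_ du ui] := sol.
pose f q := row 0 (u q); pose P q := row 1 (u q); pose Q q := row 2 (u q).
have sf : smooth B f by move=> k; exact: Cn_row.
have sP : smooth B P by move=> k; exact: Cn_row.
have sQ : smooth B Q by move=> k; exact: Cn_row.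
have uij i : (fun q => row i (u q)) = (fun q => \row_j u q i j).
  by apply/funext => q; apply/rowP => j; rewrite !mxE.
have fy z : B z -> is_derive z (evec false) f (Q z).
  move=> Bz; apply/is_derive_mx => i j; rewrite ord1 (_ : (fun q => f q 0 j) =
    (fun q => u q 0 j)).
    by have := du z 0 j Bz; rewrite stack30.
  by apply/funext => q; rewrite mxE.
have Py z : B z -> is_derive z (evec false) P (H *: lcross (P z) (Q z)).
  move=> Bz; apply/is_derive_mx => i j; rewrite ord1 (_ : (fun q => P q 0 j) =
    (fun q => u q 1 j)).
    by have := du z 1 j Bz; rewrite stack31.
  by apply/funext => q; rewrite mxE.
have Qx z : B z -> is_derive z (evec true) Q (H *: lcross (P z) (Q z)).
  move=> Bz; apply/is_derive_mx => i j; rewrite ord1 (_ : (fun q => Q q 0 j) =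
    (fun q => u q 2 j)).
    by have := du z 2 j Bz; rewrite stack32.
  by apply/funext => q; rewrite mxE.
have fyE z : B z -> 'D_(0, 1) f z = Q z by move=> /fy[].
have diagB (t : R) : t0 - d < t < t0 + d -> B (t, - t) by move=> ?; rewrite /B box_diag.
have fi t : t0 - d < t < t0 + d -> f (t, - t) = f0 t.
  by move=> /diagB/ui uE; apply/rowP => j; rewrite mxE uE stack30.
have Pi t : t0 - d < t < t0 + d -> P (t, - t) = P0 t.
  by move=> /diagB/ui uE; apply/rowP => j; rewrite mxE uE stack31.
have Qi t : t0 - d < t < t0 + d -> Q (t, - t) = Q0 t.
  by move=> /diagB/ui uE; apply/rowP => j; rewrite mxE uE stack32.
have P0Q0 t : P0 t - Q0 t = 'D_1 f0 t.
  by rewrite -scalerBr; apply: rV3P; rewrite !rvE; lra.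
(* Both sides have the derivative [H P x Q] along [y], by symmetry of second derivatives for the
   left one, and they agree on the diagonal. *)
have fxE z : B z -> 'D_(1, 0) f z = P z.
  apply: (@eq_along_mx 1 3 false (t0 - d) (t0 + d) ('D_((1, 0) : R * R) f) P (fun z => H *:
    lcross (P z) (Q z))) => // p.
    move=> Bp; have dd := smooth_is_derive ((0,
      1) : R * R) (smooth_derive ((1, 0) : R * R) sf) Bp.
    apply: is_derive_eq dd _.
    rewrite (derive_mx_commute _ _ oB Bp (sf 2%N)).
    case: (Qx p Bp) => _ <-; apply: near_eq_derive.
    exact: near_box Bp fyE.
  move=> pI; have /= dd := @diag_derive R _ f f0 p (smooth_differentiable sf (diagB p pI)).
  have {}dd : 'D_1 f0 p = 'D_(1, 0) f (p, - p) - Q0 p.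
    rewrite -(Qi p pI) -(fyE _ (diagB p pI)); case: dd => [|//].
    move: (open_nbhs_nbhs (conj (@oo_interval_open R (t0 - d) (t0 + d)) pI)).
    by apply: filterS => s; exact: fi.
  by rewrite Pi// -(subrK (Q0 p) ('D_(1, 0) f (p, - p))) -dd -P0Q0 subrK.
have eqc : cmc_equation H B f.
  move=> z Bz; rewrite fxE// fyE//; case: (Py z Bz) => _ <-.
  by apply: near_eq_derive; exact: near_box Bz fxE.
(* The square lengths vanish by the conditions on [V], and [<P0, Q0> = - <f0', f0'> / 2]. *)
have N0 t : J t -> [/\ lprod (P0 t) (P0 t) = 0, lprod (Q0 t) (Q0 t) = 0 &
  0 < lprod (P0 t) (Q0 t)].
  move=> Jt; have h1 := time t Jt; have h2 := orth t Jt; have h3 := norm t Jt; have h4 :=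
    h2.
  rewrite lprodC in h4; split; rewrite /P0 /Q0 lprodZl lprodZr ?(lprodDl, lprodDr, lprodNl,
    lprodNr) h2 h3 h4; lra.
have PP z : B z -> lprod (P z) (P z) = 0.
  apply: (@eq_along false (t0 - d) (t0 + d) (fun z => lprod (P z) (P z)) (fun=> 0) (fun=>
    0)).
  - move=> p Bp; apply: (is_derive_eq (is_derive_lprod (Py p Bp) (Py p Bp))).
    by rewrite lprodZr lprodZl [lprod (P p) _]lprodC lcross_l mulr0 addr0.
  - by move=> t tI; rewrite Pi//; case: (N0 t (dJ t tI)).
have QQ z : B z -> lprod (Q z) (Q z) = 0.
  apply: (@eq_along true (t0 - d) (t0 + d) (fun z => lprod (Q z) (Q z)) (fun=> 0) (fun=>
    0)).
  - move=> p Bp; apply: (is_derive_eq (is_derive_lprod (Qx p Bp) (Qx p Bp))).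
    by rewrite lprodZr lprodZl [lprod (Q p) _]lprodC lcross_r mulr0 addr0.
  - by move=> t tI; rewrite Qi//; case: (N0 t (dJ t tI)).
have t0I : t0 - d < t0 < t0 + d by rewrite ltrDl ltrBlDr ltrDl d0.
(* Positivity is known on the diagonal only; it extends by continuity to a smaller box. *)
have [e [e0 ed ePQ]] : exists e : R, [/\ 0 < e, e <= d &
  box (t0 - e) (t0 + e) `<=` [set z | 0 < lprod (P z) (Q z)]].
  apply: box_near d0 _.
  have c0 : {for (t0, - t0), continuous (fun z => lprod (P z) (Q z))}.
    exact: (Cn_continuous (Cn_lprod oB (sP 0%N) (sQ 0%N)) (diagB _ t0I)).
  apply: (@cvgr_gt _ _ _ _ _ _ c0) => /=.
  by rewrite Pi// Qi//; case: (N0 t0 Jt0).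
have sub t : t0 - e < t < t0 + e -> t0 - d < t < t0 + d.
  by move=> /andP[h1 h2]; apply/andP; split; lra.
have eB : box (t0 - e) (t0 + e) `<=` B by move=> z [/sub h1 /sub h2].
exists e, f; split=> //.
- by move=> t /sub/dJ.
- split.
  + by move=> k; exact: Cn_subset (sf k).
  + by move=> z ze; have Bz := eB z ze; rewrite fxE// fyE//; split;
    [exact: PP|exact: QQ|exact: ePQ].
  + by move=> z /eB/eqc.
- move=> t /sub tI; split; first exact: fi.
    by rewrite fxE ?Pi//; exact: diagB.
  by rewrite fyE ?Qi//; exact: diagB.
Qed.

End existence.

(** * Gluing of local solutions *)

Section open_domain.
Variable R : realType.
Implicit Types (f g : R * R -> 'rV[R]_3) (D : set (R * R)).

Lemma smooth_local (U V : normedModType R) (D : set U) (f : U -> V) :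
  (forall p, D p -> exists2 E : set U, E p & smooth E f) -> smooth D f.
Proof.
move=> loc k; have {}loc p : D p -> exists2 E : set U, E p & Cn k E f.
  by move=> /loc[E Ep sE]; exists E.
elim: k f loc => [|k IHk] f loc; first by move=> p /loc[E Ep]; exact.
split=> [p /loc[E Ep [df _]]|v]; first exact: df.
by apply: IHk => p /loc[E Ep [_ Df]]; exists E => //; exact: Df.
Qed.

Lemma eq_smooth (U V : normedModType R) (D : set U) (f g : U -> V) :
  open D -> (forall p, D p -> f p = g p) -> smooth D f -> smooth D g.
Proof. by move=> oD fg sf k; exact: eq_Cn fg (sf k). Qed.

Lemma smooth_subset (U V : normedModType R) (D E : set U) (f : U -> V) :
  E `<=` D -> smooth D f -> smooth E f.
Proof. by move=> ED sf k; exact: Cn_subset (sf k). Qed.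

Lemma null_cmc_eq (H : R) D f g : open D -> (forall z, D z -> f z = g z) ->
  null_cmc H D f -> null_cmc H D g.
Proof.
move=> oD fg [sf nf ef]; have Dfg v z : D z -> 'D_v f z = 'D_v g z.
  exact: derive_eq_on.
split; first exact: eq_smooth fg sf.
  by move=> z Dz; rewrite -!Dfg//; exact: nf.
move=> z Dz; rewrite -!Dfg// -(ef z Dz); apply/esym/derive_eq_on; first exact: oD;
  last exact: Dz.
by move=> q Dq; exact: Dfg.
Qed.

Lemma null_cmc_subset (H : R) D E f : E `<=` D -> null_cmc H D f -> null_cmc H E f.
Proof.
move=> ED [sf nf ef]; split; first exact: smooth_subset sf.
  by move=> z /ED/nf.
by move=> z /ED/ef.
Qed.

Lemma null_cmc_local (H : R) D f :
  (forall p, D p -> exists2 E : set (R * R), E p & null_cmc H E f) -> null_cmc H D f.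
Proof.
move=> loc; split.
- by apply: smooth_local => p /loc[E Ep [sE _ _]]; exists E.
- by move=> z /loc[E Ez [_ nE _]]; exact: nE.
- by move=> z /loc[E Ez [_ _ eE]]; exact: eE.
Qed.

Lemma null_cmc_unique (H a b a' b' : R) (f0 V : R -> 'rV[R]_3) f g :
  null_cmc H (box a b) f -> null_cmc H (box a' b') g ->
  cauchy_data [set t | a < t < b] f0 V f -> cauchy_data [set t | a' < t < b'] f0 V g ->
  forall z, box a b z -> box a' b' z -> f z = g z.
Proof.
move=> nf ng df dg z zb zb'; pose A := Num.max a a'; pose B := Num.min b b'.
(* The intersection of two boxes is a box. *)
have AB1 t : A < t < B -> a < t < b by rewrite gt_max lt_min =>
  /andP[/andP[-> _] /andP[-> _]].
have AB2 t : A < t < B -> a' < t < b' by rewrite gt_max lt_min =>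
  /andP[/andP[_ ->] /andP[_ ->]].
have ABI t : a < t < b -> a' < t < b' -> A < t < B.
  by rewrite gt_max lt_min => /andP[-> ->] /andP[-> ->].
have [sf _ ef] : null_cmc H (box A B) f.
  by apply: null_cmc_subset nf => q [/AB1 ? /AB1].
have [sg _ eg] : null_cmc H (box A B) g.
  by apply: null_cmc_subset ng => q [/AB2 ? /AB2].
apply: (cmc_equation_unique sf sg ef eg).
  move=> t tI; have [-> -> ->] := df t (AB1 t tI).
  by have [-> -> ->] := dg t (AB2 t tI).
by case: zb zb' => h1 h2 [h3 h4]; split; exact: ABI.
Qed.

(** [W] is the union of the boxes of local solutions centred on the diagonal. Solutions agree where
    their boxes meet, so the choice made in [f] is immaterial. A box around each point of [W] is
    part of the conclusion because uniqueness is proved box by box. *)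
Lemma null_cmc_exists (J : set R) (f0 V : R -> 'rV[R]_3) (H : R) :
  open J -> smooth J f0 -> smooth J V ->
  (forall t, J t -> lprod ('D_1 f0 t) ('D_1 f0 t) < 0) ->
  (forall t, J t -> lprod (V t) ('D_1 f0 t) = 0) ->
  (forall t, J t -> lprod (V t) (V t) = - lprod ('D_1 f0 t) ('D_1 f0 t)) ->
  exists (W : set (R * R)) f, [/\ open W, W `<=` J `*` [set y | J (- y)],
    forall t, J t -> W (t, - t),
    forall z, W z -> exists a b : R, [/\ box a b z, box a b `<=` W & forall t, a < t < b ->
      J t] &
    null_cmc H W f /\ cauchy_data J f0 V f].
Proof.
move=> oJ sf0 sV time orth norm.
have FP0 t : exists F : R * (R * R -> 'rV[R]_3), J t ->
    [/\ 0 < F.1, forall s, t - F.1 < s < t + F.1 -> J s,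
      null_cmc H (box (t - F.1) (t + F.1)) F.2 &
      cauchy_data [set s | t - F.1 < s < t + F.1] f0 V F.2].
  (* Outside of [J] a dummy value, so that [choice] applies to all [t]. *)
  have [Jt|nJt] := pselect (J t); last by exists (0, fun=> 0).
  have [d [f dfP]] := null_cmc_near H oJ sf0 sV time orth norm Jt.
  by exists (d, f).
have [F FP] := choice FP0.
pose B t := box (t - (F t).1) (t + (F t).1).
have BJ t : J t -> B t `<=` J `*` [set y | J (- y)].
  by move=> /FP[_ Js _ _] z [/Js ? /Js].
pose W := [set z | exists2 t, J t & B t z].
pose f z := (F (xget 0 [set t | J t /\ B t z])).2 z.
have fE t z : J t -> B t z -> f z = (F t).2 z.
  move=> Jt Bz; have [Js Bs] : [set t | J t /\ B t z] (xget 0 [set t | J t /\ B t z]).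
    by apply: xgetPex; exists t.
  have [_ _ n1 c1] := FP _ Js; have [_ _ n2 c2] := FP _ Jt.
  exact: null_cmc_unique n1 n2 c1 c2 z Bs Bz.
have Bt (t : R) : J t -> B t (t, - t).
  by move=> /FP[d0 _ _ _]; rewrite /B box_diag ltrDl ltrBlDr ltrDl d0.
have oB t : open (B t) by exact: box_open.
exists W, f; split.
- rewrite (_ : W = \bigcup_(t in J) B t); last first.
    by apply/seteqP; split=> z [t Jt Bz]; exists t.
  by apply: bigcup_open.
- by move=> z [t Jt /(BJ t Jt)].
- by move=> t Jt; exists t => //; exact: Bt.
- move=> z [t Jt Bz]; exists (t - (F t).1), (t + (F t).1); split=> //.
    by move=> q Bq; exists t.
  by case: (FP t Jt).
- split.
    apply: null_cmc_local => z [t Jt Bz]; exists (B t) => //.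
    by apply: (null_cmc_eq (oB t) _) (let: And4 _ _ n _ := FP t Jt in n) => q Bq;
      rewrite (fE t).
  move=> t Jt; have Btt := Bt t Jt; have [d0 _ _ cd] := FP t Jt.
  have Dfg v : 'D_v f (t, - t) = 'D_v (F t).2 (t, - t).
    by apply: (derive_eq_on v (oB t)) Btt => q; exact: fE.
  rewrite !Dfg (fE t)//; apply: cd => /=.
  by rewrite ltrDl ltrBlDr ltrDl d0.
Qed.

Section open_chart.
Variables (W : set (R * R)) (oW : open W) (k : chart R W).
Hypothesis ak : open_atlas k.

Lemma cimgW : cimg k = W.
Proof.
have [kT kE] := ak; rewrite /cimg kT; apply/seteqP; split=> [_ [s _ <-]|z Wz].
  by rewrite kE; exact: set_valP.
by exists (SigSub (mem_set Wz)); rewrite ?kE.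
Qed.

Lemma open_inclK z : W z -> open_incl oW (cinv k z) = z.
Proof.
rewrite -{1}cimgW => -[s ds <-]; rewrite cfunK//.
by have [_ ->] := ak.
Qed.

Lemma smooth_open_incl (V : normedModType R) (f : R * R -> V) :
  smooth W f -> smooth (cimg k) (f \o open_incl oW \o cinv k).
Proof.
rewrite cimgW; apply: eq_smooth => // p Wp /=.
by rewrite open_inclK.
Qed.

Lemma open_incl_smooth (V : normedModType R) (f : R * R -> V) :
  smooth (cimg k) (f \o open_incl oW \o cinv k) -> smooth W f.
Proof.
rewrite cimgW; apply: eq_smooth => // p Wp /=.
by rewrite open_inclK.
Qed.

Lemma derive_open_incl (V : normedModType R) (f : R * R -> V) v z : W z ->
  'D_v (f \o open_incl oW \o cinv k) z = 'D_v f z.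
Proof. by move=> Wz; apply: derive_eq_on Wz => // q Wq /=; rewrite open_inclK. Qed.

End open_chart.

Lemma isothermal_derive f u v (a : R * R) d :
  is_derive ((u + v, v - u) : R * R) (a.1 + a.2, a.2 - a.1) f d ->
  'D_a (in_isothermal f) (u, v) = d.
Proof.
move=> df.
have : is_derive (((u, v) : R * R) + (0 : R) *: a) a (in_isothermal f) d.
  apply/line_derive.
  have -> : (fun s : R => in_isothermal f ((u, v) + s *: a)) =
      (fun s => f (((u + v, v - u) : R * R) + s *: ((a.1 + a.2, a.2 - a.1) : R * R))).
    by apply/funext => s; congr f; congr pair => /=; rewrite /GRing.scale /=; ring.
  by apply/line_derive; rewrite scale0r addr0.
by rewrite scale0r addr0 => -[].
Qed.

End open_domain.

(** * Solution of the Cauchy problem in the plane *)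

Section change_of_null_coordinates.
Variable R : realType.
Implicit Types (f g N : R * R -> 'rV[R]_3) (D W : set (R * R)).

(* [(a1, b1)] and [(a2, b2)] are the coordinate fields of one null chart in terms
   of those of another one: the hypotheses force [a1 * a2 = b1 * b2 = 0]. *)
Lemma curvature_algebra (a1 b1 a2 b2 L E eps H m1 m2 S : R) :
  eps = 1 \/ eps = -1 -> 0 < L -> 0 < E ->
  2 * (a1 * b1) * L = 0 -> 2 * (a2 * b2) * L = 0 -> (a1 * b2 + a2 * b1) * L = eps * E / 2 ->
  S + (a1 * a2 * m1 + (a1 * b2 + a2 * b1) * (- (H * L)) + b1 * b2 * m2) = 0 ->
  2 * eps * E^-1 * S = H.
Proof.
move=> epsP L0 E0 /eqP + /eqP + ab.
rewrite !mulf_eq0 (gt_eqF L0) !orbF pnatr_eq0 /= => h1 h2.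
have ab0 : a1 * b2 + a2 * b1 != 0.
  apply: contraTneq E0 => e0; move: ab; rewrite e0 mul0r => ab.
  by have : E = 0; [case: epsP ab => ->; lra|move=> ->; rewrite ltxx].
have [aa bb] : a1 * a2 = 0 /\ b1 * b2 = 0.
  case/orP: h1 => /eqP e1; case/orP: h2 => /eqP e2; rewrite e1 e2 ?(mul0r, mulr0) //;
    split=> //;
  by move: ab0; rewrite e1 e2 !(mul0r, mulr0) addr0 eqxx.
rewrite aa bb !mul0r add0r addr0 mulrN => /eqP; rewrite subr_eq0 => /eqP ->.
rewrite (_ : (a1 * b2 + a2 * b1) * (H * L) = H * ((a1 * b2 + a2 * b1) * L)); last by ring.
rewrite ab; case: epsP => ->; field; exact: lt0r_neq0.
Qed.

Lemma lprod_comb0 (a b : R) (X Y Z : 'rV[R]_3) : lprod X Z = 0 -> lprod Y Z = 0 ->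
  lprod (a *: X + b *: Y) Z = 0.
Proof. by move=> XZ YZ; rewrite lprodDl !lprodZl XZ YZ !mulr0 addr0. Qed.

Lemma null_pair_normal (P Q N : 'rV[R]_3) : null_pair P Q ->
  N = (lprod P Q)^-1 *: lcross P Q ->
  [/\ lprod N N = 1, lprod P N = 0, lprod Q N = 0 & lprod (lcross P Q) N = lprod P Q].
Proof.
move=> [PP QQ PQ] ->; have PQ0 := lt0r_neq0 PQ.
rewrite !lprodZr lprodZl lcross_norm PP mul0r subr0.
rewrite [lprod P (lcross _ _)]lprodC [lprod Q (lcross _ _)]lprodC lcross_l lcross_r mulr0.
by split=> //; rewrite -?expr2; field.
Qed.

(** [X] and [Y] are the derivatives of the immersion in one null chart, the two combinations those
    in another one. There [s] is the normal component of the mixed second derivative, known through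
    the derivative of the normal. *)
Lemma curvature_frame (a1 b1 a2 b2 E eps H s : R) (X Y Nx Ny : 'rV[R]_3) :
  eps = 1 \/ eps = -1 -> 0 < E -> null_pair X Y ->
  lprod X Ny = - (H * lprod X Y) -> lprod Y Nx = - (H * lprod X Y) ->
  lprod (a1 *: X + b1 *: Y) (a1 *: X + b1 *: Y) = 0 ->
  lprod (a2 *: X + b2 *: Y) (a2 *: X + b2 *: Y) = 0 ->
  lprod (a1 *: X + b1 *: Y) (a2 *: X + b2 *: Y) = eps * E / 2 ->
  s + lprod (a1 *: X + b1 *: Y) (a2 *: Nx + b2 *: Ny) = 0 ->
  2 * eps * E^-1 * s = H.
Proof.
move=> epsP E0 [XX YY XY] XN YN; rewrite !(lprodDl, lprodDr, lprodZl, lprodZr) XX YY XN YN.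
rewrite [lprod Y X]lprodC => m11 m22 m12 key.
apply: (@curvature_algebra a1 b1 a2 b2 (lprod X Y) E eps H (lprod X Nx) (lprod Y Ny) s) =>
  //.
- by rewrite -m11; ring.
- by rewrite -m22; ring.
- by rewrite -m12; ring.
- by rewrite -[RHS]key; ring.
Qed.

(* As [<f_xy, N> = - <f_x, N_y>], only first derivatives of [phi] are involved. *)
Lemma mean_curvature_comp (H : R) D W f N (phi : R * R -> R * R) eps w z :
  open D -> open W -> smooth D phi -> smooth W f -> smooth W N ->
  (forall q, D q -> W (phi q)) ->
  (forall q, W q -> null_pair ('D_(1, 0) f q) ('D_(0, 1) f q)) ->
  (forall q, W q -> lprod ('D_(1, 0) f q) (N q) = 0 /\ lprod ('D_(0, 1) f q) (N q) = 0) ->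
  (forall q, W q -> lprod ('D_(0, 1) ('D_(1, 0) f) q) (N q) =
      H * lprod ('D_(1, 0) f q) ('D_(0, 1) f q)) ->
  null_metric D (f \o phi) eps w -> D z ->
  mean_curvature (f \o phi) (N \o phi) eps w z = H.
Proof.
move=> oD oW sphi sf sN DW null norm curv [epsP met] Dz.
have dphi q : D q -> differentiable phi q by move=> Dq;
  exact: smooth_differentiable sphi Dq.
have df q : W q -> differentiable f q by move=> Wq; exact: smooth_differentiable sf Wq.
have DG v q : D q -> 'D_v (f \o phi) q =
    ('D_v phi q).1 *: 'D_(1, 0) f (phi q) + ('D_v phi q).2 *: 'D_(0, 1) f (phi q).
  move=> Dq; rewrite derive_comp; [|exact: dphi|exact/df/DW].
  by rewrite deriveRR//; exact/df/DW.
have sG : smooth D (f \o phi).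
  by move=> k; exact: (Cn_comp_mx (frame_RR R) oD oW DW (sphi k) (sf k)).
have sn : smooth D (N \o phi).
  by move=> k; exact: (Cn_comp_mx (frame_RR R) oD oW DW (sphi k) (sN k)).
have Wz := DW z Dz.
have fx := smooth_derive ((1, 0) : R * R) sf; have fy := smooth_derive ((0, 1) : R * R) sf.
have lin0 v w' : (forall q, W q -> lprod ('D_v f q) (N q) = 0) ->
    lprod ('D_v f (phi z)) ('D_w' N (phi z)) = - lprod ('D_w' ('D_v f) (phi z)) (N (phi z)).
  move=> vN; have fv := smooth_derive v sf.
  have := is_derive_lprod (smooth_is_derive w' fv Wz) (smooth_is_derive w' sN Wz).
  have zero : is_derive (phi z) w' (fun q => lprod ('D_v f q) (N q)) 0.
    apply: near_eq_is_derive (is_derive_cst (0 : R) (phi z) w').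
    by move: (open_nbhs_nbhs (conj oW Wz)); apply: filterS => q /vN ->.
  by move=> /(is_derive_unique zero)/esym/eqP; rewrite addrC addr_eq0 => /eqP.
have sGx := smooth_derive ((1, 0) : R * R) sG.
have key : lprod ('D_(0, 1) ('D_(1, 0) (f \o phi)) z) (N (phi z)) +
    lprod ('D_(1, 0) (f \o phi) z) ('D_(0, 1) (N \o phi) z) = 0.
  have := is_derive_lprod (smooth_is_derive ((0, 1) : R * R) sGx Dz)
     (smooth_is_derive ((0, 1) : R * R) sn Dz).
  have zero : is_derive z ((0, 1) : R * R) (fun q =>
    lprod ('D_(1, 0) (f \o phi) q) ((N \o phi) q)) 0.
    apply: near_eq_is_derive (is_derive_cst (0 : R) z ((0, 1) : R * R)).
    move: (open_nbhs_nbhs (conj oD Dz)); apply: filterS => q Dq.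
    have [h1 h2] := norm (phi q) (DW q Dq).
    by rewrite /= (DG _ q Dq) (lprod_comb0 _ _ h1 h2).
  by move=> /(is_derive_unique zero)/esym.
have Dn : 'D_(0, 1) (N \o phi) z =
    ('D_(0, 1) phi z).1 *: 'D_(1, 0) N (phi z) + ('D_(0, 1) phi z).2 *: 'D_(0, 1) N (phi z).
  have dN : differentiable N (phi z) by exact: smooth_differentiable sN Wz.
  by rewrite derive_comp; [rewrite deriveRR|exact: dphi|].
have G1 := DG ((1, 0) : R * R) z Dz; have G2 := DG ((0, 1) : R * R) z Dz.
have m11 : first_form (f \o phi) z (1, 0) (1, 0) = 0 by rewrite met//=
  mulr0 mul0r addr0 mul0r mulr0.
have m22 : first_form (f \o phi) z (0, 1) (0, 1) = 0 by rewrite met//=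
  mulr0 mul0r addr0 mul0r mulr0.
have m12 : first_form (f \o phi) z (1, 0) (0, 1) = eps * expR (w z) / 2.
  by rewrite met//= mulr1 mul0r addr0 mul1r.
rewrite /first_form G1 in m11; rewrite /first_form G2 in m22;
  rewrite /first_form G1 G2 in m12.
rewrite Dn G1 in key.
have nx q : W q -> lprod ('D_(1, 0) f q) (N q) = 0 by move=> /norm[].
have ny q : W q -> lprod ('D_(0, 1) f q) (N q) = 0 by move=> /norm[].
have k1 := lin0 _ ((0, 1) : R * R) nx; have k2 := lin0 _ ((1, 0) : R * R) ny.
rewrite (curv _ Wz) in k1.
rewrite -(derive_mx_commute _ _ oW Wz (sf 2%N)) (curv _ Wz) in k2.
rewrite /mean_curvature expRN.
exact: curvature_frame epsP (expR_gt0 (w z)) (null _ Wz) k1 k2 m11 m22 m12 key.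
Qed.

Lemma smooth_scale (U : normedModType R) (D : set U) (l : U -> R) (v : U ->
  'rV[R]_3) : open D ->
  smooth D l -> smooth D v -> smooth D (fun p => l p *: v p).
Proof.
move=> oD sl sv k; apply/Cn_mxP => // i j; rewrite ord1.
apply: (eq_Cn oD (f := fun p => l p * v p 0 j)); first by move=> p _; rewrite mxE.
by apply: CnM => //; exact: Cn_entry.
Qed.

(** The cross product of [f_x] and [f_y] has square length [<f_x, f_y> ^+ 2] as both are null, so
    normalising it takes no square root. *)
Definition null_normal f : R * R -> 'rV[R]_3 := fun z =>
  (lprod ('D_(1, 0) f z) ('D_(0, 1) f z))^-1 *: lcross ('D_(1, 0) f z) ('D_(0, 1) f z).

Section null_normal.
Variables (H : R) (D : set (R * R)) (f : R * R -> 'rV[R]_3).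
Hypotheses (oD : open D) (nf : null_cmc H D f).

Lemma null_normal_smooth : smooth D (null_normal f).
Proof.
have [sf null _] := nf; have fx := smooth_derive ((1, 0) : R * R) sf; have fy :=
  smooth_derive ((0, 1) : R * R) sf.
apply: (smooth_scale oD) => k; last exact: (Cn_lcross oD (fx k) (fy k)).
apply: (CnV oD _ (Cn_lprod oD (fx k) (fy k))) => z Dz.
by have [_ _ /lt0r_neq0] := null z Dz.
Qed.

Lemma null_normalP z : D z -> [/\ lprod (null_normal f z) (null_normal f z) = 1,
  lprod ('D_(1, 0) f z) (null_normal f z) = 0, lprod ('D_(0, 1) f z) (null_normal f z) = 0 &
  lprod (lcross ('D_(1, 0) f z) ('D_(0, 1) f z)) (null_normal f z) =
    lprod ('D_(1, 0) f z) ('D_(0, 1) f z)].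
Proof.
by have [_ null _] := nf; move=> /null/null_pair_normal; exact.
Qed.

Lemma null_normal_curvature z : D z ->
  lprod ('D_(0, 1) ('D_(1, 0) f) z) (null_normal f z) =
    H * lprod ('D_(1, 0) f z) ('D_(0, 1) f z).
Proof.
have [_ _ ef] := nf; move=> Dz; rewrite (ef z Dz) lprodZl.
by have [_ _ _ ->] := null_normalP Dz.
Qed.

End null_normal.

End change_of_null_coordinates.

Section cauchy_problem.
Variable R : realType.
Implicit Types (f g N : R * R -> 'rV[R]_3) (D W : set (R * R)).

Lemma null_pair_eq0 (P Q : 'rV[R]_3) (a b : R) : null_pair P Q -> a *: P + b *: Q = 0 ->
  a = 0 /\ b = 0.
Proof.
move=> [PP QQ PQ] e; have PQ0 := lt0r_neq0 PQ.
have /eqP := congr1 (fun X => lprod X Q) e; have /eqP := congr1 (lprod P) e.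
rewrite !(lprodDl, lprodDr, lprodZl, lprodZr) lprod0l lprod0r PP QQ !mulr0 addr0 add0r.
by rewrite !mulf_eq0 (negPf PQ0) !orbF => /eqP -> /eqP ->.
Qed.

Lemma null_pair_first_form (P Q : 'rV[R]_3) (a b : R * R) : null_pair P Q ->
  lprod (a.1 *: P + a.2 *: Q) (b.1 *: P + b.2 *: Q) = (a.1 * b.2 + a.2 * b.1) * lprod P Q.
Proof.
move=> [PP QQ PQ]; rewrite !(lprodDl, lprodDr, lprodZl, lprodZr) PP QQ [lprod Q P]lprodC.
ring.
Qed.

(** The mean curvature is tested in every null chart of the maximal atlas; the transition from it to
    the coordinates of [W] is the [phi] of [mean_curvature_comp]. *)
Lemma timelike_cmc_open (H : R) W (oW : open W) f : null_cmc H W f ->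
  timelike_cmc H (f \o open_incl oW) (null_normal f \o open_incl oW).
Proof.
move=> nf; have [sf null _] := nf.
have sN := null_normal_smooth oW nf; have NP := null_normalP nf.
have Df k z a : open_atlas k -> cimg k z ->
    'D_a (f \o open_incl oW \o cinv k) z = a.1 *: 'D_(1, 0) f z + a.2 *: 'D_(0, 1) f z.
  move=> ak; rewrite (cimgW ak) => Wz; rewrite derive_open_incl// deriveRR//.
  exact: smooth_differentiable sf Wz.
split.
- split; first split.
  + by move=> k ak; exact: smooth_open_incl.
  + move=> k z ak kz a; rewrite (Df k z a ak kz); rewrite (cimgW ak) in kz.
    by move=> /(null_pair_eq0 (null z kz)); case: a => a1 a2 /= [-> ->].
  + move=> k z ak kz; have kz' := kz; rewrite (cimgW ak) in kz'.
    have ff a b : first_form (f \o open_incl oW \o cinv k) z a b =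
        (a.1 * b.2 + a.2 * b.1) * lprod ('D_(1, 0) f z) ('D_(0, 1) f z).
      by rewrite /first_form (Df k z a ak kz) (Df k z b ak kz) null_pair_first_form//;
        exact: null.
    have [_ _ XY] := null z kz'.
    (* The coordinate vectors of [u] and [v]. *)
    exists (1, -1), (1, 1); rewrite !ff /=; move: XY; move: (lprod _ _) => L L0.
    by split; lra.
- split.
  + by move=> k ak; exact: smooth_open_incl.
  + by move=> p; have [] := NP (open_incl oW p) (set_valP p).
  + move=> k z a ak kz; rewrite (Df k z a ak kz) /=; rewrite (cimgW ak) in kz.
    have [_ h1 h2 _] := NP z kz; rewrite (open_inclK oW ak kz).
    exact: (lprod_comb0 _ _ h1 h2).
- move=> k eps w [ck met] z kz.
  have oD : open (cimg k) by exact: cimg_open.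
  have [l al _] := cover_W oW (cinv k z); have [lT lE] := al.
  have sphi : smooth (cimg k) (open_incl oW \o cinv k).
    have [skl _] := ck l al; rewrite lT setIT in skl.
    by apply: (eq_smooth oD _ skl) => q _; rewrite /= lE.
  apply: (mean_curvature_comp oD oW sphi sf sN _ null _ _ met kz).
  + by move=> q _; exact: set_valP.
  + by move=> q /NP[_ h1 h2 _].
  + by move=> q; exact: null_normal_curvature.
Qed.

Lemma cauchy_data_diag (J : set R) (f0 V : R -> 'rV[R]_3) f t : cauchy_data J f0 V f ->
  J t ->
  'D_(1, 0) f (t, - t) - 'D_(0, 1) f (t, - t) = 'D_1 f0 t /\
  'D_(1, 0) f (t, - t) + 'D_(0, 1) f (t, - t) = V t.
Proof.
move=> cf /cf[_ -> ->]; split; apply: rV3P; rewrite !rvE; lra.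
Qed.

Lemma in_isothermal_derive W f u v (a : R * R) : smooth W f -> W (u + v, v - u) ->
  'D_a (in_isothermal f) (u, v) =
  (a.1 + a.2) *: 'D_(1, 0) f (u + v, v - u) + (a.2 - a.1) *: 'D_(0, 1) f (u + v, v - u).
Proof.
move=> sf Wuv; have df := smooth_differentiable sf Wuv.
have D := smooth_is_derive ((a.1 + a.2, a.2 - a.1) : R * R) sf Wuv.
by rewrite (isothermal_derive D) (deriveRR _ df).
Qed.

Lemma null_metric_ln D f : smooth D f ->
  (forall z, D z -> null_pair ('D_(1, 0) f z) ('D_(0, 1) f z)) ->
  null_metric D f 1 (fun z => ln (2 * lprod ('D_(1, 0) f z) ('D_(0, 1) f z))).
Proof.
move=> sf null; split; first by left.
move=> z a b Dz; have [_ _ XY] := null z Dz.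
have dz := smooth_differentiable sf Dz; rewrite /first_form (deriveRR a dz) (deriveRR b dz).
rewrite (null_pair_first_form _ _ (null z Dz)) lnK; last by rewrite posrE mulr_gt0.
by move: (lprod _ _) => L; field.
Qed.

Lemma cmc_with_cauchy_data_exists (J : set R) (f0 V : R ->
  'rV[R]_3) (H : R) W (oW : open W) f :
  (forall t, J t -> W (t, - t)) -> null_cmc H W f -> cauchy_data J f0 V f ->
  cmc_with_cauchy_data J f0 V H oW f.
Proof.
move=> WJ nf cf; have [sf null _] := nf.
split.
- by eexists; eexists; exact: null_metric_ln sf null.
- exists (null_normal f); first exact: timelike_cmc_open.
  move=> u v Wuv; apply/positively_orientedE; rewrite !(in_isothermal_derive _ sf Wuv) /=.
  have [_ _ XY] := null _ Wuv; have [_ _ _ E] := null_normalP nf Wuv.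
  move: E XY; move: ('D_(1, 0) f _) ('D_(0, 1) f _) (null_normal f _) => P Q N <-.
  rewrite !(addr0, add0r, subr0, sub0r) => PQN.
  (* As [f_u = f_x - f_y] and [f_v = f_x + f_y], their cross product is twice that of [f_x] and
     [f_y]. *)
  have -> : lprod (lcross (1 *: P + -1 *: Q) (1 *: P + 1 *: Q)) N =
    2 * lprod (lcross P Q) N.
    by rewrite /lprod !lcrossE !rvE; ring.
  by rewrite mulr_gt0.
- by move=> u Ju; have [e _ _] := cf u Ju; rewrite /in_isothermal /= addr0 sub0r.
- move=> u Ju; have Wu : W (u + 0, 0 - u) by rewrite addr0 sub0r; exact: WJ.
  rewrite (in_isothermal_derive _ sf Wu).
  have [_ <-] := cauchy_data_diag cf Ju; rewrite addr0 sub0r.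
  by congr (_ + _); [rewrite add0r scale1r|rewrite subr0 scale1r].
Qed.

Lemma mean_curvature_open_incl W (oW : open W) (k : chart R W) f N eps w z : open_atlas k ->
  W z ->
  mean_curvature (f \o open_incl oW \o cinv k) (N \o open_incl oW \o cinv k) eps w z =
  mean_curvature f N eps w z.
Proof.
move=> ak Wz; have E2 : (N \o open_incl oW \o cinv k) z = N z.
  by rewrite -[RHS](congr1 N (open_inclK oW ak Wz)).
have E1 : 'D_(0, 1) ('D_(1, 0) (f \o open_incl oW \o cinv k)) z = 'D_(0, 1) ('D_(1, 0) f) z.
  apply: (derive_eq_on _ oW _ Wz) => q Wq; exact: (derive_open_incl oW ak f _ Wq).
by rewrite /mean_curvature E1 E2.
Qed.

Lemma half_comb (P Q : 'rV[R]_3) :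
  P = 2^-1 *: ((P - Q) + (P + Q)) /\ Q = 2^-1 *: ((P + Q) - (P - Q)).
Proof. by split; apply: rV3P; rewrite !rvE; field. Qed.

(** The sign [eps] is 1 because [V 0], the derivative along [v], is spacelike. Then the curvature
    and orientation conditions, read in an atlas chart, give the equation, and the two initial
    conditions determine [f_x] and [f_y] on the diagonal. *)
Lemma cmc_with_cauchy_data_null (J : set R) (f0 V : R ->
  'rV[R]_3) (H : R) W (oW : open W) g :
  open J -> J 0 -> 0 < lprod (V 0) (V 0) ->
  (forall t, J t -> W (t, - t)) ->
  cmc_with_cauchy_data J f0 V H oW g -> null_cmc H W g /\ cauchy_data J f0 V g.
Proof.
move=> oJ J0 V0 WJ [[eps [w met]] [N tc orient] gi gV].
have [l al _] := cover_W oW (SigSub (mem_set (WJ 0 J0))).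
have [[[sgl _] _] [sNl NN Ng] cmc] := tc.
have sg : smooth W g by exact: (@open_incl_smooth R W oW l al _ g (sgl l al)).
have sN : smooth W N by exact: (@open_incl_smooth R W oW l al _ N (sNl l al)).
have gV' u : J u -> 'D_(1, 0) g (u, - u) + 'D_(0, 1) g (u, - u) = V u.
  move=> Ju; rewrite -gV//.
  rewrite (@in_isothermal_derive W g u 0 (0, 1)) ?addr0 ?sub0r//; last exact: WJ.
  by congr (_ + _); [rewrite add0r scale1r|rewrite subr0 scale1r].
have ff : first_form g (0, - 0) (1, 1) (1, 1) = lprod (V 0) (V 0).
  rewrite /first_form (deriveRR _ (smooth_differentiable sg (WJ 0 J0))).
  by rewrite (_ : _ + _ = V 0)// -(gV' 0 J0); congr (_ + _); exact: scale1r.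
have [epsP m] := met.
have eps1 : eps = 1.
  have := m (0, - 0) (1, 1) (1, 1) (WJ 0 J0); rewrite ff => e.
  move: epsP => [//|epsN]; move: V0; rewrite e epsN /=; have := expR_gt0 (w (0, - 0)).
  by move: (expR _) => E E0; rewrite mulr1; lra.
have null z : W z -> null_pair ('D_(1, 0) g z) ('D_(0, 1) g z).
  move=> Wz; have m11 : first_form g z (1, 0) (1, 0) = 0.
    by rewrite (m _ _ _ Wz) /= mulr0 mul0r addr0 mul0r mulr0.
  have m22 : first_form g z (0, 1) (0, 1) = 0.
    by rewrite (m _ _ _ Wz) /= mulr0 mul0r addr0 mul0r mulr0.
  have m12 : 0 < first_form g z (1, 0) (0, 1).
    by rewrite (m _ _ _ Wz) /= eps1 mulr1 mul0r addr0 mul1r mulr_gt0 ?expR_gt0// divr_gt0.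
  exact: And3 m11 m22 m12.
have cl : @coordinates R (open_surface oW) l by move=> k ak; exact: compatible_W.
have lW := cimgW al.
have Ngz z a : W z -> lprod ('D_a g z) (N z) = 0.
  move=> Wz; have := Ng l z a al; rewrite lW => /(_ Wz).
  by rewrite derive_open_incl//= open_inclK.
have curv z : W z -> lprod ('D_(0, 1) ('D_(1, 0) g) z) (N z) =
    H * lprod ('D_(1, 0) g z) ('D_(0, 1) g z).
  move=> Wz; have ml : null_metric (cimg l) (g \o open_incl oW \o cinv l) eps w.
    split; first by left.
    move=> q a b; rewrite lW => Wq; rewrite -(m q a b Wq) /first_form.
    by rewrite !derive_open_incl.
  have := cmc l eps w (conj cl ml) z; rewrite lW => /(_ Wz).
  have -> : mean_curvature (g \o open_incl oW \o cinv l) (N \o open_incl oW \o cinv l) eps w z =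
      2 * eps * expR (- w z) * lprod ('D_(0, 1) ('D_(1, 0) g) z) (N z).
    exact: mean_curvature_open_incl.
  have m12 := m z (1, 0) (0, 1) Wz; rewrite /first_form in m12; rewrite m12 eps1 expRN.
  have := expR_gt0 (w z); move: (expR _) (lprod _ _) => E s /= E0 <-.
  by field; exact: lt0r_neq0.
have ori z : W z -> 0 < lprod (lcross ('D_(1, 0) g z) ('D_(0, 1) g z)) (N z).
  case: z => x y Wz; pose u : R := (x - y) / 2; pose v : R := (x + y) / 2.
  have E : (u + v, v - u) = (x, y) by congr pair; rewrite /u /v; field.
  have Wuv : W (u + v, v - u) by rewrite E.
  have /positively_orientedE := orient u v Wuv.
  rewrite !(in_isothermal_derive _ sg Wuv) E /= !(addr0, add0r, subr0, sub0r).
  move: ('D_(1, 0) g _) ('D_(0, 1) g _) (N _) => P Q n.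
  have -> : lprod (lcross (1 *: P + -1 *: Q) (1 *: P + 1 *: Q)) n =
    2 * lprod (lcross P Q) n.
    by rewrite /lprod !lcrossE !rvE; ring.
  by rewrite pmulr_rgt0.
have NNz z : W z -> lprod (N z) (N z) = 1.
  by move=> Wz; have := NN (cinv l z); rewrite /= open_inclK.
split; first split=> //.
- apply: (cmc_equation_null oW sg null _ curv) => z Wz.
  by split; [exact: NNz|exact: Ngz|exact: Ngz|exact: ori].
- move=> t Jt; have gt s : J s -> g (s, - s) = f0 s.
    by move=> Js; rewrite -gi// /in_isothermal /= addr0 sub0r.
  have dd : 'D_1 f0 t = 'D_(1, 0) g (t, - t) - 'D_(0, 1) g (t, - t).
    have := @diag_derive R _ g f0 t (smooth_differentiable sg (WJ t Jt)).
    case=> [|//]; move: (open_nbhs_nbhs (conj oJ Jt)); exact: filterS.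
  by rewrite dd -(gV' t Jt); split; [exact: gt|exact: (half_comb _ _).1|exact: (half_comb _ _).2].
Qed.

Lemma diag_comb (a b : R) (P Q : 'rV[R]_3) :
  a *: (P - Q) + b *: (P + Q) = (a + b) *: P + (b - a) *: Q.
Proof. by apply: rV3P; rewrite !rvE; ring. Qed.

Lemma diag_combE (a b : R) (P Q : 'rV[R]_3) :
  a *: P + b *: Q = ((a - b) / 2) *: (P - Q) + ((a + b) / 2) *: (P + Q).
Proof. by apply: rV3P; rewrite !rvE; field. Qed.

Lemma open_cauchy_solution (J : set R) (f0 V : R -> 'rV[R]_3) (H : R) W (oW : open W) f :
  open J -> J 0 -> (forall t, J t -> W (t, - t)) -> null_cmc H W f ->
    cauchy_data J f0 V f ->
  exists2 c : R -> open_surface oW,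
    (forall t, J t -> open_incl oW (c t) = (t, - t)) &
    geometric_cauchy_solution J f0 V H (f \o open_incl oW) c.
Proof.
move=> oJ J0 WJ nf cf; have [sf null _] := nf.
have [l al _] := cover_W oW (SigSub (mem_set (WJ 0 J0))).
pose c t : open_surface oW := cinv l (t, - t).
have cE t : J t -> open_incl oW (c t) = (t, - t) by move=> Jt; apply: open_inclK => //;
  exact: WJ.
have sdiag : smooth J (fun s : R => (s, - s)).
  by move=> k; apply/Cn_pairP => //; split;
    [exact: smooth_id|apply: CnN => //; exact: smooth_id].
have Df t a k : J t -> open_atlas k -> 'D_a (f \o open_incl oW \o cinv k) (cfun k (c t)) =
    a.1 *: 'D_(1, 0) f (t, - t) + a.2 *: 'D_(0, 1) f (t, - t).
  move=> Jt ak; have [_ kE] := ak; rewrite kE -[set_val _]/(open_incl oW _) cE//.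
  rewrite (derive_open_incl oW ak _ _ (WJ t Jt)).
  by rewrite (deriveRR a (smooth_differentiable sf (WJ t Jt))).
exists c => //; split.
- split.
    move=> t Jt; apply: (@continuous_comp _ _ _ (fun s : R => (s, - s)) (cinv l));
      first exact: smooth_continuous sdiag Jt.
    by apply: cinv_continuous; rewrite -/(cimg l) (cimgW al); exact: WJ.
  move=> k ak; have [kT kE] := ak; rewrite kT preimage_setT setIT.
  by apply: (eq_smooth oJ _ sdiag) => t Jt /=; rewrite kE -[RHS]/(open_incl oW _) cE.
- by move=> t Jt; rewrite /= cE//; have [] := cf t Jt.
- move=> t Jt; have [d1 d2] := cauchy_data_diag cf Jt.
  rewrite derive1E -d1 -d2; apply/seteqP; split=> X.
    move=> [k [ak _] [a ->]]; exists ((a.1 - a.2) / 2), ((a.1 + a.2) / 2).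
    by rewrite (Df t a k Jt ak); exact: diag_combE.
  move=> [a [b ->]]; exists l; first by have [-> _] := al.
  by exists (a + b, b - a); rewrite (Df t _ l Jt al); exact: diag_comb.
- exists (null_normal f \o open_incl oW); first exact: timelike_cmc_open.
  move=> t Jt; have [d1 d2] := cauchy_data_diag cf Jt.
  apply/positively_orientedE; rewrite derive1E -d1 -d2 /= cE//.
  have [_ _ XY] := null _ (WJ t Jt); have [_ _ _ E] := null_normalP nf (WJ t Jt).
  move: E XY; move: ('D_(1, 0) f _) ('D_(0, 1) f _) (null_normal f _) => P Q N <- PQN.
  have -> : lprod (lcross (P - Q) (P + Q)) N = 2 * lprod (lcross P Q) N.
    by rewrite /lprod !lcrossE !rvE; ring.
  by rewrite mulr_gt0.
Qed.

End cauchy_problem.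

(** * Null coordinates along a curve in a surface *)

Section straightening.
Variable R : realType.

Lemma pair_split (x y : R) (p : R * R) : (x, y) = p -> x = p.1 /\ y = p.2.
Proof. by move=> <-. Qed.

Lemma derive_fst (p v : R * R) : 'D_v (@fst R R) p = v.1.
Proof.
have [_ <-] // : is_derive p v (@fst R R) v.1.
have -> : p = p + (0 : R) *: v by rewrite scale0r addr0.
apply/line_derive; have -> : (fun t : R => (p + t *: v).1) = (fun t => p.1 + t * v.1) by [].
have := is_deriveD (is_derive_cst p.1 (0 : R) (1 : R)) (is_deriveZ v.1 (is_derive_id (0 : R) (1 : R))).
rewrite add0r [_ *: 1]mulr1; congr is_derive.
by apply/funext => t; rewrite /= mulrC.
Qed.

Lemma derive_snd (p v : R * R) : 'D_v (@snd R R) p = v.2.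
Proof.
have [_ <-] // : is_derive p v (@snd R R) v.2.
have -> : p = p + (0 : R) *: v by rewrite scale0r addr0.
apply/line_derive; have -> : (fun t : R => (p + t *: v).2) = (fun t => p.2 + t * v.2) by [].
have := is_deriveD (is_derive_cst p.2 (0 : R) (1 : R)) (is_deriveZ v.2 (is_derive_id (0 : R) (1 : R))).
rewrite add0r [_ *: 1]mulr1; congr is_derive.
by apply/funext => t; rewrite /= mulrC.
Qed.

Lemma smooth_fst (D : set (R * R)) : open D -> smooth D (@fst R R).
Proof. by move=> oD k; have [] := (Cn_pairP k (@id (R * R)) oD).1 (@smooth_id _ _ D k). Qed.

Lemma smooth_snd (D : set (R * R)) : open D -> smooth D (@snd R R).
Proof. by move=> oD k; have [] := (Cn_pairP k (@id (R * R)) oD).1 (@smooth_id _ _ D k). Qed.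

Lemma smooth_pair (U : normedModType R) (D : set U) (f g : U -> R) : open D ->
  smooth D f -> smooth D g -> smooth D (fun p => (f p, g p)).
Proof. by move=> oD sf sg k; apply/Cn_pairP. Qed.

Lemma smooth_pairP (U : normedModType R) (D : set U) (f : U -> R * R) : open D ->
  smooth D f -> smooth D (fun p => (f p).1) /\ smooth D (fun p => (f p).2).
Proof. by move=> oD sf; split=> k; have [] := (Cn_pairP k f oD).1 (sf k). Qed.

Lemma derive_pair (U : normedModType R) (f : U -> R * R) p v : differentiable f p ->
  'D_v f p = ('D_v (fun q => (f q).1) p, 'D_v (fun q => (f q).2) p).
Proof.
move=> df; have oT := @openT (R * R)%type.
have d1 := smooth_differentiable (smooth_fst oT) (I : setT (f p)).
have d2 := smooth_differentiable (smooth_snd oT) (I : setT (f p)).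
have e1 := derive_comp v df d1; have e2 := derive_comp v df d2.
rewrite derive_fst in e1; rewrite derive_snd in e2.
by rewrite [LHS]surjective_pairing -e1 -e2.
Qed.

Lemma open_preimage (T : topologicalType) (U : set T) (V : topologicalType) (f : T ->
  V) (B : set V) :
  open U -> open B -> (forall p, U p -> {for p, continuous f}) -> open (U `&` f @^-1` B).
Proof.
move=> oU oB cf; rewrite openE => p [Up Bp]; apply: filterI;
  first exact: (open_nbhs_nbhs (conj oU Up)).
by apply: cf => //; exact: (open_nbhs_nbhs (conj oB Bp)).
Qed.

(** The plane as a space of matrices, the form in which [local_solution] takes its unknown. *)
Let pr (v : 'rV[R]_2) : R * R := (v 0 0, v 0 1).
Let mk (p : R * R) : 'rV[R]_2 := \row_j (if j == 0 then p.1 else p.2).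

Let mkK p : pr (mk p) = p. Proof. by rewrite /pr !mxE; case: p. Qed.

Let smooth_pr (D : set 'rV[R]_2) : open D -> smooth D pr.
Proof. by move=> oD; apply: smooth_pair => // k; apply: Cn_entry => //;
  exact: smooth_id. Qed.

Let smooth_mk (U : normedModType R) (D : set U) (f : U -> R * R) : open D -> smooth D f ->
  smooth D (fun p => mk (f p)).
Proof.
move=> oD /(smooth_pairP oD)[s1 s2] k; apply/Cn_mxP => // i j.
case: (eqVneq j 0) => [->|j0]; [apply: eq_Cn (s1 k)|apply: eq_Cn (s2 k)] => // p _.
  by rewrite mxE.
by rewrite mxE (negPf j0).
Qed.

(* With [Z_y = X(Z)] and [Z (t, - t) = g t], [xi] is the first component of the
   inverse of [Z]. *)
Lemma straighten (D : set (R * R)) (X : R * R -> R * R) (A : set R) (g : R ->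
  R * R) (t0 : R) :
  open D -> smooth D X -> open A -> smooth A g -> (forall t, A t -> D (g t)) -> A t0 ->
  ('D_1 g t0).1 * (X (g t0)).2 - ('D_1 g t0).2 * (X (g t0)).1 != 0 ->
  exists (E : set (R * R)) (xi : R * R -> R) (e : R),
    [/\ open E, smooth E xi, forall z, E z -> D z /\ 'D_(X z) xi z = 0, 0 < e &
        forall t, t0 - e < t < t0 + e -> [/\ A t, E (g t) & xi (g t) = t]].
Proof.
move=> oD sX oA sg AD At0 det0.
have oT := @openT 'rV[R]_2.
pose O : set 'rV[R]_2 := pr @^-1` D.
have oO : open O.
  rewrite (_ : O = setT `&` pr @^-1` D); last by rewrite setTI.
  apply: open_preimage => // p _; exact: (smooth_continuous (smooth_pr oT)).
have sF : smooth O (fun v => mk (X (pr v))).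
  by apply: smooth_mk => // k; apply: (Cn_comp_pair (frame_RR R) oO oD _ (smooth_pr oO k) (sX k)).
have su0 : smooth A (fun t => mk (g t)) by exact: smooth_mk.
have Ou0 t : A t -> O (mk (g t)) by move=> /AD; rewrite /O /preimage /= mkK.
pose dir (i : 'I_1) (j : 'I_2) := false.
have [d [u [d0 dA sol Ou]]] := @local_solution R 1 2 dir O (fun v => mk (X (pr v))) A
  (fun t => mk (g t)) t0 oO (sF 1%N) oA At0 (fun t At => su0 0%N t At) (Ou0 t0 At0).
set B := box (t0 - d) (t0 + d) in sol Ou; have oB : open B := @box_open R _ _.
have su : smooth B u.
  apply: (solution_smooth oO sF _ sol) => //.
  by move=> k; apply: Cn_subset (su0 k) => t /dA.
have [_ du ui] := sol.
pose Z z := pr (u z); pose Z1 z := (Z z).1; pose Z2 z := (Z z).2.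
have sZ1 : smooth B Z1 by move=> k; exact: Cn_entry.
have sZ2 : smooth B Z2 by move=> k; exact: Cn_entry.
have sZ : smooth B Z by exact: smooth_pair.
have Zy z : B z -> 'D_(0, 1) Z z = X (Z z).
  move=> Bz; rewrite derive_pair; last exact: smooth_differentiable sZ Bz.
  have [_ e1] := du z 0 0 Bz; have [_ e2] := du z 0 1 Bz.
  by rewrite [RHS]surjective_pairing; congr pair; [rewrite [LHS]e1|rewrite [LHS]e2];
    rewrite mxE.
have diagB t : t0 - d < t < t0 + d -> B (t, - t) by move=> ?; rewrite /B box_diag.
have Zi t : t0 - d < t < t0 + d -> Z (t, - t) = g t by move=> /diagB/ui uE;
  rewrite /Z uE mkK.
have t0I : t0 - d < t0 < t0 + d by rewrite ltrDl ltrBlDr ltrDl d0.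
have Bz0 := diagB t0 t0I; set z0 := (t0, - t0) in Bz0.
have dZ := smooth_differentiable sZ Bz0.
have near0 : \forall s \near t0, Z (s, - s) = g s.
  move: (open_nbhs_nbhs (conj (@oo_interval_open R (t0 - d) (t0 + d)) t0I)).
  by apply: filterS => s; exact: Zi.
have [_ gZ] := @diag_derive R _ Z g t0 dZ near0.
(* [Z (t, - t) = g t] differentiates to [Z_x - Z_y = g']; hence the Jacobian of [Z] at [z0] is the
   determinant of [g'] and [X], nonzero by transversality. *)
have Zx : 'D_(1, 0) Z z0 = 'D_1 g t0 + X (g t0).
  by rewrite gZ -(Zi t0 t0I) -(Zy _ Bz0) subrK.
have J0 : jac Z1 Z2 z0 != 0.
  have := Zx; have := Zy _ Bz0; rewrite !(derive_pair _ dZ) [Z z0](Zi t0 t0I) => e2 e1.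
  have [x1 x2] : 'D_(1, 0) Z1 z0 = ('D_1 g t0).1 + (X (g t0)).1 /\
      'D_(1, 0) Z2 z0 = ('D_1 g t0).2 + (X (g t0)).2.
    exact: pair_split e1.
  have [y1 y2] : 'D_(0, 1) Z1 z0 = (X (g t0)).1 /\ 'D_(0, 1) Z2 z0 = (X (g t0)).2.
    exact: pair_split e2.
  rewrite /jac x1 x2 y1 y2; move: det0; congr (_ != 0).
  by move: ('D_1 g t0) (X (g t0)) => T x; ring.
have [r [zeta [r0 rB oI zetaK szeta]]] := inverse_function oB sZ1 sZ2 Bz0 J0.
have szeta1 := (smooth_pairP oI szeta).1.
pose e := Num.min r d.
exists (Z @` ball z0 r), (fun w => (zeta w).1), e; split=> //.
- move=> _ [q qr <-]; have [Bq _] := rB q qr; split; first exact: (Ou q Bq).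
  have dZq := smooth_differentiable sZ Bq.
  have dx : differentiable (fun w => (zeta w).1) (Z q).
    by apply: smooth_differentiable szeta1 _; exists q.
  (* As [X] is [Z_y], differentiating the first component of [zeta] along it amounts to
     differentiating [x] along [y]. *)
  rewrite -(Zy q Bq) -(derive_comp _ dZq dx).
  rewrite (@derive_eq_on R _ _ (ball z0 r) _ (@fst R R)) ?derive_fst//;
    first exact: ball_open.
  by move=> p pr0; rewrite /= (zetaK p pr0).
- by rewrite lt_min r0.
- have er : e <= r by rewrite ge_min lexx.
  have ed : e <= d by rewrite ge_min lexx orbT.
  move=> t /andP[h1 h2].
  have td : t0 - d < t < t0 + d by move: h1 h2 er ed; move: e => e' h1 h2 er ed; apply/andP;
    split; lra.
  have tr : ball z0 r (t, - t).
    have h4 : `|t0 - t| < r.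
      by move: h1 h2 er ed; move: e => e' h1 h2 er ed; rewrite ltr_norml; apply/andP; split;
        lra.
    split; rewrite /ball //=.
    by rewrite (_ : - t0 - - t = - (t0 - t)) ?normrN//; ring.
  split; first exact: dA.
    by exists (t, - t) => //; exact: Zi.
  by rewrite -(Zi t td) (zetaK _ tr).
Qed.

End straightening.

(** * Null vectors of a timelike plane *)

Section null_fields.
Variable R : realType.
Implicit Types P Q N C tau : 'rV[R]_3.

Lemma cross_normal P Q N : lprod N N = 1 -> lprod P N = 0 -> lprod Q N = 0 ->
  lcross P Q = lprod (lcross P Q) N *: N.
Proof.
move=> NN PN QN; have := lprod_dual P Q N N.
by rewrite NN [lprod N P]lprodC [lprod N Q]lprodC PN QN !scale0r !add0r scale1r => ->.
Qed.

Lemma null_field_push (l s a b : R) P Q : let tau := a *: P + b *: Q in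
  (l * a + s * lprod tau Q) *: P + (l * b - s * lprod tau P) *: Q =
  l *: tau + s *: lcross (lcross P Q) tau.
Proof.
move=> tau; rewrite lcrossK [lprod Q tau]lprodC [lprod P tau]lprodC.
by rewrite /tau; apply: rV3P; rewrite !rvE; ring.
Qed.

(** By [lcross_norm], [lcross C tau] has square length [- l ^+ 2 * lprod tau tau], opposite to that
    of [l *: tau], and the two vectors are orthogonal; so their sum and difference are null. *)
Lemma null_field_null C tau (l s : R) : lprod C C = l ^+ 2 -> lprod C tau = 0 ->
  s ^+ 2 = 1 ->
  lprod (l *: tau + s *: lcross C tau) (l *: tau + s *: lcross C tau) = 0.
Proof.
move=> CC Ct ss; have e := lcross_norm C tau; rewrite CC Ct expr0n /= sub0r in e.
rewrite !(lprodDl, lprodDr, lprodZl, lprodZr) e [lprod tau (lcross _ _)]lprodC lcross_r.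
rewrite !mulr0 addr0 add0r mulrA -expr2 mulrA -expr2 ss; ring.
Qed.

Lemma null_field_prod C tau (l : R) : lprod C C = l ^+ 2 -> lprod C tau = 0 ->
  lprod (l *: tau + 1 *: lcross C tau) (l *: tau + -1 *: lcross C tau) = 2 * l ^+
    2 * lprod tau tau.
Proof.
move=> CC Ct; have e := lcross_norm C tau; rewrite CC Ct expr0n /= sub0r in e.
rewrite !(lprodDl, lprodDr, lprodZl, lprodZr) e [lprod tau (lcross _ _)]lprodC lcross_r.
ring.
Qed.

Lemma lcrossZl (k : R) P Q : lcross (k *: P) Q = k *: lcross P Q.
Proof. by apply: rV3P; rewrite !(lcrossE, rvE); ring. Qed.

Lemma lcrossZr (k : R) P Q : lcross P (k *: Q) = k *: lcross P Q.
Proof. by apply: rV3P; rewrite !(lcrossE, rvE); ring. Qed.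

Lemma lcross_antidiag P Q (l : R) :
  lcross (l *: P + 1 *: Q) (l *: P + -1 *: Q) = (2 * l) *: lcross Q P.
Proof. by apply: rV3P; rewrite !(lcrossE, rvE); ring. Qed.

Lemma null_field_cross C tau N (l : R) : C = l *: N -> lprod N N = 1 -> lprod C tau = 0 ->
  lprod (lcross (l *: tau + 1 *: lcross C tau) (l *: tau + -1 *: lcross C tau)) N =
  2 * l ^+ 2 * lprod tau tau.
Proof.
move=> CN NN Ct; rewrite lcross_antidiag lprodZl lcrossK Ct scale0r subr0 lprodZl CN lprodZl NN.
ring.
Qed.

(** If [lcross P Q] vanished, the triple product would make [tau] orthogonal to [P] and [Q], hence
    to itself. *)
Lemma null_field_nondegenerate (a b : R) P Q :
  (forall x y : R, x *: P + y *: Q = 0 -> x = 0 /\ y = 0) ->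
  lprod (a *: P + b *: Q) (a *: P + b *: Q) < 0 -> lcross P Q != 0.
Proof.
set tau := a *: P + b *: Q => inj neg; apply/eqP => C0.
have [e1 /eqP] : lprod tau Q = 0 /\ - lprod tau P = 0.
  apply: inj; rewrite scaleNr [lprod tau Q]lprodC [lprod tau P]lprodC -lcrossK C0.
  by apply: rV3P; rewrite !(lcrossE, rvE); ring.
rewrite oppr_eq0 => /eqP e2.
by move: neg; rewrite {2}/tau lprodDr !lprodZr e1 e2 !mulr0 addr0 ltxx.
Qed.

(** The determinant of the coefficient vectors of [tau] and of its null field. It is nonzero for
    timelike [tau], which is the transversality that [straighten] asks for. *)
Lemma field_det (t1 t2 l s : R) P Q tau : tau = t1 *: P + t2 *: Q ->
  t1 * (l * t2 - s * lprod tau P) - t2 * (l * t1 + s * lprod tau Q) = - s * lprod tau tau.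
Proof.
move=> e; have -> : lprod tau tau = t1 * lprod tau P + t2 * lprod tau Q.
  by rewrite {2}e lprodDr !lprodZr.
ring.
Qed.

End null_fields.

Section derivations.
Variable R : realType.

Lemma derive_comb (g : R * R -> R) p (k : R) u v : differentiable g p ->
  'D_(k *: u - v) g p = k * 'D_u g p - 'D_v g p.
Proof. by move=> dg; rewrite !deriveE// linearB linearZ. Qed.

(** Multiplicativity of determinants: the Jacobian matrix applied to the two null fields is
    diagonal, with entries [2 l] and [- 2 l]. *)
Lemma jac_neq0 (l a1 a2 b1 b2 x1 x2 y1 y2 : R) : l != 0 ->
  x1 * a1 + x2 * a2 = 2 * l -> y1 * a1 + y2 * a2 = 0 ->
  x1 * b1 + x2 * b2 = 0 -> y1 * b1 + y2 * b2 = - (2 * l) -> a1 * b2 - b1 * a2 != 0.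
Proof.
move=> l0 h1 h2 h3 h4; have : (a1 * b2 - b1 * a2) * (x1 * y2 - x2 * y1) = - (2 * l) ^+ 2.
  transitivity ((x1 * a1 + x2 * a2) * (y1 * b1 + y2 * b2) - (y1 * a1 + y2 * a2) * (x1 * b1 +
    x2 * b2)); first by ring.
  by rewrite h1 h2 h3 h4; ring.
move=> e; apply: contra_eq_neq e => ->; rewrite mul0r eq_sym oppr_eq0 sqrf_eq0 mulf_neq0//.
Qed.

Lemma null_scaled (k : R) (P V : 'rV[R]_3) : k *: P = V -> V != 0 -> lprod V V = 0 ->
  lprod P P = 0.
Proof.
move=> <-; case: (eqVneq k 0) => [->|k0 _]; first by rewrite scale0r eqxx.
by rewrite lprodZl lprodZr => /eqP; rewrite !mulf_eq0 (negPf k0) /= => /eqP.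
Qed.

Lemma antidiag_pos (l m x : R) : l != 0 -> m < 0 ->
  - (2 * l) * (2 * l * x) = 2 * l ^+ 2 * m -> 0 < x.
Proof.
move=> l0 m0 e; have l2 : 0 < l ^+ 2 by rewrite exprn_even_gt0.
have : l ^+ 2 * (2 * x + m) = 0 by lra.
by move=> /eqP; rewrite mulf_eq0 (gt_eqF l2) /= => /eqP; lra.
Qed.

Lemma antidiag_prod (l m : R) (P Q U V : 'rV[R]_3) : l != 0 -> m < 0 ->
  (2 * l) *: P = U -> - (2 * l) *: Q = V -> lprod U V = 2 * l ^+ 2 * m -> 0 < lprod P Q.
Proof. by move=> l0 m0 <- <- E; apply: (antidiag_pos l0 m0); rewrite -E lprodZl lprodZr;
  ring. Qed.

Lemma antidiag_cross (l m : R) (P Q U V N : 'rV[R]_3) : l != 0 -> m < 0 ->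
  (2 * l) *: P = U -> - (2 * l) *: Q = V -> lprod (lcross U V) N = 2 * l ^+ 2 * m ->
  0 < lprod (lcross P Q) N.
Proof.
move=> l0 m0 <- <- E; apply: (antidiag_pos l0 m0); rewrite -E lcrossZl lcrossZr !lprodZl;
  ring.
Qed.

Lemma near_interval (t0 : R) (P : set R) : nbhs t0 P ->
  exists2 e : R, 0 < e & forall t, t0 - e < t < t0 + e -> P t.
Proof.
move=> /nbhs_ballP[e /= e0 eP]; exists e => // t /andP[h1 h2]; apply: eP.
by rewrite /ball /= ltr_norml; apply/andP; split; lra.
Qed.

Lemma interval_shrink (t0 d e t : R) : d <= e -> t0 - d < t < t0 + d -> t0 - e < t < t0 + e.
Proof. by move=> de /andP[h1 h2]; apply/andP; split; lra. Qed.

End derivations.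

Section null_coordinates.
Variable R : realType.
Variables (F n : R * R -> 'rV[R]_3) (D : set (R * R)).
Hypotheses (oD : open D) (sF : smooth D F) (sn : smooth D n).
Hypothesis nn : forall z, D z -> lprod (n z) (n z) = 1.
Hypothesis Fn : forall z a, D z -> lprod ('D_a F z) (n z) = 0.
Hypothesis Finj : forall z a, D z -> 'D_a F z = 0 -> a = 0.

Let lam z := lprod (lcross ('D_(1, 0) F z) ('D_(0, 1) F z)) (n z).

(* The multiple [lam z *: (tau + s *: lcross n tau)] of a null vector, where
   [tau = 'D_T F z], written in the basis of the coordinate fields. *)
Definition null_field (T : R * R) (s : R) (z : R * R) : R * R :=
  (lam z * T.1 + s * lprod ('D_T F z) ('D_(0, 1) F z),
   lam z * T.2 - s * lprod ('D_T F z) ('D_(1, 0) F z)).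

Let C z := lcross ('D_(1, 0) F z) ('D_(0, 1) F z).

Let DF z (a : R * R) : D z -> 'D_a F z = a.1 *: 'D_(1, 0) F z + a.2 *: 'D_(0, 1) F z.
Proof. by move=> Dz; apply: deriveRR; exact: smooth_differentiable sF Dz. Qed.

Let CE z : D z -> C z = lam z *: n z.
Proof. by move=> Dz; apply: cross_normal; [exact: nn|exact: Fn|exact: Fn]. Qed.

Let CC z : D z -> lprod (C z) (C z) = lam z ^+ 2.
Proof. by move=> Dz; rewrite CE// lprodZl lprodZr nn// mulr1. Qed.

Let Ct z T : D z -> lprod (C z) ('D_T F z) = 0.
Proof. by move=> Dz; rewrite CE// lprodZl lprodC Fn// mulr0. Qed.

Lemma null_fieldE z T s : D z ->
  'D_(null_field T s z) F z = lam z *: 'D_T F z + s *: lcross (C z) ('D_T F z).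
Proof.
move=> Dz; rewrite (DF (null_field T s z) Dz) /null_field /=.
by have e := DF T Dz; rewrite e; exact: null_field_push.
Qed.

Lemma null_field_lam z T : D z -> lprod ('D_T F z) ('D_T F z) < 0 -> lam z != 0.
Proof.
move=> Dz neg; apply/eqP => l0; have := CE Dz; rewrite l0 scale0r.
apply/eqP; apply: (@null_field_nondegenerate _ T.1 T.2); last by rewrite -DF.
move=> x y e; have := Finj (a := (x, y)) Dz; rewrite DF// => /(_ e) /eqP.
by rewrite xpair_eqE => /andP[/eqP -> /eqP ->].
Qed.

Lemma null_field_det z T s : D z -> T.1 * (null_field T s z).2 - T.2 * (null_field T s z).1 =
  - s * lprod ('D_T F z) ('D_T F z).
Proof.
by move=> Dz; exact: field_det (DF T Dz).
Qed.

Lemma smooth_null_field T s : smooth D (null_field T s).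
Proof.
have s1 := smooth_derive ((1, 0) : R * R) sF; have s2 := smooth_derive ((0, 1) : R * R) sF.
have sT := smooth_derive T sF.
have sl k : Cn k D lam := Cn_lprod oD (Cn_lcross oD (s1 k) (s2 k)) (sn k).
have c x k : Cn k D (fun=> x : R) by exact: Cn_cst.
apply: smooth_pair => // k.
  apply: (CnD oD (CnM oD (sl k) (c T.1 k)) (CnM oD (c s k) (Cn_lprod oD (sT k) (s2 k)))).
exact: (CnB oD (CnM oD (sl k) (c T.2 k)) (CnM oD (c s k) (Cn_lprod oD (sT k) (s1 k)))).
Qed.

(* The two components of [psi] are constant along the two families of null lines. *)
Lemma null_coordinates_near (A : set R) (g : R -> R * R) (t0 : R) :
  open A -> smooth A g -> (forall t, A t -> D (g t)) -> A t0 ->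
  lprod ('D_('D_1 g t0) F (g t0)) ('D_('D_1 g t0) F (g t0)) < 0 ->
  exists (G : set (R * R)) (psi zeta : R * R -> R * R) (d0 : R),
    [/\ open G, G `<=` D, smooth G psi, 0 < d0 &
     [/\ smooth (box (t0 - d0) (t0 + d0)) zeta,
         forall z, box (t0 - d0) (t0 + d0) z -> G (zeta z) /\ psi (zeta z) = z,
         forall w, G w -> zeta (psi w) = w,
         forall t, t0 - d0 < t < t0 + d0 -> [/\ A t, G (g t) & psi (g t) = (t, - t)] &
         forall z, box (t0 - d0) (t0 + d0) z ->
           null_pair ('D_(1, 0) (F \o zeta) z) ('D_(0, 1) (F \o zeta) z) /\
           0 < lprod (lcross ('D_(1, 0) (F \o zeta) z) ('D_(0,
             1) (F \o zeta) z)) (n (zeta z))]].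
Proof.
move=> oA sg AD At0; set T := 'D_1 g t0; set w0 := g t0 => neg.
have Dw0 : D w0 := AD _ At0.
have sT := smooth_derive T sF.
have stt : smooth D (fun z => lprod ('D_T F z) ('D_T F z)) by move=> k; exact: Cn_lprod.
(* [T] is the velocity frozen at [t0]. Its null fields are defined on all of [D], and nonzero where
   ['D_T F] is timelike. *)
pose D' := D `&` [set z | lprod ('D_T F z) ('D_T F z) < 0].
have oD' : open D'.
  by apply: (open_preimage oD (@open_lt R 0)) => p Dp; exact: smooth_continuous stt Dp.
have D'D : D' `<=` D by move=> z [].
pose A' := A `&` g @^-1` D'.
have oA' : open A' by apply: open_preimage => // t At; exact: smooth_continuous sg At.
have sg' : smooth A' g by apply: smooth_subset sg => t [].
have A'D t : A' t -> D' (g t) by case.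
have A't0 : A' t0 by [].
have sX s : smooth D' (null_field T s) by apply: smooth_subset D'D _;
  exact: smooth_null_field.
have tt0 : lprod ('D_T F w0) ('D_T F w0) != 0 by rewrite lt_eqF.
have [|E1 [xi1 [e1 [oE1 sxi1 E1P e10 cur1]]]] :=
  @straighten R D' (null_field T (-1)) A' g t0 oD' (sX _) oA' sg' A'D A't0.
  by rewrite null_field_det// opprK mul1r.
have [|E2 [xi2 [e2 [oE2 sxi2 E2P e20 cur2]]]] :=
  @straighten R D' (null_field T 1) A' g t0 oD' (sX _) oA' sg' A'D A't0.
  by rewrite null_field_det// mulN1r oppr_eq0.
pose E := E1 `&` E2; have oE : open E by exact: openI.
(* The sign sends the curve to the line [y = - x]. *)
pose psi1 := xi1; pose psi2 z := - xi2 z.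
have s1 : smooth E psi1 by apply: smooth_subset sxi1 => z [].
have s2 : smooth E psi2 by move=> k; apply: CnN => //; apply: Cn_subset (sxi2 k) => z [].
have l0 := null_field_lam Dw0 neg.
have ts e : 0 < e -> t0 - e < t0 < t0 + e by move=> h; rewrite ltrDl ltrBlDr ltrDl h.
have Ew0 : E w0 by split; [case: (cur1 t0 (ts _ e10))|case: (cur2 t0 (ts _ e20))].
pose X := null_field T 1 w0; pose Y := null_field T (-1) w0.
have XY : X = (2 * lam w0) *: T - Y.
  rewrite [LHS]surjective_pairing [RHS]surjective_pairing; congr pair;
    rewrite /X /Y /null_field /=.
    by rewrite /GRing.scale /=; move: (lam w0) (lprod _ _) T.1 => *; ring.
  by rewrite /GRing.scale /=; move: (lam w0) (lprod _ _) T.2 => *; ring.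
(* [xi (g t) = t] fixes the derivative along [T]. As [X + Y = (2 * lam w0) *: T] and each function
   is annihilated by one of the two fields, its derivative along the other one follows. *)
have along (xi : R * R -> R) (Ex : set (R * R)) e : open Ex -> smooth Ex xi -> 0 < e ->
    (forall t, t0 - e < t < t0 + e -> [/\ A' t, Ex (g t) & xi (g t) = t]) -> 'D_T xi w0 = 1.
  move=> oEx sxi e0 cur; have [_ Ewx _] := cur t0 (ts e e0).
  rewrite -(derive_comp _ (smooth_differentiable sg At0) (smooth_differentiable sxi Ewx)).
  rewrite -[RHS](@derive_id R R t0 1); apply: near_eq_derive.
  move: (open_nbhs_nbhs (conj (@oo_interval_open R (t0 - e) (t0 + e)) (ts e e0))).
  by apply: filterS => t /cur[].
have T1 := along _ _ _ oE1 sxi1 e10 cur1; have T2 := along _ _ _ oE2 sxi2 e20 cur2.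
have d1 := smooth_differentiable s1 Ew0; have d2 := smooth_differentiable s2 Ew0.
have [E1w E2w] := Ew0.
have psi2D v z : E z -> 'D_v psi2 z = - 'D_v xi2 z.
  move=> [_ E2z]; rewrite deriveN//; apply: diff_derivable;
    exact: smooth_differentiable sxi2 E2z.
have Y1 : 'D_Y psi1 w0 = 0 by have [] := E1P w0 E1w.
have X2 : 'D_X psi2 w0 = 0 by rewrite psi2D//; have [_ ->] := E2P w0 E2w; rewrite oppr0.
have X1 : 'D_X psi1 w0 = 2 * lam w0 by rewrite XY (derive_comb _ _ _ d1) [X in X - _](congr1 ( *%R _) T1) mulr1 Y1 subr0.
have YX : Y = (2 * lam w0) *: T - X by rewrite XY opprB addrC subrK.
have Y2 : 'D_Y psi2 w0 = - (2 * lam w0).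
  by rewrite YX (derive_comb _ _ _ d2) X2 subr0 psi2D// T2 mulrN1.
have J0 : jac psi1 psi2 w0 != 0.
  move: X1 Y1 X2 Y2; rewrite (derive_RR X d1) (derive_RR Y d1) (derive_RR X d2) (derive_RR Y d2).
  by move=> h1 h2 h3 h4; exact: jac_neq0 l0 h1 h2 h3 h4.
have [r [zeta [r0 rE oQ zetaK szeta]]] := inverse_function oE s1 s2 Ew0 J0.
pose psi z := (psi1 z, psi2 z); set G := ball w0 r in rE oQ zetaK szeta.
rewrite -/psi in zetaK; set Q := _ @` G in oQ szeta.
have oG : open G by exact: ball_open.
have GE w : G w -> E w by move=> /rE[].
have GD' w : G w -> D' w by move=> /GE[/E1P[]].
have GD w : G w -> D w by move=> /GD'[].
have Qz z : Q z -> G (zeta z) /\ psi (zeta z) = z by move=> [w Gw <-];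
  rewrite -/(psi w) (zetaK w Gw).
pose K := F \o zeta.
have sK : smooth Q K.
  by move=> k; apply: (Cn_comp_mx (frame_RR R) oQ oD _ (szeta k) (sF k)) => z /Qz[/GD].
have spsi : smooth G psi.
  by apply: smooth_pair => //; [apply: smooth_subset s1|apply: smooth_subset s2].
(* The chain rule for [F = K \o psi]. A field annihilating one component of [psi] is thus mapped by
   the differential of [F] to a multiple of a single partial derivative of [K], which is therefore
   null. *)
have push w v : G w -> ('D_v psi1 w) *: 'D_(1, 0) K (psi w) + ('D_v psi2 w) *:
  'D_(0, 1) K (psi w) = 'D_v F w.
  move=> Gw; have Qw : Q (psi w) by exists w.
  have dpsi := smooth_differentiable spsi Gw; have dK := smooth_differentiable sK Qw.
  have := derive_comp v dpsi dK; rewrite (derive_pair _ dpsi) (deriveRR _ dK) /= => <-.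
  by apply: (derive_eq_on v oG _ Gw) => q Gq; exact: (congr1 F (zetaK q Gq)).
have psi0 : psi w0 = (t0, - t0).
  by rewrite /psi /psi1 /psi2; have [_ _ ->] := cur1 t0 (ts _ e10); have [_ _ ->] :=
    cur2 t0 (ts _ e20).
have Gw0 : G w0 by exact: ballxx.
have null s w : s ^+ 2 = 1 -> G w -> 'D_(null_field T s w) F w != 0 /\
    lprod ('D_(null_field T s w) F w) ('D_(null_field T s w) F w) = 0.
  move=> ss Gw; have Dw := GD w Gw; split; last first.
    by rewrite null_fieldE//; apply: null_field_null => //; [exact: CC|exact: Ct].
  apply/eqP => /(Finj Dw) e; have := null_field_det T s Dw;
    rewrite e /= !mulr0 subrr => /esym/eqP.
  have [_ neg'] := GD' w Gw; rewrite mulf_eq0 oppr_eq0 (lt_eqF neg') orbF => /eqP s0.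
  by move: ss; rewrite s0 expr0n /= => /esym/eqP; rewrite oner_eq0.
have Kx w : G w -> ('D_(null_field T 1 w) psi1 w) *: 'D_(1, 0) K (psi w) =
  'D_(null_field T 1 w) F w.
  move=> Gw; rewrite -(push w (null_field T 1 w) Gw) (psi2D _ _ (GE w Gw)).
  by have [_ E2w'] := GE w Gw; have [_ ->] := E2P w E2w'; rewrite oppr0 scale0r addr0.
have Ky w : G w -> ('D_(null_field T (-1) w) psi2 w) *: 'D_(0, 1) K (psi w) =
  'D_(null_field T (-1) w) F w.
  move=> Gw; rewrite -(push w (null_field T (-1) w) Gw).
  by have [E1w' _] := GE w Gw; have [_ ->] := E1P w E1w'; rewrite scale0r add0r.
have nullK z : Q z -> lprod ('D_(1, 0) K z) ('D_(1, 0) K z) = 0 /\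
  lprod ('D_(0, 1) K z) ('D_(0, 1) K z) = 0.
  move=> /Qz[Gw]; move: (zeta z) Gw => w Gw <-.
  have [n1 n2] := null 1 w (expr1n _ _) Gw; have [n3 n4] :=
    null (-1) w (etrans (sqrrN 1) (expr1n _ _)) Gw.
  by split; [exact: null_scaled (Kx w Gw) n1 n2|exact: null_scaled (Ky w Gw) n3 n4].
have Kx0 := Kx w0 Gw0; have Ky0 := Ky w0 Gw0.
rewrite -/X X1 in Kx0; rewrite -/Y Y2 in Ky0; rewrite psi0 in Kx0 Ky0.
have XF := null_fieldE T 1 Dw0; have YF := null_fieldE T (-1) Dw0.
(* At [t0] the factors are [2 lam] and [- 2 lam], so the sign of [lam] cancels both here and in the
   orientation; continuity extends the two inequalities to a box. *)
have pos0 : 0 < lprod ('D_(1, 0) K (t0, - t0)) ('D_(0, 1) K (t0, - t0)).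
  apply: (antidiag_prod l0 neg Kx0 Ky0); rewrite XF YF.
  by apply: null_field_prod; [exact: CC|exact: Ct].
have cross0 : 0 < lprod (lcross ('D_(1, 0) K (t0, - t0)) ('D_(0, 1) K (t0,
  - t0))) (n (zeta (t0, - t0))).
  have -> : zeta (t0, - t0) = w0 by rewrite -psi0; exact: zetaK.
  apply: (antidiag_cross l0 neg Kx0 Ky0); rewrite XF YF.
  by apply: null_field_cross; [exact: CE|exact: nn|exact: Ct].
have Qz0 : Q (t0, - t0) by exists w0.
have sKx := smooth_derive ((1, 0) : R * R) sK; have sKy :=
  smooth_derive ((0, 1) : R * R) sK.
have snz : smooth Q (n \o zeta).
  by move=> k; apply: (Cn_comp_mx (frame_RR R) oQ oD _ (szeta k) (sn k)) => z /Qz[/GD].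
have c1 := Cn_continuous (Cn_lprod oQ (sKx 0%N) (sKy 0%N)) Qz0.
have c2 := Cn_continuous (Cn_lprod oQ (Cn_lcross oQ (sKx 0%N) (sKy 0%N)) (snz 0%N)) Qz0.
have [e3 /= e30 e3G] : exists2 e : R, 0 < e & forall t, t0 - e < t < t0 + e -> G (g t).
  have : nbhs t0 (g @^-1` G).
    by apply: (smooth_continuous sg At0); exact: (open_nbhs_nbhs (conj oG Gw0)).
  exact: near_interval.
have [d [d0 dE dP]] : exists d : R, [/\ 0 < d, d <= Num.min (Num.min e1 e2) e3 &
    box (t0 - d) (t0 + d) `<=` [set z | Q z /\
      0 < lprod ('D_(1, 0) K z) ('D_(0, 1) K z) /\
      0 < lprod (lcross ('D_(1, 0) K z) ('D_(0, 1) K z)) ((n \o zeta) z)]].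
  apply: box_near; first by rewrite !lt_min e10 e20.
  apply: filterI; first exact: (open_nbhs_nbhs (conj oQ Qz0)).
  apply: filterI; first exact: (@cvgr_gt _ _ _ _ _ _ c1).
  exact: (@cvgr_gt _ _ _ _ _ _ c2).
have [de1 [de2 de3]] : d <= e1 /\ d <= e2 /\ d <= e3.
  by move: dE; rewrite !le_min => /andP[/andP[-> ->] ->].
have tI (e t : R) : d <= e -> t0 - d < t < t0 + d -> t0 - e < t < t0 + e.
  exact: interval_shrink.
exists G, psi, zeta, d; split; [exact: oG|exact: GD|exact: spsi|exact: d0|split].
- by apply: smooth_subset szeta => z /dP[].
- by move=> z /dP[/Qz].
- exact: zetaK.
- move=> t td; have [[At _] _ x1] := cur1 t (tI _ _ de1 td); have [_ _ x2] :=
  cur2 t (tI _ _ de2 td).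
  by split; [exact: At|exact: e3G (tI _ _ de3 td)|rewrite /psi /psi1 /psi2 x1 x2].
- move=> z /dP[Qzz [p1 p2]]; have [n1 n2] := nullK z Qzz.
  exact: (conj (And3 n1 n2 p1) p2).
Qed.


End null_coordinates.

(** * Charts of an abstract surface *)

Section charts.
Variable R : realType.

Lemma smooth_comp_pair (U : normedModType R) (D : set U) (E : set (R * R)) (f : U -> R * R)
    (g : R * R -> R * R) : open D -> open E -> (forall p, D p -> E (f p)) ->
  smooth D f -> smooth E g -> smooth D (g \o f).
Proof. by move=> oD oE DE sf sg k; exact: (Cn_comp_pair (frame_RR R) oD oE DE (sf k) (sg k)). Qed.

Lemma smooth_comp_mx (U : normedModType R) m n (D : set U) (E : set (R * R)) (f : U ->
  R * R)
    (g : R * R -> 'M[R]_(m, n)) : open D -> open E -> (forall p, D p -> E (f p)) ->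
  smooth D f -> smooth E g -> smooth D (g \o f).
Proof. by move=> oD oE DE sf sg k; exact: (Cn_comp_mx (frame_RR R) oD oE DE (sf k) (sg k)). Qed.

Lemma cinvK (T : topologicalType) (k : chart R T) z : cimg k z ->
  cdom k (cinv k z) /\ cfun k (cinv k z) = z.
Proof. by move=> [p dp <-]; rewrite cfunK. Qed.

Lemma chart_image_open (T : topologicalType) (k : chart R T) (U : set T) : open U ->
  open (cfun k @` (cdom k `&` U)).
Proof.
move=> oU; have -> : cfun k @` (cdom k `&` U) = cimg k `&` cinv k @^-1` U.
  apply/seteqP; split=> [_ [p [dp Up] <-]|z [[p dp <-]]].
    by split; [exists p|rewrite /preimage /= cfunK].
  by rewrite /preimage /= cfunK// => Up; exists p.
by apply: open_preimage => //; [exact: cimg_open|exact: cinv_continuous].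
Qed.

(** The domain is cut down to the part that is mapped into [B], so that the image is exactly [B];
    compatibility with a chart of the atlas factors through [l]. *)
Lemma compose_chart (M : surface R) (l : chart R M) (G B : set (R * R)) (psi zeta : R * R ->
  R * R) :
  atlas l -> open G -> G `<=` cimg l -> smooth G psi -> open B -> smooth B zeta ->
  (forall z, B z -> G (zeta z) /\ psi (zeta z) = z) ->
    (forall w, G w -> zeta (psi w) = w) ->
  exists k : chart R M, [/\ coordinates k, cimg k = B,
    cdom k = cdom l `&` cfun l @^-1` (G `&` psi @^-1` B),
    cfun k = psi \o cfun l & cinv k = cinv l \o zeta].
Proof.
move=> al oG Gl spsi oB szeta GB zetaK.
pose dom := cdom l `&` cfun l @^-1` (G `&` psi @^-1` B).
have oGB : open (G `&` psi @^-1` B).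
  by apply: open_preimage => // p Gp; exact: smooth_continuous spsi Gp.
have odom : open dom.
  by apply: open_preimage => //; [exact: cdom_open|exact: cfun_continuous].
have imgE : (psi \o cfun l) @` dom = B.
  apply/seteqP; split=> [_ [p [_ [_ Bp]] <-]//|z Bz].
  have [Gz psiz] := GB z Bz; have [dz fz] := cinvK (Gl _ Gz).
  by exists (cinv l (zeta z)); [split=> //;
    rewrite /preimage /= fz psiz|rewrite /= fz psiz].
have oimg : open ((psi \o cfun l) @` dom) by rewrite imgE.
have K p : dom p -> (cinv l \o zeta) ((psi \o cfun l) p) = p.
  by move=> [dp [Gp _]]; rewrite /= zetaK// cfunK.
have cf p : dom p -> {for p, continuous (psi \o cfun l)}.
  move=> [dp [Gp _]]; apply: (@continuous_comp _ _ _ (cfun l) psi);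
    first exact: cfun_continuous.
  exact: smooth_continuous spsi Gp.
have ci z : ((psi \o cfun l) @` dom) z -> {for z, continuous (cinv l \o zeta)}.
  rewrite imgE => Bz; apply: (@continuous_comp _ _ _ zeta (cinv l)).
    exact: smooth_continuous szeta Bz.
  by apply: cinv_continuous; apply: Gl; have [] := GB z Bz.
exists (Chart odom oimg K cf ci); split=> //.
move=> m am; have [s1 s2] := atlas_compatible al am.
set k := Chart odom oimg K cf ci.
have ok := chart_image_open (k := k) (cdom_open m).
have ol := chart_image_open (k := l) (cdom_open m).
have ok' : open (cfun m @` (cdom k `&` cdom m)) by rewrite setIC; apply: chart_image_open;
  exact: cdom_open.
have ol' : open (cfun m @` (cdom l `&` cdom m)) by rewrite setIC; apply: chart_image_open;
  exact: cdom_open.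
split.
- apply: (smooth_comp_pair ok ol _ _ s1 (f := zeta)).
    move=> _ [p [[dp [Gp _]] mp] <-]; exists p => //.
    by rewrite /= zetaK.
  apply: smooth_subset szeta => _ [p [kp _] <-].
  by rewrite -imgE; exists p.
- apply: (smooth_comp_pair ok' oG _ _ spsi (f := cfun l \o cinv m)).
    by move=> _ [p [[dp [Gp _]] mp] <-]; rewrite /= cfunK.
  apply: smooth_subset s2 => _ [p [[dp _] mp] <-].
  by exists p.
Qed.

End charts.

(** * Null charts along the initial curve of a solution *)

Section null_chart.
Variable R : realType.
Implicit Types (f N : R * R -> 'rV[R]_3) (D : set (R * R)).

(** [V] is tangent and orthogonal to [P - Q], so it is a multiple of [P + Q]; its length makes the
    factor 1 or -1, and the orientation selects 1. Thus tangent plane and orientation recover the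
    transverse derivative along the curve. *)
Lemma tangent_normal (P Q N V : 'rV[R]_3) : null_pair P Q ->
  lprod N N = 1 -> lprod P N = 0 -> lprod Q N = 0 -> 0 < lprod (lcross P Q) N ->
  lprod V N = 0 -> lprod V (P - Q) = 0 -> lprod V V = - lprod (P - Q) (P - Q) ->
  0 < lprod (lcross (P - Q) V) N -> V = P + Q.
Proof.
move=> [PP QQ PQ] NN PN QN PQN VN VT VV TVN.
have L0 := lt0r_neq0 PQ; pose a := lprod V P / lprod P Q.
have VQ : lprod V Q = lprod V P.
  by move: VT; rewrite lprodDr lprodNr => /eqP; rewrite subr_eq0 => /eqP.
have VE : V = a *: (P + Q).
  apply/eqP; rewrite -subr_eq0; apply/eqP.
  rewrite (@normal_component R P Q N (V - a *: (P + Q)) NN PN QN (lt0r_neq0 PQN)).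
  - by rewrite lprodDl lprodNl lprodZl lprodDl VN PN QN addr0 mulr0 subr0 scale0r.
  - rewrite lprodDl lprodNl lprodZl lprodDl PP add0r [lprod Q P]lprodC /a divfK//.
    by rewrite subrr.
  - by rewrite lprodDl lprodNl lprodZl lprodDl QQ addr0 /a divfK// VQ subrr.
have a0 : 0 < a.
  move: TVN; rewrite VE (_ : lcross (P - Q) (a *: (P + Q)) = (2 * a) *: lcross P Q).
    by rewrite lprodZl pmulr_lgt0// pmulr_rgt0.
  by apply: rV3P; rewrite !(lcrossE, rvE); ring.
have a2 : a ^+ 2 = 1.
  have e1 : lprod V V = 2 * a ^+ 2 * lprod P Q.
    by rewrite VE lprodZl lprodZr lprodDl !lprodDr PP QQ [lprod Q P]lprodC; ring.
  have e2 : lprod (P - Q) (P - Q) = - 2 * lprod P Q.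
    by rewrite lprodDl !lprodDr lprodNl lprodNr lprodNr lprodNl PP QQ [lprod Q P]lprodC;
      ring.
  by apply: (mulIf L0); move: VV; rewrite e1 e2; lra.
have a1 : a = 1.
  by apply/eqP; rewrite -(@eqrXn2 _ 2)// ?ltW// expr1n a2.
by rewrite VE a1 scale1r.
Qed.

Lemma mean_curvature_ln (H : R) f N z : 0 < lprod ('D_(1, 0) f z) ('D_(0, 1) f z) ->
  mean_curvature f N 1 (fun z => ln (2 * lprod ('D_(1, 0) f z) ('D_(0, 1) f z))) z = H ->
  lprod ('D_(0, 1) ('D_(1, 0) f) z) (N z) = H * lprod ('D_(1, 0) f z) ('D_(0, 1) f z).
Proof.
move=> L0 <-; rewrite /mean_curvature expRN lnK; last by rewrite posrE mulr_gt0.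
move: L0; move: (lprod ('D_(1, 0) f z) _) (lprod _ (N z)) => L s L0.
by field; exact: lt0r_neq0.
Qed.

Lemma box_shrink (t0 d e : R) z : d <= e -> box (t0 - d) (t0 + d) z ->
  box (t0 - e) (t0 + e) z.
Proof. by move=> de [h1 h2]; split; exact: interval_shrink de _. Qed.

(** Every [d] up to [d0] is allowed, so that charts of two solutions can be given the same image.
    Here the geometric conditions turn into Cauchy data, with [tangent_normal] identifying [V]. *)
Lemma null_chart (J : set R) (f0 V : R -> 'rV[R]_3) (H : R) (M : surface R) (f : M ->
  'rV[R]_3)
    (c : R -> M) (t0 : R) :
  open J -> (forall t, J t -> lprod ('D_1 f0 t) ('D_1 f0 t) < 0) ->
  (forall t, J t -> lprod (V t) ('D_1 f0 t) = 0) ->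
  (forall t, J t -> lprod (V t) (V t) = - lprod ('D_1 f0 t) ('D_1 f0 t)) ->
  geometric_cauchy_solution J f0 V H f c -> J t0 ->
  exists2 d0 : R, 0 < d0 & forall d, 0 < d -> d <= d0 -> exists k : chart R M,
    [/\ coordinates k, cimg k = box (t0 - d) (t0 + d),
        forall t, t0 - d < t < t0 + d -> cdom k (c t) /\ cfun k (c t) = (t, - t),
        null_cmc H (box (t0 - d) (t0 + d)) (f \o cinv k) &
        cauchy_data [set t | t0 - d < t < t0 + d] f0 V (f \o cinv k)].
Proof.
move=> oJ time orth norm [[cc sc] fc tp [N [[[sfM inj] tl] [sNM NN Nf] cmc] ori]] Jt0.
have [l al lt0] := @atlas_cover R M (c t0).
pose D := cimg l; have oD : open D by exact: cimg_open.
pose F := f \o cinv l; pose n := N \o cinv l; pose g := cfun l \o c.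
have sF : smooth D F := sfM l al; have sn : smooth D n := sNM l al.
pose A := J `&` c @^-1` cdom l.
have oA : open A by apply: open_preimage => //; exact: cdom_open.
have sg : smooth A g := sc l al.
have AD t : A t -> D (g t) by move=> [_ lt]; exists (c t).
have At0 : A t0 by [].
have Fg t : A t -> F (g t) = f0 t by move=> [Jt lt]; rewrite /F /g /= cfunK// fc.
have dFg : 'D_('D_1 g t0) F (g t0) = 'D_1 f0 t0.
  rewrite -(derive_comp _ (smooth_differentiable sg At0) (smooth_differentiable sF (AD _ At0))).
  by apply: (@derive_eq_on R R _ A (F \o g) f0 1 t0 oA _ At0) => t At; exact: Fg.
have nn z : D z -> lprod (n z) (n z) = 1 by move=> _; exact: NN.
have Fn z a : D z -> lprod ('D_a F z) (n z) = 0 by move=> Dz; exact: Nf.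
have Finj z a : D z -> 'D_a F z = 0 -> a = 0 by move=> Dz; exact: inj.
have neg : lprod ('D_('D_1 g t0) F (g t0)) ('D_('D_1 g t0) F (g t0)) < 0 by rewrite dFg;
  exact: time.
have [G [psi [zeta [d0 [oG GD spsi d00 [szeta0 Qz zetaK cur null0]]]]]] :=
  null_coordinates_near oD sF sn nn Fn Finj oA sg AD At0 neg.
exists d0 => // d d_gt0 dd0.
set B := box (t0 - d) (t0 + d); have oB : open B by exact: box_open.
have Bs z : B z -> box (t0 - d0) (t0 + d0) z by exact: box_shrink.
have szeta : smooth B zeta by apply: smooth_subset szeta0.
have [k [ck kB kdom kfun kinv]] := compose_chart al oG GD spsi oB szeta (fun z Bz =>
  Qz z (Bs z Bz)) zetaK.
have dI t : t0 - d < t < t0 + d -> t0 - d0 < t < t0 + d0 by exact: interval_shrink.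
have BG z : B z -> G (zeta z) by move=> /Bs/Qz[].
have BD z : B z -> D (zeta z) by move=> /BG/GD.
pose K := F \o zeta; have KE : f \o cinv k = K by rewrite kinv.
pose m := n \o zeta; have mE : N \o cinv k = m by rewrite kinv.
have sK : smooth B K by exact: smooth_comp_mx BD szeta sF.
have null z : B z -> null_pair ('D_(1, 0) K z) ('D_(0, 1) K z) by move=> /Bs/null0[].
have pos z : B z -> 0 < lprod (lcross ('D_(1, 0) K z) ('D_(0, 1) K z)) (m z) by move=>
  /Bs/null0[].
have Km z v : B z -> lprod ('D_v K z) (m z) = 0.
  move=> Bz; rewrite (derive_comp v (smooth_differentiable szeta Bz) (smooth_differentiable sF (BD _ Bz))).
  by apply: Fn; exact: BD.
have diagB t : t0 - d < t < t0 + d -> B (t, - t) by move=> tI; rewrite /B box_diag.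
have zetag t : t0 - d < t < t0 + d -> zeta (t, - t) = g t.
  by move=> /dI/cur[_ Gt <-]; rewrite zetaK.
exists k; split; [exact: ck|exact: kB| | |].
- move=> t tI; have [[Jt lt] Gt pt] := cur t (dI t tI).
  have Bp : B (psi (g t)) by rewrite pt; exact: diagB.
  by rewrite kdom kfun; exact: (conj (conj lt (conj Gt Bp)) pt).
- rewrite KE; split=> //.
  apply: (cmc_equation_null oB sK null (N := m)) => z Bz.
    by split; [apply: nn; exact: BD|exact: Km|exact: Km|exact: pos].
  have [_ _ L0] := null z Bz; apply: mean_curvature_ln => //.
  rewrite -[in LHS]KE -[in LHS]mE; apply: cmc; last by rewrite kB.
  by split=> //; rewrite kB KE; exact: null_metric_ln.
- rewrite KE => t tI; have [[Jt lt] Gt pt] := cur t (dI t tI).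
  have Kf s : t0 - d < s < t0 + d -> K (s, - s) = f0 s.
    by move=> sI; rewrite /K /= zetag//; apply: Fg; have [] := cur s (dI s sI).
  have Bt := diagB t tI.
  have dd : 'D_1 f0 t = 'D_(1, 0) K (t, - t) - 'D_(0, 1) K (t, - t).
    have := @diag_derive R _ K f0 t (smooth_differentiable sK Bt).
    case=> [|//]; move: (open_nbhs_nbhs (conj (@oo_interval_open R (t0 - d) (t0 + d)) tI)).
    by apply: filterS => s; exact: Kf.
  have mc : m (t, - t) = N (c t) by rewrite /m /n /= zetag// /g /= cfunK.
  have VN : lprod (V t) (N (c t)) = 0.
    have : tangent_plane f (c t) (V t).
      by rewrite tp//; exists 0, 1; rewrite scale0r add0r scale1r.
    move=> [k' [ak' k'c] [a ->]]; rewrite -[in N _](cfunK k'c).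
    by apply: Nf => //; exists (c t).
  have VE : V t = 'D_(1, 0) K (t, - t) + 'D_(0, 1) K (t, - t).
    apply: (tangent_normal (null _ Bt) (N := m (t, - t))).
    - by apply: nn; exact: BD.
    - exact: Km.
    - exact: Km.
    - exact: pos.
    - by rewrite mc.
    - by rewrite -dd orth.
    - by rewrite -dd norm.
    - by rewrite -dd mc -derive1E; apply/positively_orientedE; exact: ori.
  by rewrite dd VE; split; [exact: Kf|exact: (half_comb _ _).1|exact: (half_comb _ _).2].
Qed.

End null_chart.

(** * Isometry of two solutions *)

Section isometry.
Variable R : realType.

Section transition.
Variables (M1 M2 : surface R) (k1 : chart R M1) (k2 : chart R M2).
Hypotheses (ck1 : coordinates k1) (ck2 : coordinates k2) (k12 : cimg k1 `<=` cimg k2).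

Let phi := cinv k2 \o cfun k1.

Lemma transition_cdom p : cdom k1 p -> cdom k2 (phi p) /\ cfun k2 (phi p) = cfun k1 p.
Proof. by move=> dp; apply: cinvK; apply: k12; exists p. Qed.

Lemma transition_continuous p : cdom k1 p -> {for p, continuous phi}.
Proof.
move=> dp; apply: (@continuous_comp _ _ _ (cfun k1) (cinv k2));
  first exact: cfun_continuous.
by apply: cinv_continuous; apply: k12; exists p.
Qed.

Lemma transition_open (k : chart R M1) (l : chart R M2) :
  open (cfun k @` (cdom k1 `&` cdom k `&` phi @^-1` cdom l)).
Proof.
rewrite -setIA setICA; apply: chart_image_open; apply: open_preimage;
  first exact: cdom_open.
  exact: cdom_open.
exact: transition_continuous.
Qed.

Lemma transition_smooth : smooth_between (cdom k1) phi.
Proof.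
split; first exact: transition_continuous.
move=> k l ak al; have [_ s1] := ck1 ak; have [s2 _] := ck2 al.
have o1 : open (cfun k @` (cdom k1 `&` cdom k `&` phi @^-1` cdom l)) by exact: transition_open.
have o2 : open (cfun k2 @` (cdom k2 `&` cdom l)) by apply: chart_image_open;
  exact: cdom_open.
apply: (smooth_comp_pair o1 o2 _ _ s2 (f := cfun k1 \o cinv k)).
  move=> _ [p [[k1p kp] lp] <-]; rewrite /= cfunK//.
  by have [d2 e2] := transition_cdom k1p; exists (phi p).
by apply: smooth_subset s1 => _ [p [[k1p kp] _] <-]; exists p.
Qed.

End transition.

(** Since [f1 = f2 \o phi], the chain rule alone makes [phi] preserve the induced metrics;
    smoothness in both directions holds because the two charts lie in the maximal atlases. *)
Lemma chart_isometry (M1 M2 : surface R) (k1 : chart R M1) (k2 : chart R M2)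
    (f1 : M1 -> 'rV[R]_3) (f2 : M2 -> 'rV[R]_3) :
  coordinates k1 -> coordinates k2 -> cimg k1 = cimg k2 ->
  (forall z, cimg k1 z -> f1 (cinv k1 z) = f2 (cinv k2 z)) -> smooth_map f2 ->
  surface_isometry f1 f2 (cdom k1) (cdom k2) (cinv k2 \o cfun k1) /\
  forall p, cdom k1 p -> f1 p = f2 ((cinv k2 \o cfun k1) p).
Proof.
move=> ck1 ck2 k12 f12 sf2; set phi := cinv k2 \o cfun k1.
have sub12 : cimg k1 `<=` cimg k2 by rewrite k12.
have sub21 : cimg k2 `<=` cimg k1 by rewrite k12.
have fphi p : cdom k1 p -> f1 p = f2 (phi p).
  by move=> dp; rewrite -{1}(cfunK dp) f12//; exists p.
split=> //; split.
- apply/seteqP; split=> [_ [p dp <-]|q dq]; first by have [] := transition_cdom sub12 dp.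
  have [d1 e1] := transition_cdom sub21 dq; exists (cinv k1 (cfun k2 q)) => //.
  by rewrite /phi /= [cfun k1 _]e1 cfunK.
- exact: transition_smooth.
- exists (cinv k1 \o cfun k2); first exact: transition_smooth.
  move=> p dp; have [d2 e2] := transition_cdom sub12 dp.
  by rewrite /= [cfun k2 _]e2 cfunK.
- move=> k l p a b ak al k1p kp lp Phi.
  set S := cfun k @` (cdom k1 `&` cdom k `&` phi @^-1` cdom l).
  have oS : open S by exact: transition_open.
  have Sp : S (cfun k p) by exists p.
  have sPhi : smooth S Phi by have [_] := transition_smooth ck1 ck2 sub12; apply.
  have PhiE q : cdom k q -> Phi (cfun k q) = cfun l (phi q) by move=> kq;
    rewrite /Phi /= cfunK.
  have F12 z : S z -> (f1 \o cinv k) z = (f2 \o cinv l \o Phi) z.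
    move=> [q [[k1q kq] lq] <-]; change (f1 (cinv k (cfun k q)) =
      f2 (cinv l (Phi (cfun k q)))).
    by rewrite (PhiE q kq) (cfunK kq) (cfunK lq); exact: fphi.
  have D v : 'D_('D_v Phi (cfun k p)) (f2 \o cinv l) (cfun l (phi p)) =
    'D_v (f1 \o cinv k) (cfun k p).
    rewrite (derive_eq_on v oS F12 Sp) -(PhiE p kp).
    apply/esym/derive_comp; first exact: smooth_differentiable sPhi Sp.
    by apply: (smooth_differentiable (sf2 l al)); rewrite PhiE//; exists (phi p).
  exact: (congr2 (@lprod R) (D a) (D b)).
Qed.

End isometry.

Theorem theorem3p1 (R : realType) (J : set R) (f0 V : R -> 'rV[R]_3) (H : R)
    (oJ : open J) (iJ : is_interval J) (J0 : J 0)
    (sf0 : smooth J f0) (regf0 : forall t, J t -> derive1 f0 t != 0)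
    (timef0 : forall t, J t -> lprod (derive1 f0 t) (derive1 f0 t) < 0)
    (sV : smooth J V) (regV : forall t, J t -> V t != 0)
    (orthV : forall t, J t -> lprod (V t) (derive1 f0 t) = 0)
    (normV : forall t, J t ->
       lprod (V t) (V t) = - lprod (derive1 f0 t) (derive1 f0 t))
    (H0 : H != 0) :
  (exists (W : set (R * R)) (oW : open W) (f : R * R -> 'rV[R]_3),
    [/\ W `<=` J `*` [set y | J (- y)],
        (forall x, J x -> W (x, - x)),
        cmc_with_cauchy_data J f0 V H oW f,
        (forall g, cmc_with_cauchy_data J f0 V H oW g ->
           forall z, W z -> g z = f z) &
        exists2 c : R -> open_surface oW,
          (forall t, J t -> open_incl oW (c t) = (t, - t)) &
          geometric_cauchy_solution J f0 V H (f \o open_incl oW) c]) /\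
  (forall (M1 M2 : surface R) (f1 : M1 -> 'rV[R]_3) (f2 : M2 -> 'rV[R]_3)
      (c1 : R -> M1) (c2 : R -> M2),
    geometric_cauchy_solution J f0 V H f1 c1 ->
    geometric_cauchy_solution J f0 V H f2 c2 ->
    forall t0, J t0 ->
    exists (U1 : set M1) (U2 : set M2) (phi : M1 -> M2),
      [/\ open_nbhs (c1 t0) U1, open_nbhs (c2 t0) U2,
          surface_isometry f1 f2 U1 U2 phi &
          forall p, U1 p -> f1 p = f2 (phi p)]).
Proof.
have time t : J t -> lprod ('D_1 f0 t) ('D_1 f0 t) < 0 by rewrite -derive1E; exact: timef0.
have orth t : J t -> lprod (V t) ('D_1 f0 t) = 0 by rewrite -derive1E; exact: orthV.
have norm t : J t -> lprod (V t) (V t) = - lprod ('D_1 f0 t) ('D_1 f0 t).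
  by rewrite -derive1E; exact: normV.
split.
  have [W [f [oW WJ WD Wbox [nf cf]]]] := null_cmc_exists H oJ sf0 sV time orth norm.
  exists W, oW, f; split=> //.
  - exact: cmc_with_cauchy_data_exists.
  - move=> g cg z Wz.
    have V0 : 0 < lprod (V 0) (V 0) by rewrite norm// oppr_gt0; exact: time.
    have [ng dg] := cmc_with_cauchy_data_null oJ J0 V0 WD cg.
    (* On a box inside [W] around [z] both maps solve the same Cauchy problem. *)
    have [a [b [Bz BW abJ]]] := Wbox z Wz.
    apply: (@null_cmc_unique R H a b a b f0 V g f) => //.
    + exact: null_cmc_subset BW ng.
    + exact: null_cmc_subset BW nf.
    + by move=> t /abJ; exact: dg.
    + by move=> t /abJ; exact: cf.
  - exact: open_cauchy_solution.
move=> M1 M2 f1 f2 c1 c2 sol1 sol2 t0 Jt0.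
have [d1 d10 k1P] := null_chart oJ time orth norm sol1 Jt0.
have [d2 d20 k2P] := null_chart oJ time orth norm sol2 Jt0.
(* A common size gives the two null charts the same image, so that one can be composed with the
   inverse of the other. *)
pose d := Num.min d1 d2; have d0 : 0 < d by rewrite lt_min d10.
have [k1 [ck1 im1 diag1 n1 i1]] : exists k1 : chart R M1,
  [/\ coordinates k1, cimg k1 = box (t0 - d) (t0 + d),
    forall t, t0 - d < t < t0 + d -> cdom k1 (c1 t) /\ cfun k1 (c1 t) = (t, - t),
    null_cmc H (box (t0 - d) (t0 + d)) (f1 \o cinv k1) &
    cauchy_data [set t | t0 - d < t < t0 + d] f0 V (f1 \o cinv k1)].
  by apply: k1P => //; rewrite ge_min lexx.
have [k2 [ck2 im2 diag2 n2 i2]] : exists k2 : chart R M2,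
  [/\ coordinates k2, cimg k2 = box (t0 - d) (t0 + d),
    forall t, t0 - d < t < t0 + d -> cdom k2 (c2 t) /\ cfun k2 (c2 t) = (t, - t),
    null_cmc H (box (t0 - d) (t0 + d)) (f2 \o cinv k2) &
    cauchy_data [set t | t0 - d < t < t0 + d] f0 V (f2 \o cinv k2)].
  by apply: k2P => //; rewrite ge_min lexx orbT.
have t0I : t0 - d < t0 < t0 + d by rewrite ltrDl ltrBlDr ltrDl d0.
have sf2 : smooth_map f2 by case: sol2 => _ _ _ [N [[[]]]].
have f12 z : cimg k1 z -> f1 (cinv k1 z) = f2 (cinv k2 z).
  by rewrite im1 => Bz; exact: (null_cmc_unique n1 n2 i1 i2 Bz Bz).
have [iso feq] := chart_isometry ck1 ck2 (etrans im1 (esym im2)) f12 sf2.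
exists (cdom k1), (cdom k2), (cinv k2 \o cfun k1); split=> //.
- by split; [exact: cdom_open|case: (diag1 t0 t0I)].
- by split; [exact: cdom_open|case: (diag2 t0 t0I)].
Qed.
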